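(* Define $$y_*=\inf\Big\{y\ge 0:\lambda_0\int_0^y S_g(u,u)\,du\ge 1\Big\},$$ with $y_*=\infty$ if the integral expression is strictly less than one for all $y\ge 0$. There exists a unique $\mu\in\mathcal S^+$ such that $\mu_0$ is the null measure. Its threshold function is $$\bar y_*(\mu_t)=\begin{cases}\infty & \text{if } 0\le t<y_*,\\ y_* & \text{if } y_*<\infty\text{ and }t\ge y_*.\end{cases}$$ Moreover, $\mu$ is determined by the integrals $$\langle\phi,\mu_t\rangle=\lambda_0\int_0^t\phi(u\wedge y_*,u)\,S_g(u\wedge y_*,u)\,du\qquad\text{for all }t\ge 0\text{ and all bounded continuous }\phi:\mathbb R_+^2\to\mathbb R.$$
   Context: **Notation.** $\mathbb R_+=[0,\infty)$; $\inf\emptyset=\infty$; $u\wedge v=\min\{u,v\}$; $\mathbf 1\{\cdot\}$ is an indicator. $\mathcal M_F^+(\mathbb R_+^2)$ is the space of finite nonnegative Borel measures on $\mathbb R_+^2$ with the weak topology; $\langle f,\mu\rangle=\int f\,d\mu$. $D_S[0,\infty)$ is the space of càdlàg functions $[0,\infty)\to S$. $C_c^1(\mathbb R_+^3)$ is the set of compactly supported continuously differentiable functions on $\mathbb R_+^3$ (one-sided derivatives on the boundary); values are written $\varphi_t(x,y)$. **Data and standing assumptions.** $\lambda_0>0$ is a constant and $g:\mathbb R_+^2\to\mathbb R_+$ is a probability density. $S_g(x,y)=\int_{[x,\infty)\times[y,\infty)}g(u,v)\,du\,dv$, $U_g=\{(x,y)\in\mathbb R_+^2:S_g(x,y)>0\}$,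 $U_g^c=\mathbb R_+^2\setminus U_g$. It is assumed that $g$ is locally bounded in $U_g$ (each $z\in U_g$ has a relatively open neighborhood $U\subset U_g$ in $\mathbb R_+^2$ on which $g$ is bounded) and that $S_g$ is continuously differentiable. The hazard rate vector field is $h_g=(h_g^x,h_g^y)=-\nabla\log S_g$ on $U_g$ and $h_g=0$ outside $U_g$. **Fluid problem.** For $\mu\in\mathcal M_F^+(\mathbb R_+^2)$ let $\bar y_*(\mu)=\inf\{y\ge 0:\mu(\mathbb R_+\times[0,y])\ge 1\}$ and $\bar r(\mu,y)=\mathbf 1\{y\le\bar y_*(\mu)\}$; $\bar r(\mu)$ denotes the function $(x,y)\mapsto\bar r(\mu,y)$. $\mathcal S^+$, the set of solutions of the fluid problem, consists of all $\mu\in D_{\mathcal M_F^+(\mathbb R_+^2)}[0,\infty)$ such that: (a) $\mu_t(U_g^c)=0$ for all $t\ge 0$; (b) the $y$-marginal $A\mapsto\mu_t(\mathbb R_+\times A)$ is absolutely continuous with respect to Lebesgue measure for all $t\ge 0$; (c) $\int_0^t\langle\bar r(\mu_s)h_g^x+h_g^y,\mu_s\rangle\,ds<\infty$ for all $t\ge 0$; (d) for all $t\ge 0$ and $\varphi\in C_c^1(\mathbb R_+^3)$, $$\langle\varphi_t,\mu_t\rangle=\langle\varphi_0,\mu_0\rangle+\lambda_0\int_0^t\varphi_s(0,0)\,ds-\int_0^t\langle\varphi_s[\bar r(\mu_s)h_g^x+h_g^y],\mu_s\rangle\,ds+\int_0^t\langle\partial_t\varphi_s+\bar r(\mu_s)\partial_x\varphi_s+\partial_y\varphi_s,\mu_s\rangle\,ds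 .$$ *)

(* Defs.v *)
From HB Require Import structures.
From mathcomp Require Import all_boot all_order all_algebra.
From mathcomp Require Import all_classical all_reals all_analysis.
From mathcomp Require Import giry.

Set Implicit Arguments.
Unset Strict Implicit.
Unset Printing Implicit Defensive.

Import Order.TTheory GRing.Theory Num.Theory.
Import numFieldNormedType.Exports.

Local Open Scope classical_set_scope.
Local Open Scope ring_scope.

Section half_spaces.
Context {R : realType}.

Definition nneg : set R := `[0, +oo[%classic.
Definition quad : set (R * R) := nneg `*` nneg.

(* R_+^3, a point being (t, (x, y)) *)
Definition octant : set (R * (R * R)) := nneg `*` quad.

(* Derivatives relative to [0, +oo[: the difference quotient is only taken at
   points s >= 0, so the derivative at 0 is the right derivative. *)
Definition derivable_nneg (f : R -> R) (a : R) : Prop :=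
  cvg ((fun s => (f s - f a) / (s - a)) @ within nneg a^').

Definition derive_nneg (f : R -> R) (a : R) : R :=
  lim ((fun s => (f s - f a) / (s - a)) @ within nneg a^').

Definition dx (f : R * R -> R) (z : R * R) : R :=
  derive_nneg (fun x => f (x, z.2)) z.1.
Definition dy (f : R * R -> R) (z : R * R) : R :=
  derive_nneg (fun y => f (z.1, y)) z.2.

Definition C1_quad (f : R * R -> R) : Prop :=
  [/\ {within quad, continuous f},
      forall z, quad z -> derivable_nneg (fun x => f (x, z.2)) z.1
                       /\ derivable_nneg (fun y => f (z.1, y)) z.2,
      {within quad, continuous (dx f)}
    & {within quad, continuous (dy f)}].

Definition dt3 (phi : R * (R * R) -> R) (p : R * (R * R)) : R :=
  derive_nneg (fun t => phi (t, p.2)) p.1.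
Definition dx3 (phi : R * (R * R) -> R) (p : R * (R * R)) : R :=
  dx (fun z => phi (p.1, z)) p.2.
Definition dy3 (phi : R * (R * R) -> R) (p : R * (R * R)) : R :=
  dy (fun z => phi (p.1, z)) p.2.

Definition C1_octant (phi : R * (R * R) -> R) : Prop :=
  [/\ {within octant, continuous phi},
      forall p, octant p ->
        [/\ derivable_nneg (fun t => phi (t, p.2)) p.1,
            derivable_nneg (fun x => phi (p.1, (x, p.2.2))) p.2.1
          & derivable_nneg (fun y => phi (p.1, (p.2.1, y))) p.2.2],
      {within octant, continuous (dt3 phi)},
      {within octant, continuous (dx3 phi)}
    & {within octant, continuous (dy3 phi)}].

(* The values of phi off R_+^3 are irrelevant and left unconstrained. *)
Definition C1c_octant (phi : R * (R * R) -> R) : Prop :=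
  C1_octant phi /\
  exists2 K : set (R * (R * R)), compact K &
    forall p, octant p -> ~ K p -> phi p = 0.

End half_spaces.

Section finite_measures.
Context {R : realType}.

(* Finite Borel measures on R_+^2, represented as the finite Borel measures on
   R^2 which do not charge the complement of R_+^2. Only values on measurable
   sets are meaningful, so two of them are compared with [measure_eq]. *)
Record finmeas : Type := FinMeas {
  finmeas_val :> {finite_measure set (R * R)%type -> \bar R};
  finmeas_quad : finmeas_val (~` quad) = 0%E
}.

HB.instance Definition _ := gen_eqMixin finmeas.
HB.instance Definition _ := gen_choiceMixin finmeas.

Definition bounded_continuous (phi : R * R -> R) : Prop :=
  {within quad, continuous phi} /\ [bounded phi z | z in quad].

Definition pairing (phi : R * R -> R) (mu : finmeas) : R :=
  \int[mu]_(z in quad) phi z.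

Definition test_pairings (mu : finmeas) :
    prod_topology (fun _ : {phi | bounded_continuous phi} => R : topologicalType) :=
  fun phi => pairing (sval phi) mu.

(* weak topology: the coarsest one making all pairings with bounded continuous
   functions continuous *)
HB.instance Definition _ :=
  Topological.copy finmeas (initial_topology test_pairings).

End finite_measures.
Arguments finmeas : clear implicits.

Lemma initial_cvgP (S : choiceType) (T : topologicalType) (f : S -> T)
    (F : set_system S) (s : S) : Filter F ->
  F --> (s : initial_topology f) <-> f @ F --> f s.
Proof.
move=> FF; split=> [Fs A /initial_continuous|fF A].
  by rewrite nbhs_simpl => /Fs.
rewrite nbhsE/= => -[B [[C oC CB] Bs] BA].
have Cs : (f @^-1` C) s by rewrite CB.
have nC : nbhs (f s) C by rewrite nbhsE; exists C.
have FC : F (f @^-1` C) by exact: (fF C nC).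
apply: (@filterS _ F FF (f @^-1` C)) FC; rewrite CB; exact: BA.
Qed.

Lemma finmeas_cvgP (R : realType) (F : set_system (finmeas R)) (m : finmeas R) :
  Filter F ->
  F --> m <-> (forall phi, bounded_continuous phi ->
                 pairing phi mu @[mu --> F] --> pairing phi m).
Proof.
move=> FF; rewrite (initial_cvgP test_pairings)//; split=> [h phi bc|h].
  by move/cvg_sup: h => /(_ (exist _ phi bc)) /initial_cvgP.
apply/cvg_sup => -[phi bc]; apply/initial_cvgP.
exact: h.
Qed.

Definition cadlag (R : realType) (S : topologicalType) (f : R -> S) : Prop :=
  (forall t : R, 0 <= t -> f @ t^'+ --> f t) /\
  (forall t : R, 0 < t -> exists l : S, f @ t^'- --> l).

Section data.
Context {R : realType}.
Implicit Types (g : R * R -> R) (z : R * R).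

Local Notation leb2 := (@lebesgue_measure R \x @lebesgue_measure R)%E.

Definition is_density g : Prop :=
  [/\ measurable_fun quad g, forall z, quad z -> 0 <= g z
    & (\int[leb2]_(z in quad) (g z)%:E = 1)%E].

Definition survival g z : R :=
  \int[leb2]_(w in `[z.1, +oo[ `*` `[z.2, +oo[) g w.

Definition Ug g : set (R * R) := [set z | quad z /\ 0 < survival g z].

Definition locally_bounded_Ug g : Prop :=
  forall z, Ug g z -> exists U : set (R * R),
    [/\ open U, U z, U `&` quad `<=` Ug g & [bounded g w | w in U `&` quad]].

Definition hazard_x g z : R :=
  if z \in Ug g then - dx (fun w => ln (survival g w)) z else 0.
Definition hazard_y g z : R :=
  if z \in Ug g then - dy (fun w => ln (survival g w)) z else 0.

End data.

Section fluid.
Context {R : realType}.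
Implicit Types (g : R * R -> R) (m : finmeas R) (mu : R -> finmeas R).

Definition ystar m : \bar R :=
  ereal_inf [set y%:E | y in [set y : R | 0 <= y /\ (1 <= m (nneg `*` `[0%R, y]))%E]].

Definition rbar m (z : R * R) : R := (z.2%:E <= ystar m)%E%:R.

Definition drift_rate g m (z : R * R) : R :=
  rbar m z * hazard_x g z + hazard_y g z.

Definition fluid_eq (lambda0 : R) g mu (phi : R * (R * R) -> R) (t : R) : Prop :=
  pairing (fun z => phi (t, z)) (mu t) =
    pairing (fun z => phi (0, z)) (mu 0)
    + lambda0 * \int[lebesgue_measure]_(s in `[0, t]) phi (s, (0, 0))
    - \int[lebesgue_measure]_(s in `[0, t])
        pairing (fun z => phi (s, z) * drift_rate g (mu s) z) (mu s)
    + \int[lebesgue_measure]_(s in `[0, t])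
        pairing (fun z => dt3 phi (s, z) + rbar (mu s) z * dx3 phi (s, z)
                          + dy3 phi (s, z)) (mu s).

(* A trajectory is a function on R of which only the values at t >= 0 matter. *)
Definition fluid_solution (lambda0 : R) g mu : Prop :=
  [/\ cadlag mu,
      forall t : R, 0 <= t -> mu t (quad `\` Ug g) = 0%E,
      forall t : R, 0 <= t ->
        content_dominates (@lebesgue_measure R) (fun A => mu t (nneg `*` A)),
      forall t : R, 0 <= t ->
        (\int[lebesgue_measure]_(s in `[0%R, t])
           \int[mu s]_(z in quad) (drift_rate g (mu s) z)%:E < +oo)%E
    & forall (t : R) phi, 0 <= t -> C1c_octant phi -> fluid_eq lambda0 g mu phi t].

Definition critical_age (lambda0 : R) g : \bar R :=
  ereal_inf [set y%:E | y in [set y : R | 0 <= y /\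
    1 <= lambda0 * \int[lebesgue_measure]_(u in `[0, y]) survival g (u, u)]].

End fluid.

(* Main.v *)
(* Write S for the survival function and h for the hazard field. Since
   h S = - grad S, testing the equation with phi / S removes the loss term, and
   only transport along the characteristics is left. Below the threshold
   every point moves along (1, 1) and above it along (0, 1), so a test function
   constant along the characteristics up to time t determines mu_t wherever
   S > 0, as soon as the thresholds of two solutions are known to agree. The
   y-marginal has density at most lambda0, and the mass at ages up to r < y_*
   stays below one as long as all thresholds exceed r, so no threshold is below
   y_*. Up to age y_* the solution is then known, which puts the thresholds at
   y_* from time y_* on. For existence, the image of the measure
   lambda0 S (u /\ y_*, u) du on [0, t] under u |-> (u /\ y_*, u) solves the
   equation, by Fubini on the triangle u <= s and the fundamental theorem of
   calculus along each characteristic. *)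

Require Import Defs.
From HB Require Import structures.
From mathcomp Require Import all_boot all_order all_algebra.
From mathcomp Require Import all_classical all_reals all_analysis.
From mathcomp Require Import giry measurable_realfun.
From mathcomp Require Import ring lra.

Import Order.TTheory GRing.Theory Num.Theory.
Import numFieldNormedType.Exports.
Local Open Scope classical_set_scope.
Local Open Scope ring_scope.

Set Implicit Arguments.
Unset Strict Implicit.
Unset Printing Implicit Defensive.

(** Two obstacles shape the uniqueness proof. First, [1 / S] is unbounded and meaningless where [S]
    vanishes. It is replaced by a C1 function [weight] that equals it where [S] is at least [e], and
    the test functions carry cutoffs in both coordinates confining them to a corner [x < a], [y < b]
    with [e <= S (a, b)]. Characteristics never move down or left, so [S] is at least [e] wherever
    the transported cutoffs are nonzero. Such corners cover [Ug]. Second, the characteristics have a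
    kink at age [y_*], so a function constant along them is not C1. The x-speed is therefore
    smoothed to fall from 1 to 0 on an interval of ages ending at [y_*], and the x-cutoff is chosen
    constant over that interval. This suffices because the solution is by then known to live on the
    diagonal below age [y_*]. Along an arbitrary solution the pairings are not known to be
    measurable in time. Identities between time integrals are therefore obtained pointwise in time,
    and inequalities from signs alone. *)

Section one_sided_derivatives.
Context {R : realType}.
Implicit Types (f g : R -> R) (a l : R).

Definition is_derive_nneg f a l : Prop :=
  (fun s => (f s - f a) / (s - a)) @ within nneg a^' --> l.

Lemma is_derive_nneg_near f a l : is_derive_nneg f a l <->
  forall A, nbhs l A ->
    nbhs a (fun s => s != a -> 0 <= s -> A ((f s - f a) / (s - a))).
Proof.
split=> H A Al.
  have {H} : nbhs a (fun s => s != a -> nneg s -> A ((f s - f a) / (s - a))) := H A Al.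
  apply: filterS => s h sa s0; apply: h => //.
  by rewrite /nneg /= in_itv /= s0.
change (nbhs a (fun s => s != a -> nneg s -> A ((f s - f a) / (s - a)))).
apply: filterS (H _ Al) => s h sa s0; apply: h => //.
by move: s0; rewrite /nneg /= in_itv /= andbT.
Qed.

Lemma cvg_within_nneg (q : R -> R) a l : q @ within nneg (nbhs a) --> l <->
  forall A, nbhs l A -> nbhs a (fun s => 0 <= s -> A (q s)).
Proof.
split=> H A Al.
  have {H} : nbhs a (fun s => nneg s -> A (q s)) := H A Al.
  by apply: filterS => s h s0; apply: h; rewrite /nneg /= in_itv /= s0.
change (nbhs a (fun s => nneg s -> A (q s))).
apply: filterS (H _ Al) => s h; rewrite /nneg /= in_itv /= andbT; exact: h.
Qed.

Lemma nneg_dnbhs_proper a : 0 <= a -> ProperFilter (within nneg a^').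
Proof.
move=> a0; apply: Build_ProperFilter_ex => A H.
have {H} : nbhs a (fun s => s != a -> nneg s -> A s) := H.
move=> /nbhs_ballP [e /= e0 H].
exists (a + e / 2); apply: H => /=.
- by rewrite /ball /= opprD addrA subrr add0r normrN gtr0_norm ?divr_gt0//; lra.
- by rewrite gt_eqF// ltrDl divr_gt0.
- by rewrite /nneg /= in_itv /= andbT addr_ge0// divr_ge0// ltW.
Qed.

(** Caratheodory's form: the difference quotient, completed by [l] at [a], is a factor [q]
    continuous at [a]. Product and chain rules become limits of such factors, without dividing by
    increments that may vanish. *)
Lemma is_derive_nnegP f a l :
  is_derive_nneg f a l <->
  exists q : R -> R, [/\ forall s, 0 <= s -> f s - f a = q s * (s - a),
    q a = l & q @ within nneg (nbhs a) --> l].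
Proof.
split=> [/is_derive_nneg_near fl|[q [fq qa /cvg_within_nneg ql]]].
  exists (fun s => if s == a then l else (f s - f a) / (s - a)); split.
  - move=> s _; case: eqVneq => [->|sa]; first by rewrite !subrr mulr0.
    by rewrite divfK// subr_eq0.
  - by rewrite eqxx.
  - apply/cvg_within_nneg => A Al; apply: filterS (fl _ Al) => s H ns.
    case: eqVneq => [_|sa]; first exact: nbhs_singleton.
    exact: H.
apply/is_derive_nneg_near => A Al; apply: filterS (ql _ Al) => s H sa ns.
by rewrite (fq _ ns) mulfK ?subr_eq0//; exact: H.
Qed.

Lemma is_derive_nneg_val f a l : 0 <= a -> is_derive_nneg f a l ->
  derivable_nneg f a /\ derive_nneg f a = l.
Proof.
move=> a0 fl; have := nneg_dnbhs_proper a0; split; first by apply/cvg_ex; exists l.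
exact/cvg_lim.
Qed.

Lemma derivable_nnegP f a : derivable_nneg f a -> is_derive_nneg f a (derive_nneg f a).
Proof. by []. Qed.

Lemma is_derive_nneg_cvg f a l : is_derive_nneg f a l ->
  f @ within nneg (nbhs a) --> f a.
Proof.
move/is_derive_nnegP => [q [fq qa ql]].
have H : (fun s => f a + q s * (s - a)) @ within nneg (nbhs a) --> f a + l * (a - a).
  apply: cvgD; first exact: cvg_cst.
  apply: cvgM => //; apply: cvgB; last exact: cvg_cst.
  by apply: cvg_within_filter; exact: cvg_id.
rewrite subrr mulr0 addr0 in H.
move/cvg_within_nneg: H => H; apply/cvg_within_nneg => A Al.
apply: filterS (H _ Al) => s h ns.
by have := h ns; rewrite /= -(fq _ ns) addrC subrK.
Qed.

Lemma is_derive_nnegM f g a l m : is_derive_nneg f a l -> is_derive_nneg g a m ->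
  is_derive_nneg (fun s => f s * g s) a (l * g a + f a * m).
Proof.
move=> fl gm; have gc := is_derive_nneg_cvg gm.
move: fl gm => /is_derive_nnegP[p [fp pa pl]] /is_derive_nnegP[q [gq qa qm]].
apply/is_derive_nnegP; exists (fun s => p s * g s + f a * q s); split.
- move=> s ns; rewrite mulrDl -mulrA [g s * _]mulrC mulrA -fp// -[f a * q s * _]mulrA -gq//.
  ring.
- by rewrite pa qa.
- apply: cvgD; first exact: cvgM.
  by apply: cvgM => //; exact: cvg_cst.
Qed.

(** The outer derivative is two-sided because [f s] may approach [f a] from either side. Its slope
    is set to [m] at [f a], so points with [f s = f a] need not be excluded. *)
Lemma is_derive_nneg_comp f (h : R -> R) a l m : is_derive_nneg f a l ->
  is_derive (f a : R) (1 : R) h m -> is_derive_nneg (h \o f) a (m * l).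
Proof.
move=> fl [hd hm]; have fc := is_derive_nneg_cvg fl.
move: fl => /is_derive_nnegP[p [fp pa pl]].
pose q y := if y == f a then m else (h y - h (f a)) / (y - f a).
have qc : q y @[y --> f a] --> m.
  move=> A Am; move: hd => /cvg_ex /= [z hz].
  have zm : z = m by rewrite -hm /derive; apply/esym/cvg_lim.
  rewrite {z}zm in hz.
  have {hz} : nbhs (0 : R) (fun t => t != 0 -> A (t^-1 *: (h (t *: (1 : R) + f a) - h (f a)))) :=
    hz _ Am.
  move=> /nbhs_ballP[e /= e0 H].
  apply/nbhs_ballP; exists e => //= y; rewrite /ball /= => ye.
  rewrite /q; case: eqVneq => [_|ya]; first exact: nbhs_singleton.
  have := H (y - f a); rewrite /ball /= sub0r normrN distrC => /(_ ye).
  rewrite subr_eq0 => /(_ ya); rewrite /GRing.scale /= mulr1 subrK.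
  by rewrite mulrC.
apply/is_derive_nnegP; exists (fun s => q (f s) * p s); split.
- move=> s ns; rewrite -mulrA -fp// /q /=; case: eqVneq => [->|fa].
    by rewrite !subrr mulr0.
  by rewrite divfK// subr_eq0.
- by rewrite pa /q eqxx.
- apply: cvgM => //; apply: (@cvg_comp _ _ _ f q); [exact: fc|exact: qc].
Qed.

Lemma is_derive_is_derive_nneg f a l : is_derive (a : R) (1 : R) f l -> is_derive_nneg f a l.
Proof.
move=> fl; have := @is_derive_nneg_comp id f a 1 l; rewrite mulr1; apply => //.
apply/is_derive_nnegP; exists (fun=> 1); split => //; first by move=> s _; rewrite mul1r.
exact: cvg_cst.
Qed.

Lemma is_derive_nneg_is_derive f a l : 0 < a -> is_derive_nneg f a l ->
  is_derive (a : R) (1 : R) f l.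
Proof.
move=> a0 /is_derive_nneg_near fl.
have H : (fun t : R => t^-1 *: ((f \o shift a) (t *: (1 : R)) - f a)) @ 0^' --> l.
  move=> A Al; change (nbhs (0 : R) (fun t => t != 0 ->
     A (t^-1 *: (f (t *: (1 : R) + a) - f a)))).
  move: (fl _ Al) => /nbhs_ballP[e /= e0 H]; apply/nbhs_ballP.
  exists (Num.min e a); rewrite /= ?lt_min ?e0 ?a0//.
  move=> t; rewrite /ball /= sub0r normrN lt_min => /andP[te ta] t0.
  have := H (t + a); rewrite /ball /= opprD addrCA subrr addr0 normrN => /(_ te).
  rewrite -subr_eq0 addrK => /(_ t0).
  have ta0 : 0 <= t + a by move: ta; rewrite ltr_norml => /andP[? _]; lra.
  by move=> /(_ ta0); rewrite /GRing.scale /= mulr1 mulrC.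
apply: DeriveDef; first by apply/cvg_ex; exists l.
exact/cvg_lim.
Qed.

Lemma nonincreasing_is_derive_nneg f a l : 0 <= a ->
  (forall x y, 0 <= x -> x <= y -> f y <= f x) ->
  is_derive_nneg f a l -> l <= 0.
Proof.
move=> a0 fni /is_derive_nneg_near fl; rewrite leNgt; apply/negP => l0.
have /fl /nbhs_ballP [e /= e0] : nbhs l (fun x => 0 < x) by exact: lt_nbhsr.
have e2 : 0 < e / 2 by rewrite divr_gt0.
have ee : e / 2 < e by lra.
move=> /(_ (a + e / 2)); rewrite /ball /= opprD addNKr normrN (gtr0_norm e2).
have nea : a + e / 2 != a by rewrite gt_eqF// ltrDl divr_gt0.
move=> /(_ ee nea).
have ae : 0 <= a + e / 2 by rewrite addr_ge0// divr_ge0// ltW.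
have fae : f (a + e / 2) <= f a by apply: fni => //; rewrite lerDl divr_ge0// ltW.
have -> : a + e / 2 - a = e / 2 by ring.
move=> /(_ ae); apply/negP; rewrite -leNgt mulr_le0_ge0 ?subr_le0//.
by rewrite invr_ge0 divr_ge0// ltW.
Qed.

End one_sided_derivatives.

(** * C1 cutoffs and truncations on the line *)

Section smooth_functions_of_one_variable.
Context {R : realType}.
Implicit Types (f df g dg : R -> R) (x p q C : R).

Definition C1_fun f df : Prop :=
  (forall x, is_derive (x : R) (1 : R) f (df x)) /\ continuous df.

(** For [sqpos] this replaces a discussion of one-sided limits at 0 by polynomial inequalities. *)
Lemma is_derive_quadratic f x l C :
  (forall h, `|f (x + h) - f x - h * l| <= C * h ^+ 2) -> is_derive (x : R) (1 : R) f l.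
Proof.
move=> H.
have fl : (fun t : R => t^-1 *: ((f \o shift x) (t *: (1 : R)) - f x)) @ 0^' --> l.
  apply/cvgrPdist_le => e e0; near=> t.
  have t0 : t != 0 by near: t; exact: nbhs_dnbhs_neq.
  rewrite /GRing.scale /= mulr1 [t + x]addrC.
  have -> : l - t^-1 * (f (x + t) - f x) = - (f (x + t) - f x - t * l) / t by field.
  rewrite normrM normrN normfV ler_pdivrMr ?normr_gt0//.
  apply: le_trans (H t) _; rewrite -real_normK ?num_real// expr2 mulrA ler_wpM2r//.
  have C0 : 0 < `|C| + 1 by rewrite ltr_wpDl.
  apply: (@le_trans _ _ ((`|C| + 1) * `|t|)).
    by rewrite ler_wpM2r// (le_trans (ler_norm _))// lerDl.
  rewrite mulrC -ler_pdivlMr//; near: t; apply: dnbhs0_le.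
  by rewrite divr_gt0.
apply: DeriveDef; first by apply/cvg_ex; exists l.
exact/cvg_lim.
Unshelve. all: by end_near. Qed.

Lemma C1_fun_cst (k : R) : C1_fun (fun=> k) (fun=> 0).
Proof. split; [move=> x; exact: is_derive_cst|move=> x; exact: cvg_cst]. Qed.

Lemma C1_fun_id : C1_fun id (fun=> 1).
Proof. split; [move=> x; exact: is_derive_id|move=> x; exact: cvg_cst]. Qed.

Lemma C1_fun_continuous f df : C1_fun f df -> continuous f.
Proof.
move=> [fd _] x; have [d _] := fd x.
exact/differentiable_continuous/derivable1_diffP.
Qed.

Lemma C1_funD f df g dg : C1_fun f df -> C1_fun g dg ->
  C1_fun (fun x => f x + g x) (fun x => df x + dg x).
Proof.
move=> [fd fc] [gd gc]; split=> x; first exact: is_deriveD.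
by apply: cvgD; [exact: fc|exact: gc].
Qed.

Lemma C1_funM f df g dg : C1_fun f df -> C1_fun g dg ->
  C1_fun (fun x => f x * g x) (fun x => df x * g x + f x * dg x).
Proof.
move=> Cf Cg; have fc' := C1_fun_continuous Cf; have gc' := C1_fun_continuous Cg.
move: Cf Cg => [fd fc] [gd gc]; split=> x.
  have := is_deriveM (fd x) (gd x).
  by rewrite /GRing.scale /= addrC [g x * _]mulrC.
by apply: cvgD; apply: cvgM; [exact: fc|exact: gc'|exact: fc'|exact: gc].
Qed.

Lemma C1_fun_comp f df g dg : C1_fun f df -> C1_fun g dg ->
  C1_fun (g \o f) (fun x => dg (f x) * df x).
Proof.
move=> Cf [gd gc]; have fc' := C1_fun_continuous Cf; case: Cf => [fd fc].
split=> x; first by have := is_derive1_comp (gd (f x)) (fd x).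
apply: cvgM; last exact: fc.
by apply: (@cvg_comp _ _ _ f dg); [exact: fc'|exact: gc].
Qed.

Lemma C1_funV g dg : (forall x, g x != 0) -> C1_fun g dg ->
  C1_fun (fun x => (g x)^-1) (fun x => - dg x / g x ^+ 2).
Proof.
move=> g0 Cg; have gc' := C1_fun_continuous Cg; case: Cg => [gd gc].
split=> x.
  have := is_deriveV (g0 x) (gd x).
  by rewrite /GRing.scale /= mulNr mulrC -mulNr.
apply: cvgM; first by apply: cvgN; exact: gc.
by apply: cvgV; [rewrite expf_neq0|apply: cvgM; exact: gc'].
Qed.

(** The simplest C1 function that vanishes on one half-line and is positive on the other; the
    cutoffs below are rational expressions in its translates. *)
Definition sqpos x : R := Num.max x 0 ^+ 2.

Lemma C1_fun_sqpos : C1_fun sqpos (fun x => 2 * Num.max x 0).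
Proof.
split=> x.
  apply: (@is_derive_quadratic _ _ _ 1) => h; rewrite /sqpos ler_norml.
  by case: (leP (x + h) 0) => ?; case: (leP x 0) => ?; apply/andP; split; nra.
apply: cvgM; first exact: cvg_cst.
by apply: (@continuous_max _ _ id (fun=> 0)); [exact: cvg_id|exact: cvg_cst].
Qed.

Lemma sqpos_ge0 x : 0 <= sqpos x.
Proof. exact: sqr_ge0. Qed.

Lemma sqpos_le0 x : x <= 0 -> sqpos x = 0.
Proof. by move=> x0; rewrite /sqpos max_r// expr0n. Qed.

Lemma sqpos_gt0 x : 0 < x -> 0 < sqpos x.
Proof. by move=> x0; rewrite /sqpos max_l ?exprn_gt0// ltW. Qed.

Lemma C1_fun_eq f df g dg : f =1 g -> df =1 dg -> C1_fun f df -> C1_fun g dg.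
Proof. by move=> /funext <- /funext <-. Qed.

Lemma C1_fun_affine (k m : R) : C1_fun (fun x => k * x + m) (fun=> k).
Proof.
apply: C1_fun_eq (C1_funD (C1_funM (C1_fun_cst k) C1_fun_id) (C1_fun_cst m)) => x //.
by rewrite mul0r add0r mulr1 addr0.
Qed.

Lemma C1_fun_sqpos_right p :
  C1_fun (fun x => sqpos (x - p)) (fun x => 2 * Num.max (x - p) 0).
Proof.
apply: C1_fun_eq (C1_fun_comp (C1_fun_affine 1 (- p)) C1_fun_sqpos) => x /=;
  by rewrite mul1r ?mulr1.
Qed.

Lemma C1_fun_sqpos_left q :
  C1_fun (fun x => sqpos (q - x)) (fun x => - (2 * Num.max (q - x) 0)).
Proof.
apply: C1_fun_eq (C1_fun_comp (C1_fun_affine (-1) q) C1_fun_sqpos) => x /=;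
  by rewrite mulN1r ?mulrN1 [- x + q]addrC.
Qed.

(** For [p < q], a nonincreasing C1 transition from 1 on [x <= p] to 0 on [q <= x]; the two terms of
    the denominator never vanish together. *)
Definition cut p q x : R := sqpos (q - x) / (sqpos (q - x) + sqpos (x - p)).

Definition dcut p q x : R :=
  - (2 * Num.max (q - x) 0 * sqpos (x - p) + sqpos (q - x) * (2 * Num.max (x - p) 0))
  / (sqpos (q - x) + sqpos (x - p)) ^+ 2.

Lemma cut_den_gt0 p q x : p < q -> 0 < sqpos (q - x) + sqpos (x - p).
Proof.
move=> pq; have [qx|qx] := ltP x q.
  by rewrite ltr_wpDr ?sqpos_ge0// sqpos_gt0// subr_gt0.
by rewrite ltr_wpDl ?sqpos_ge0// sqpos_gt0// subr_gt0 (lt_le_trans pq).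
Qed.

Lemma C1_fun_cut p q : p < q -> C1_fun (cut p q) (dcut p q).
Proof.
move=> pq; have D0 x := lt0r_neq0 (cut_den_gt0 x pq).
have A := C1_fun_sqpos_left q.
have B := C1_fun_sqpos_right p.
have D := C1_funM A (C1_funV D0 (C1_funD A B)).
by apply: C1_fun_eq D => x //; rewrite /dcut; field; exact: D0.
Qed.

Lemma cut_ge0 p q x : 0 <= cut p q x.
Proof. by rewrite /cut divr_ge0 ?addr_ge0 ?sqpos_ge0. Qed.

Lemma cut_le1 p q x : p < q -> cut p q x <= 1.
Proof.
move=> pq; rewrite /cut ler_pdivrMr ?cut_den_gt0// mul1r lerDl; exact: sqpos_ge0.
Qed.

Lemma cut_eq1 p q x : p < q -> x <= p -> cut p q x = 1.
Proof.
move=> pq xp; rewrite /cut (sqpos_le0 (x := x - p)) ?subr_le0// addr0 divff//.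
by rewrite gt_eqF// sqpos_gt0// subr_gt0 (le_lt_trans xp).
Qed.

Lemma cut_eq0 p q x : q <= x -> cut p q x = 0.
Proof. by move=> xp; rewrite /cut sqpos_le0 ?subr_le0// mul0r. Qed.

Lemma dcut_le0 p q x : dcut p q x <= 0.
Proof.
have m0 y : 0 <= Num.max y (0 : R) by rewrite le_max lexx orbT.
by rewrite /dcut mulNr oppr_le0 divr_ge0 ?sqr_ge0// addr_ge0// !mulr_ge0 ?sqpos_ge0 ?m0.
Qed.

Lemma dcut_eq0 p q x : x <= p \/ q <= x -> dcut p q x = 0.
Proof.
rewrite /dcut => -[xp|qx].
  rewrite (sqpos_le0 (x := x - p)) ?subr_le0// mulr0 add0r (max_r (x := x - p)) ?subr_le0//.
  by rewrite !mulr0 oppr0 mul0r.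
rewrite (sqpos_le0 (x := q - x)) ?subr_le0// (max_r (x := q - x)) ?subr_le0//.
by rewrite mulr0 !mul0r addr0 oppr0 mul0r.
Qed.

(* Equals [1 / x] for [q <= x] and vanishes for [x <= p]. *)
Definition recip p q x : R := sqpos (x - p) / (sqpos (q - x) + x * sqpos (x - p)).

(** The factor [x] can be negative only below [p], and there [sqpos (x - p)] vanishes. *)
Lemma recip_den_gt0 p q x : 0 <= p -> p < q -> 0 < sqpos (q - x) + x * sqpos (x - p).
Proof.
move=> p0 pq; have [qx|qx] := ltP x q.
  rewrite ltr_wpDr ?sqpos_gt0 ?subr_gt0//.
  have [xp|xp] := leP x p; first by rewrite sqpos_le0 ?subr_le0// mulr0.
  by rewrite mulr_ge0 ?sqpos_ge0// (le_trans p0)// ltW.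
have px : p < x by exact: lt_le_trans qx.
rewrite ltr_wpDl ?sqpos_ge0// mulr_gt0 ?sqpos_gt0 ?subr_gt0//.
exact: le_lt_trans px.
Qed.

Lemma C1_fun_recip p q : 0 <= p -> p < q -> exists drecip,
  [/\ C1_fun (recip p q) drecip, forall x, x <= p -> drecip x = 0
    & forall x, q <= x -> drecip x = - x ^- 2].
Proof.
move=> p0 pq; have D0 x := lt0r_neq0 (recip_den_gt0 x p0 pq).
have A := C1_fun_sqpos_left q.
have B := C1_fun_sqpos_right p.
have D := C1_funM B (C1_funV D0 (C1_funD A (C1_funM C1_fun_id B))).
pose d x := (2 * Num.max (x - p) 0 * (sqpos (q - x) + x * sqpos (x - p)) -
  sqpos (x - p) * (- (2 * Num.max (q - x) 0) + sqpos (x - p) + x * (2 * Num.max (x - p) 0)))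
  / (sqpos (q - x) + x * sqpos (x - p)) ^+ 2.
exists d; split.
- by apply: C1_fun_eq D => x //; rewrite /d; field; exact: D0.
- move=> x xp; rewrite /d (sqpos_le0 (x := x - p)) ?subr_le0// (max_r (x := x - p)) ?subr_le0//.
  by rewrite !mulr0 !mul0r subr0 mul0r.
- move=> x qx; have := D0 x.
  rewrite /d (sqpos_le0 (x := q - x)) ?subr_le0// (max_r (x := q - x)) ?subr_le0//.
  rewrite !add0r mulf_eq0 => /norP[x0 sx0]; rewrite mulr0 oppr0 add0r.
  by field; rewrite x0 sx0.
Qed.

Lemma recip_inv p q x : 0 <= p -> p < q -> q <= x -> recip p q x = x^-1.
Proof.
move=> p0 pq qx; rewrite /recip (sqpos_le0 (x := q - x)) ?subr_le0// add0r.
have px : 0 < x - p by rewrite subr_gt0 (lt_le_trans pq).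
by rewrite invfM mulrCA mulfV ?mulr1// gt_eqF// sqpos_gt0.
Qed.

(* C1, equal to [x] up to [p] and constant from [q] on. *)
Definition ramp p q x : R := x - sqpos (x - p) / (2 * (q - p)) + sqpos (x - q) / (2 * (q - p)).

Definition dramp p q x : R := 1 - Num.max (x - p) 0 / (q - p) + Num.max (x - q) 0 / (q - p).

Lemma C1_fun_ramp p q : p < q -> C1_fun (ramp p q) (dramp p q).
Proof.
move=> pq; have D0 : q - p != 0 by rewrite subr_eq0 gt_eqF.
have A := C1_fun_sqpos_right p.
have B := C1_fun_sqpos_right q.
pose k := (2 * (q - p))^-1.
have D := C1_funD (C1_funD C1_fun_id (C1_funM A (C1_fun_cst (- k)))) (C1_funM B (C1_fun_cst k)).
apply: C1_fun_eq D => x; rewrite /ramp /dramp /k; by field.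
Qed.

Lemma dramp_le p q x : p < q -> x <= p -> dramp p q x = 1.
Proof.
move=> pq xp; rewrite /dramp !max_r ?subr_le0 ?(le_trans xp) ?(ltW pq)//.
by rewrite !mul0r subr0 addr0.
Qed.

Lemma dramp_ge p q x : p < q -> q <= x -> dramp p q x = 0.
Proof.
move=> pq qx; have D0 : q - p != 0 by rewrite subr_eq0 gt_eqF.
rewrite /dramp !max_l ?subr_ge0 ?(le_trans (ltW pq))//; field => //.
Qed.

Lemma dramp_ge0 p q x : p < q -> 0 <= dramp p q x.
Proof.
move=> pq; have [xp|px] := leP x p; first by rewrite dramp_le.
have [qx|xq] := leP q x; first by rewrite dramp_ge.
rewrite /dramp (max_r (x := x - q)) ?subr_le0 ?(ltW xq)// mul0r addr0 max_l ?subr_ge0 ?(ltW px)//.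
by rewrite ler_pdivrMr ?subr_gt0// mul1r lerD2r ltW.
Qed.

Lemma ramp_nondecreasing p q x y : p < q -> x <= y -> ramp p q x <= ramp p q y.
Proof.
move=> pq; rewrite le_eqVlt => /predU1P[->//|xy].
have [rd _] := C1_fun_ramp pq; have rc := C1_fun_continuous (C1_fun_ramp pq).
have rc' : {within `[x, y], continuous (ramp p q)} by exact: continuous_subspaceT.
have [c _ rE] := @MVT R (ramp p q) (dramp p q) x y xy (fun z _ => rd z) rc'.
by rewrite -subr_ge0 rE mulr_ge0 ?dramp_ge0// subr_ge0 ltW.
Qed.

Lemma dramp_le1 p q x : p < q -> dramp p q x <= 1.
Proof.
move=> pq; have qp : 0 < q - p by rewrite subr_gt0.
rewrite /dramp -lerBrDr lerD2l lerN2 ler_pM2r ?invr_gt0//.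
by rewrite ge_max !le_max lexx orbT andbT lerB// ltW.
Qed.

Lemma ramp_sub_le p q x y : p < q -> x <= y -> ramp p q y - ramp p q x <= y - x.
Proof.
move=> pq; rewrite le_eqVlt => /predU1P[->|xy]; first by rewrite !subrr.
have [rd _] := C1_fun_ramp pq; have rc := C1_fun_continuous (C1_fun_ramp pq).
have rc' : {within `[x, y], continuous (ramp p q)} by exact: continuous_subspaceT.
have [c _ ->] := @MVT R (ramp p q) (dramp p q) x y xy (fun z _ => rd z) rc'.
by rewrite ler_piMl ?dramp_le1// subr_ge0 ltW.
Qed.

(** On [[p, q]] the gap [x - ramp p q x] is at most [(q - p) / 2], and [ramp] never exceeds its
    final value [q - (q - p) / 2]; the two bounds add up to [q]. This keeps a diagonal point,
    followed at the smoothed speed, inside the interval where the x-cutoff is constant. *)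
Lemma ramp_shift p q x s : p < q -> p <= x <= q -> 0 <= s ->
  p <= x + (ramp p q (x + s) - ramp p q x) <= q.
Proof.
move=> pq /andP[px xq] s0; apply/andP; split.
  by rewrite ler_wpDr// subr_ge0 ramp_nondecreasing// lerDl.
have qp : 0 < q - p by rewrite subr_gt0.
have ->: x + (ramp p q (x + s) - ramp p q x) = ramp p q (x + s) + sqpos (x - p) / (2 * (q - p)).
  by rewrite /ramp (sqpos_le0 (x := x - q)) ?subr_le0//; ring.
have h1 : sqpos (x - p) / (2 * (q - p)) <= (q - p) / 2.
  rewrite ler_pdivrMr; last lra.
  by rewrite /sqpos max_l ?subr_ge0//; nra.
suff : ramp p q (x + s) <= q - (q - p) / 2 by lra.
have [h|h] := leP (x + s) q.
  apply: le_trans (ramp_nondecreasing pq h) _.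
  rewrite /ramp subrr (sqpos_le0 (lexx 0)) /sqpos max_l ?(ltW qp)//.
  by rewrite mul0r addr0 le_eqVlt; apply/orP; left; apply/eqP; field; rewrite gt_eqF.
rewrite /ramp /sqpos !max_l; [|lra|lra].
by rewrite le_eqVlt; apply/orP; left; apply/eqP; field; rewrite gt_eqF.
Qed.

End smooth_functions_of_one_variable.

Lemma fin_num_measure_finite d (T : measurableType d) (R : realType)
    (m : {measure set T -> \bar R}) : fin_num_fun m ->
  exists m' : {finite_measure set T -> \bar R}, forall A, m' A = m A.
Proof.
move: m => [m [c1 c2]] mfin; pose M : {measure set T -> \bar R} := Measure.Pack (Measure.Class c2).
pose F := Measure_isFinite.Build _ _ _ M mfin.
by exists (HB.pack m c1 c2 F : {finite_measure set T -> \bar R}).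
Qed.

(** * Images of weighted measures and change of variables *)

Section weighted_image.
Context d1 d2 (T1 : measurableType d1) (T2 : measurableType d2) (R : realType).
Variables (mu : {measure set T1 -> \bar R}) (D : set T1) (w : T1 -> R) (z : T1 -> T2).
Hypotheses (mD : measurable D) (mw : measurable_fun D w)
  (w0 : forall x, D x -> 0 <= w x) (mz : measurable_fun setT z).

Let mzA A : measurable A -> measurable (D `&` z @^-1` A).
Proof. by move=> mA; apply: measurableI => //; rewrite -[X in measurable X]setTI; exact: mz. Qed.

(** Serves twice: with [z] the fluid trajectory on a time interval it produces the solution, and
    with [z] the identity it puts the density [w] on a measure of the plane. *)
Lemma weighted_image_measure :
  (\int[mu]_(x in D) (w x)%:E < +oo)%E ->
  exists m : {finite_measure set T2 -> \bar R}, forall A,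
    m A = (\int[mu]_(x in D `&` z @^-1` A) (w x)%:E)%E.
Proof.
move=> wfin.
pose m A := (\int[mu]_(x in D `&` z @^-1` A) (w x)%:E)%E.
have m0 : m set0 = 0%E by rewrite /m preimage_set0 setI0 integral_set0.
have mge0 A : (0 <= m A)%E.
  by apply: integral_ge0 => x [Dx _]; rewrite lee_fin w0.
have madd : semi_sigma_additive m.
  move=> F mF tF mUF; rewrite /m.
  have tDF : trivIset setT (fun i => D `&` z @^-1` F i).
    apply/trivIsetP => i j _ _ ij; rewrite setIACA setIid -preimage_setI.
    by move/trivIsetP : tF => /(_ _ _ Logic.I Logic.I ij) ->; rewrite preimage_set0 setI0.
  rewrite preimage_bigcup setI_bigcupr ge0_integral_bigcup//.
  - apply: is_cvg_nneseries => n _ _; apply: integral_ge0 => x [Dx _].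
    by rewrite lee_fin w0.
  - by move=> k; exact: mzA.
  - apply/measurable_EFinP; apply: measurable_funS mw => //.
    by move=> x [i _ []].
  - by move=> x [i _ [Dx _]]; rewrite lee_fin w0.
pose M := isMeasure.Build _ _ _ m m0 mge0 madd.
pose m' : {measure set T2 -> \bar R} := HB.pack m M.
have mfin : fin_num_fun m.
  move=> A mA; rewrite ge0_fin_numE//; apply: le_lt_trans wfin.
  apply: ge0_subset_integral => //; first exact: mzA.
    exact/measurable_EFinP.
exact: (@fin_num_measure_finite _ _ _ m' mfin).
Qed.

Variable m : {measure set T2 -> \bar R}.
Hypothesis mE : forall A, measurable A ->
  m A = (\int[mu]_(x in D `&` z @^-1` A) (w x)%:E)%E.

Import HBNNSimple.

(** Monotone convergence along the same simple functions on both sides; on a level set the identity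
    is [mE]. *)
Lemma ge0_integral_weighted_image (f : T2 -> \bar R) :
  measurable_fun setT f -> (forall y, 0 <= f y)%E ->
  (\int[m]_y f y = \int[mu]_(x in D) (f (z x) * (w x)%:E))%E.
Proof.
move=> mf f0; pose f_ := nnsfun_approx measurableT mf.
have mfz n : measurable_fun D (fun x => ((f_ n (z x))%:E * (w x)%:E)%E).
  apply: emeasurable_funM; last exact/measurable_EFinP.
  apply/measurable_EFinP/measurable_funTS; apply: measurableT_comp mz => //.
transitivity (limn (fun n => \int[m]_y (f_ n y)%:E)%E).
  rewrite -monotone_convergence//.
  - apply: eq_integral => y _; apply/esym/cvg_lim => //.
    by apply: cvg_nnsfun_approx => // *; exact: f0.
  - by move=> n; apply/measurable_EFinP/measurable_funTS.
  - by move=> n y _; rewrite lee_fin.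
  - by move=> y _ i j ij; rewrite lee_fin; exact/lefP/nd_nnsfun_approx.
rewrite [X in limn X](_ : _ =
    (fun n => \int[mu]_(x in D) ((f_ n (z x))%:E * (w x)%:E))%E).
  rewrite -monotone_convergence//.
  - apply: eq_integral => x /[!inE] Dx; apply/cvg_lim => //.
    apply: cvgeZr => //; apply: cvg_nnsfun_approx => // *; exact: f0.
  - by move=> n x Dx; rewrite mule_ge0// lee_fin// w0.
  - move=> x Dx i j ij; rewrite lee_wpmul2r ?lee_fin ?w0//.
    exact/lefP/nd_nnsfun_approx.
apply/funext => n.
have mfr r : measurable (f_ n @^-1` [set r]) by [].
under eq_integral do rewrite fimfunE -fsumEFin//.
rewrite ge0_integral_fsum//; last 2 first.
- by move=> y; exact/measurable_EFinP/measurable_funM.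
- by move=> y x _; rewrite nnfun_muleindic_ge0.
transitivity (\sum_(k \in range (f_ n))
    \int[mu]_(x in D) (k * \1_(f_ n @^-1` [set k]) (z x) * w x)%:E)%E.
  apply: eq_fsbigr => r /[!inE] -[y _ fy].
  have r0 : 0 <= r by rewrite -fy.
  under eq_integral do rewrite EFinM.
  under [RHS]eq_integral do rewrite -mulrA EFinM.
  rewrite ge0_integralZl_EFin//; last exact/measurable_EFinP.
  rewrite ge0_integralZl_EFin//; last 2 first.
    by move=> x Dx; rewrite lee_fin mulr_ge0// w0.
    apply/measurable_EFinP/measurable_funM => //; apply/measurable_funTS.
    by apply: measurableT_comp mz.
  congr (_ * _)%E; rewrite integral_indic// setIT mE//.
  rewrite setIC [RHS]integral_mkcond [LHS]integral_mkcond; apply: eq_integral => x _.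
  rewrite !patchE indicE; case: (boolP (x \in D)) => xD; last first.
    case: ifP => //; rewrite inE => -[_]; rewrite notin_setE in xD; done.
  rewrite inE in xD; case: (boolP (z x \in _)) => zx.
    by rewrite mem_set ?mul1r//; split => //; rewrite inE in zx.
  by rewrite mul0r memNset// => -[]; rewrite notin_setE in zx.
rewrite -ge0_integral_fsum//.
- apply: eq_integral => x _; rewrite fsumEFin// -EFinM; congr EFin.
  rewrite [in RHS]fimfunE mulrC !fsbig_finite//= big_distrr/=.
  by apply: eq_bigr => i _; rewrite mulrC.
- move=> r; apply/measurable_EFinP/measurable_funM => //.
  apply: measurable_funM => //; apply/measurable_funTS.
  by apply: measurableT_comp mz.
- move=> r x Dx; rewrite EFinM mule_ge0 ?lee_fin ?w0//.
  by have := nnfun_muleindic_ge0 (f_ n) r (z x); rewrite lee_fin.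
Qed.

Lemma ge0_integral_weighted_image_in B (f : T2 -> \bar R) : measurable B ->
  measurable_fun B f -> (forall y, B y -> 0 <= f y)%E ->
  (\int[m]_(y in B) f y = \int[mu]_(x in D `&` z @^-1` B) (f (z x) * (w x)%:E))%E.
Proof.
move=> mB mf f0; rewrite integral_mkcond ge0_integral_weighted_image.
- rewrite [RHS]integral_mkcondr; apply: eq_integral => x _.
  rewrite !patchE (_ : (x \in z @^-1` B) = (z x \in B)); last first.
    by apply/idP/idP; rewrite !inE.
  by case: ifP => //; rewrite mul0e.
- exact/(measurable_restrictT _ mB).
- by move=> y; rewrite patchE; case: ifPn => // /[!inE]; exact: f0.
Qed.

(** As [w] is nonnegative, the positive and negative parts of the weighted integrand are those of
    [f] times [w], so both sides are [fine] of the same difference, integrable or not. *)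
Lemma Rintegral_weighted_image B (f : T2 -> R) : measurable B ->
  measurable_fun B f ->
  \int[m]_(y in B) f y = \int[mu]_(x in D `&` z @^-1` B) (f (z x) * w x).
Proof.
move=> mB mf; rewrite /Rintegral integralE [in RHS]integralE.
have mf' : measurable_fun B (EFin \o f) by exact/measurable_EFinP.
rewrite !ge0_integral_weighted_image_in//.
- congr (fine (_ - _)%E); apply: eq_integral => x /[!inE] -[Dx _] /=.
    rewrite !funeposE -!EFin_max -EFinM maxr_pMl ?w0// mul0r//.
  by rewrite !funenegE -!EFinN -!EFin_max -EFinM maxr_pMl ?w0// mul0r mulNr.
- exact: measurable_funeneg.
- exact: measurable_funepos.
Qed.

End weighted_image.

(** * Measurability on the plane and on the quadrant *)

Section plane_measurability.
Context {R : realType}.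
Implicit Types (f : R * R -> R) (p z : R * R).

Lemma continuous_comp_within {T U V : topologicalType} (A : set U) (c : T -> U) (h : U -> V) :
  continuous c -> (forall x, A (c x)) -> {within A, continuous h} -> continuous (h \o c).
Proof.
move=> cc Ac /subspace_continuousP hA x B Bx.
have H : nbhs (c x) (fun u => A u -> B (h u)) := hA _ (Ac x) B Bx.
have {}H : nbhs x (fun y => A (c y) -> B (h (c y))) := cc x _ H.
change (nbhs x (fun y => B (h (c y)))).
by apply: filterS H => y; apply; exact: Ac.
Qed.

Definition box p (e : R) : set (R * R) :=
  `]p.1 - e, p.1 + e[%classic `*` `]p.2 - e, p.2 + e[%classic.

Lemma measurable_box p e : measurable (box p e).
Proof. by apply: measurableX; exact: measurable_itv. Qed.

(** An open set is the union of those boxes with rational centre and radius [1 / (n + 1)] that it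
    contains. The index set is countable, and boxes not contained in [O] are replaced by [set0]. *)
Lemma open_measurable_plane (O : set (R * R)) : open O -> measurable O.
Proof.
move=> oO; pose C (i : rat * rat * nat) := (ratr i.1.1 : R, ratr i.1.2 : R).
pose B (i : rat * rat * nat) := box (C i) (i.2.+1%:R^-1).
have -> : O = \bigcup_i (if pselect (B i `<=` O) then B i else set0).
  apply/seteqP; split=> [z Oz|z [i _]]; last by case: pselect => // h; exact: h.
  have := oO; rewrite openE => /(_ _ Oz); rewrite /interior /= => /nbhs_ballP[e /= e0 zO].
  (* Half of [e], because [z] and the other points of the box are each within one radius of the
     rational centre. *)
  have [n ne] : exists n : nat, (n.+1%:R^-1 : R) < e / 2.
    have [n _ H] := near_infty_natSinv_lt (PosNum (divr_gt0 e0 (ltr0n R 2))).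
    by exists n; exact: (H n (leqnn n)).
  have n0 : (0 : R) < n.+1%:R^-1 by rewrite invr_gt0.
  set d : R := n.+1%:R^-1 in ne n0.
  have Q x : exists q : rat, `|x - ratr q| < d.
    have [q] := @rat_in_itvoo R (x - d) (x + d) ltac:(lra).
    by rewrite in_itv /= => /andP[? ?]; exists q; rewrite ltr_norml; lra.
  have [q1 H1] := Q z.1; have [q2 H2] := Q z.2.
  move: H1 H2; rewrite !ltr_norml => /andP[? ?] /andP[? ?].
  exists (q1, q2, n) => //; case: pselect => [BO|nBO].
    by split=> /=; rewrite in_itv /= -/d; lra.
  exfalso; apply: nBO => y [/=]; rewrite !in_itv /= -/d => /andP[? ?] /andP[? ?].
  by apply: zO; split; rewrite /ball /= ltr_norml; lra.
apply: countable_bigcupT_measurable; first exact: countableP.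
by move=> i; case: pselect => ?; [exact: measurable_box|exact: measurable0].
Qed.

Lemma continuous_measurable_plane f : continuous f -> measurable_fun setT f.
Proof.
move=> cf; apply: (measurability _ (RGenOpens.measurableE R)).
move=> _ [_ [a [b ->] <-]]; rewrite setTI; apply: open_measurable_plane.
by move/continuousP : cf; apply; exact: interval_open.
Qed.

(** The retraction of the plane onto the quadrant. Composition with it turns continuity relative to
    the quadrant into continuity everywhere. *)
Definition clamp z : R * R := (Num.max z.1 0, Num.max z.2 0).

Lemma quadP z : quad z <-> 0 <= z.1 /\ 0 <= z.2.
Proof. by rewrite /quad /nneg; split=> -[/=]; rewrite !in_itv /= ?andbT. Qed.

Lemma quad_clamp z : quad (clamp z).
Proof. by apply/quadP; rewrite /clamp /= !le_max lexx !orbT. Qed.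

Lemma clamp_id z : quad z -> clamp z = z.
Proof. by case: z => x y /quadP[/= x0 y0]; rewrite /clamp /= !max_l. Qed.

Lemma clamp_continuous : continuous clamp.
Proof.
move=> z.
have H1 : (fun w : R * R => Num.max w.1 0) @ z --> Num.max z.1 0.
  by apply: (@continuous_max _ _ fst (fun=> 0)); [exact: cvg_fst|exact: cvg_cst].
have H2 : (fun w : R * R => Num.max w.2 0) @ z --> Num.max z.2 0.
  by apply: (@continuous_max _ _ snd (fun=> 0)); [exact: cvg_snd|exact: cvg_cst].
exact: cvg_pair H1 H2.
Qed.

Lemma measurable_quad : measurable (@quad R).
Proof. by apply: measurableX; exact: measurable_itv. Qed.

Lemma continuous_clamp f : {within quad, continuous f} -> continuous (f \o clamp).
Proof. by apply: continuous_comp_within; [exact: clamp_continuous|exact: quad_clamp]. Qed.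

Lemma within_quad_measurable f : {within quad, continuous f} -> measurable_fun quad f.
Proof.
move=> cf; apply: (eq_measurable_fun (f \o clamp)).
  by move=> z /[!inE] qz; rewrite /= clamp_id.
apply: measurable_funTS; apply: continuous_measurable_plane; exact: continuous_clamp.
Qed.

End plane_measurability.

(** * Uniqueness of measures from their values on corners *)

Section measures_on_the_quadrant.
Context {R : realType}.
Implicit Types (a b p q : R) (z : R * R).

Definition corner a b : set (R * R) := `]-oo, a[%classic `*` `]-oo, b[%classic.

Lemma cornerP a b z : corner a b z <-> z.1 < a /\ z.2 < b.
Proof. by rewrite /corner; split=> -[/=]; rewrite !in_itv. Qed.

Lemma measurable_corner a b : measurable (corner a b).
Proof. by apply: measurableX; exact: measurable_itv. Qed.

Lemma measurable_invr : measurable_fun setT (fun x : R => x^-1).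
Proof.
have -> : [set: R] = [set x | x != 0] `|` [set 0].
  by apply/seteqP; split=> x //= _; case: (eqVneq x 0) => ?; [right|left].
have on0 : open [set x : R | x != 0] by exact: open_neq.
apply/measurable_funU => //; first exact: open_measurable.
split.
  apply: open_continuous_measurable_fun => // x /[!inE] /= x0.
  exact: inv_continuous.
exact: measurable_fun_set1.
Qed.

(** The identity is measurable from the sigma-algebra generated by corners to the product one once
    both coordinates are, and a half-plane is a countable union of corners. *)
Lemma measurable_cornersE :
  @measurable _ (R * R)%type = <<s [set A | exists a b, A = corner a b] >>.
Proof.
pose G := [set A | exists a b, A = corner a b].
apply/seteqP; split; last first.
  apply: smallest_sub; first exact: sigma_algebra_measurable.
  by move=> _ [a [b ->]]; exact: measurable_corner.
move=> A mA; pose T := g_sigma_algebraType G.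
have mfst : measurable_fun [set: T] (fst : T -> R).
  apply: (measurability _ (RGenInftyO.measurableE R)).
  move=> _ [_ [a ->] <-]; rewrite setTI.
  have -> : (fst : T -> R) @^-1` `]-oo, a[%classic = \bigcup_n corner a n%:R.
    apply/seteqP; split=> z /=; last by move=> [n _ /cornerP[? _]]; rewrite in_itv.
    rewrite in_itv /= => za.
    exists (Num.truncn `|z.2|).+1 => //; apply/cornerP; split => //.
    exact: le_lt_trans (ler_norm _) (truncnS_gt _).
  by apply: bigcupT_measurable => n; apply: sub_sigma_algebra; exists a, n%:R.
have msnd : measurable_fun [set: T] (snd : T -> R).
  apply: (measurability _ (RGenInftyO.measurableE R)).
  move=> _ [_ [b ->] <-]; rewrite setTI.
  have -> : (snd : T -> R) @^-1` `]-oo, b[%classic = \bigcup_n corner n%:R b.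
    apply/seteqP; split=> z /=; last by move=> [n _ /cornerP[_ ?]]; rewrite in_itv.
    rewrite in_itv /= => za.
    exists (Num.truncn `|z.1|).+1 => //; apply/cornerP; split => //.
    exact: le_lt_trans (ler_norm _) (truncnS_gt _).
  by apply: bigcupT_measurable => n; apply: sub_sigma_algebra; exists n%:R, b.
have mid : measurable_fun [set: T] (id : T -> R * R) by apply/measurable_fun_pairP.
by have := mid measurableT A mA; rewrite setTI.
Qed.

(** Corners are stable under intersection, generate the Borel sets and exhaust the plane. *)
Lemma corner_measure_unique (m1 m2 : {finite_measure set (R * R)%type -> \bar R}) :
  (forall a b, m1 (corner a b) = m2 (corner a b)) ->
  forall A, measurable A -> m1 A = m2 A.
Proof.
move=> m12; apply: (measure_unique [set A | exists a b, A = corner a b]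
  (fun n => corner n%:R n%:R)).
- exact: measurable_cornersE.
- move=> _ _ [a [b ->]] [c [d ->]]; exists (Num.min a c), (Num.min b d).
  apply/seteqP; split=> z; first by move=> [/cornerP[? ?] /cornerP[? ?]];
    apply/cornerP; rewrite !lt_min; split; apply/andP.
  by move/cornerP; rewrite !lt_min => -[/andP[? ?] /andP[? ?]]; split; apply/cornerP.
- by move=> n; exists n%:R, n%:R.
- apply/seteqP; split=> // z _; exists (Num.truncn (`|z.1| + `|z.2|)).+1 => //.
  have := truncnS_gt (`|z.1| + `|z.2|) => h.
  have := ler_norm z.1; have := ler_norm z.2.
  have := normr_ge0 z.1; have := normr_ge0 z.2.
  by move=> *; apply/cornerP; split; lra.
- by move=> _ [a [b ->]]; exact: m12.
- by move=> n; rewrite -ge0_fin_numE ?fin_num_measure//; exact: measurable_corner.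
Qed.

Variables (m1 m2 : {finite_measure set (R * R)%type -> \bar R}) (w : R * R -> R)
  (a0 b0 C : R).
Hypotheses (mw : measurable_fun quad w) (w_ge0 : forall z, quad z -> 0 <= w z)
  (wC : forall z, quad z -> corner a0 b0 z -> 0 < w z <= C).

Let D a b := quad `&` corner a b.

Let mD a b : measurable (D a b).
Proof. by apply: measurableI; [exact: measurable_quad|exact: measurable_corner]. Qed.

Let mwD a b : measurable_fun (D a b) w.
Proof. by apply: measurable_funS mw; [exact: measurable_quad|move=> z []]. Qed.

Let intD_fin (m : {finite_measure set (R * R)%type -> \bar R}) :
  (\int[m]_(z in D a0 b0) (w z)%:E < +oo)%E.
Proof.
apply: (@le_lt_trans _ _ (\int[m]_(z in D a0 b0) C%:E)%E).
  apply: ge0_le_integral => //; [|exact/measurable_EFinP|].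
  - by move=> z [qz _]; rewrite lee_fin w_ge0.
  - by move=> z [qz cz]; rewrite lee_fin; case/andP: (wC qz cz).
by rewrite integral_cst// ltey_eq fin_numM// fin_num_measure.
Qed.

(** Each measure, restricted to the corner, is given the density [w]. The results agree on all
    corners, hence on all measurable sets, and integrating [1 / w] against them recovers the two
    restrictions, as [w] is positive there. *)
Lemma weighted_corner_unique :
  (forall a b, (a <= a0)%R -> (b <= b0)%R ->
    \int[m1]_(z in D a b) (w z)%:E = \int[m2]_(z in D a b) (w z)%:E)%E ->
  forall A, measurable A -> m1 (A `&` D a0 b0) = m2 (A `&` D a0 b0).
Proof.
move=> H.
have w0 z : D a0 b0 z -> 0 <= w z by move=> [? _]; exact: w_ge0.
have mid : measurable_fun setT (@id (R * R)) by exact: measurable_id.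
have [n1 n1E] := weighted_image_measure (mD a0 b0) (mwD (a:=a0) (b:=b0)) w0 mid (intD_fin m1).
have [n2 n2E] := weighted_image_measure (mD a0 b0) (mwD (a:=a0) (b:=b0)) w0 mid (intD_fin m2).
have n12 : forall A, measurable A -> n1 A = n2 A.
  apply: corner_measure_unique => a b; rewrite n1E n2E.
  have -> : D a0 b0 `&` id @^-1` corner a b = D (Num.min a a0) (Num.min b b0).
    apply/seteqP; split=> z.
      move=> [[qz /cornerP[? ?]] /cornerP[? ?]]; split => //.
      by apply/cornerP; rewrite !lt_min; split; apply/andP.
    move=> [qz /cornerP]; rewrite !lt_min => -[/andP[? ?] /andP[? ?]].
    by split; [split|]; try apply/cornerP.
  by apply: H; rewrite ge_min lexx orbT.
move=> A mA; have mAD : measurable (A `&` D a0 b0) by exact: measurableI.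
have mV : measurable_fun (A `&` D a0 b0) (fun z => ((w z)^-1)%:E).
  apply/measurable_EFinP; apply: measurableT_comp; first exact: measurable_invr.
  by apply: measurable_funS (mwD (a:=a0) (b:=b0)) => //; exact: subIsetr.
have key (m : {finite_measure set (R * R)%type -> \bar R})
    (n : {finite_measure set (R * R)%type -> \bar R}) :
    (forall A, n A = \int[m]_(x in D a0 b0 `&` id @^-1` A) (w x)%:E)%E ->
    m (A `&` D a0 b0) = (\int[n]_(z in A `&` D a0 b0) ((w z)^-1)%:E)%E.
  move=> nE.
  rewrite (ge0_integral_weighted_image_in (mD a0 b0) (mwD (a:=a0) (b:=b0)) w0 mid (fun A _ => nE A))//.
    have -> : D a0 b0 `&` id @^-1` (A `&` D a0 b0) = A `&` D a0 b0.
      by rewrite preimage_id setIC -setIA setIid.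
    rewrite -[LHS]mul1e -(integral_cst m mAD).
    apply: eq_integral => z /[!inE] -[_ [qz cz]]; rewrite -EFinM mulVf//.
    by rewrite gt_eqF//; case/andP: (wC qz cz).
  by move=> z [_ [qz cz]]; rewrite lee_fin invr_ge0; exact: w_ge0.
rewrite (key m1 n1 n1E) (key m2 n2 n2E); apply: eq_measure_integral => B mB _.
exact: n12.
Qed.

End measures_on_the_quadrant.

(** * Squeezing indicators of corners by test functions *)

Section squeezed_test_functions.
Context {R : realType}.
Implicit Types (a b p q : R) (z : R * R).
Variables (m1 m2 : {finite_measure set (R * R)%type -> \bar R}) (w : R * R -> R)
  (a0 b0 C : R).
Hypotheses (mw : measurable_fun quad w) (w_ge0 : forall z, quad z -> 0 <= w z)
  (wC : forall z, quad z -> corner a0 b0 z -> 0 < w z <= C).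

(** Squeezed between the indicators of [x < p] and [x < a], with no shape prescribed from [p] to
    [a]. *)
Definition between p a (c : R -> R) : Prop :=
  [/\ measurable_fun setT c, forall x, 0 <= c x <= 1,
      forall x, x < p -> c x = 1 & forall x, a <= x -> c x = 0].

Let D a b := quad `&` corner a b.

(** The product dominates the indicator of the inner corner and is dominated by that of the outer
    one, so one shared integral compares [n1] inside with [n2] outside. *)
Let squeeze (n1 n2 : {finite_measure set (R * R)%type -> \bar R}) a b p p' (c c' : R -> R) :
  a <= a0 -> b <= b0 -> between p a c -> between p' b c' ->
  \int[n1]_(z in quad) (c z.1 * c' z.2 * w z) =
    \int[n2]_(z in quad) (c z.1 * c' z.2 * w z) ->
  (\int[n1]_(z in D p p') (w z)%:E <= \int[n2]_(z in D a b) (w z)%:E)%E.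
Proof.
move=> aa bb [mc c01 c1 c0] [mc' c01' c1' c0'] /= H.
have mq : measurable (@quad R) := measurable_quad.
have mD a' b' : measurable (D a' b') by apply: measurableI => //; exact: measurable_corner.
have mcw : measurable_fun quad (fun z => c z.1 * c' z.2 * w z).
  apply: measurable_funM => //; apply: measurable_funM.
    by apply: measurable_funTS; apply: measurableT_comp mc _; exact: measurable_fst.
  by apply: measurable_funTS; apply: measurableT_comp mc' _; exact: measurable_snd.
have cw0 z : quad z -> 0 <= c z.1 * c' z.2 * w z.
  by move=> qz; rewrite !mulr_ge0 ?w_ge0//; [case/andP: (c01 z.1)|case/andP: (c01' z.2)].
have cwC z : quad z -> c z.1 * c' z.2 * w z <= Num.max C 0.
  move=> qz; rewrite le_max; apply/orP.
  have [za|az] := ltP z.1 a; last by right; rewrite c0// !mul0r.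
  have [zb|bz] := ltP z.2 b; last by right; rewrite c0'// mulr0 mul0r.
  left; have /andP[w0 wC'] := wC qz (iffRL (cornerP a0 b0 z)
    (conj (lt_le_trans za aa) (lt_le_trans zb bb))).
  apply: le_trans wC'; rewrite ler_piMl ?(ltW w0)//.
  by case/andP: (c01 z.1) => ? ?; case/andP: (c01' z.2) => ? ?; rewrite mulr_ile1.
have fin (n : {finite_measure set (R * R)%type -> \bar R}) :
    (\int[n]_(z in quad) (c z.1 * c' z.2 * w z)%:E)%E \is a fin_num.
  rewrite ge0_fin_numE; last by apply: integral_ge0 => z qz; rewrite lee_fin cw0.
  apply: (@le_lt_trans _ _ (\int[n]_(z in quad) (Num.max C 0)%:E)%E).
    by apply: ge0_le_integral => //; exact/measurable_EFinP.
  by rewrite integral_cst// ltey_eq fin_numM// fin_num_measure.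
apply: (@le_trans _ _ (\int[n1]_(z in quad) (c z.1 * c' z.2 * w z)%:E)%E).
  rewrite integral_mkcondr; apply: ge0_le_integral => //.
  - by move=> z qz; rewrite patchE; case: ifP => // _; rewrite lee_fin w_ge0.
  - apply/(measurable_restrict _ (measurable_corner _ _) mq).
    by apply/measurable_EFinP; apply: measurable_funS mw.
  - exact/measurable_EFinP.
  - move=> z qz; rewrite patchE; case: ifPn => [|_]; last by rewrite lee_fin cw0.
    by rewrite inE => /cornerP[zp zp']; rewrite lee_fin c1// c1'// !mul1r.
have -> : (\int[n1]_(z in quad) (c z.1 * c' z.2 * w z)%:E =
           \int[n2]_(z in quad) (c z.1 * c' z.2 * w z)%:E)%E.
  by rewrite -[LHS]fineK// -[RHS]fineK//; congr EFin.
rewrite [leRHS]integral_mkcondr; apply: ge0_le_integral => //.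
- exact/measurable_EFinP.
- apply/(measurable_restrict _ (measurable_corner _ _) mq).
  by apply/measurable_EFinP; apply: measurable_funS mw.
- move=> z qz; rewrite patchE; case: ifPn => [_|].
    rewrite lee_fin ler_piMl ?w_ge0//.
    by case/andP: (c01 z.1) => ? ?; case/andP: (c01' z.2) => ? ?; rewrite mulr_ile1.
  rewrite notin_setE => /cornerP; rewrite lee_fin => zab.
  have [za|az] := ltP z.1 a; last by rewrite c0// !mul0r.
  have [zb|bz] := ltP z.2 b; last by rewrite c0'// mulr0 mul0r.
  by exfalso; apply: zab.
Qed.

Let corner_limit (n : {finite_measure set (R * R)%type -> \bar R}) a b (M : \bar R) :
  0 < a -> 0 < b ->
  (forall p p', 0 <= p -> p < a -> 0 <= p' -> p' < b ->
    (\int[n]_(z in D p p') (w z)%:E <= M)%E) ->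
  (\int[n]_(z in D a b) (w z)%:E <= M)%E.
Proof.
move=> a_gt0 b_gt0 H.
have mq : measurable (@quad R) := measurable_quad.
have mD a' b' : measurable (D a' b') by apply: measurableI => //; exact: measurable_corner.
(* Scaling by [r k] keeps the inner vertex nonnegative and strictly inside the outer one. *)
pose r k : R := 1 - k.+1%:R^-1.
have r0 k : 0 <= r k by rewrite subr_ge0 invf_le1 ?ltr0n// ler1n.
have r1 k : r k < 1 by rewrite ltrBlDr ltrDl invr_gt0.
have rnd : {homo r : n m / (n <= m)%N >-> n <= m}.
  by move=> i j ij; rewrite lerD2l lerN2 lef_pV2 ?posrE// ler_nat.
have r_near x c : 0 < c -> x < c -> exists k, x < c * r k.
  move=> c0 xc; have d0 : 0 < (c - x) / c by rewrite divr_gt0// subr_gt0.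
  have [k _ /(_ k (leqnn k)) /= Hk] := near_infty_natSinv_lt (PosNum d0).
  exists k; move: Hk; rewrite ltr_pdivlMr// [_ * c]mulrC => Hk.
  by rewrite /r mulrBr mulr1 ltrBrDr addrC -ltrBrDr.
pose F k := D (a * r k) (b * r k).
have -> : D a b = \bigcup_k F k.
  apply/seteqP; split=> [z [qz /cornerP[za zb]]|z [k _ [qz /cornerP[za zb]]]].
    have [i Hi] := r_near _ _ a_gt0 za; have [j Hj] := r_near _ _ b_gt0 zb.
    exists (maxn i j) => //; split => //; apply/cornerP; split.
      by apply: lt_le_trans Hi _; rewrite ler_wpM2l ?(ltW a_gt0)// rnd// leq_maxl.
    by apply: lt_le_trans Hj _; rewrite ler_wpM2l ?(ltW b_gt0)// rnd// leq_maxr.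
  split => //; apply/cornerP; split.
    by apply: lt_trans za _; rewrite gtr_pMr.
  by apply: lt_trans zb _; rewrite gtr_pMr.
have mUF : measurable (\bigcup_k F k) by apply: bigcupT_measurable => k; exact: mD.
have ndF : nondecreasing_seq F.
  move=> i j ij; apply/subsetPset => z [qz /cornerP[za zb]].
  split => //; apply/cornerP; split.
    by apply: lt_le_trans za _; rewrite ler_wpM2l ?(ltW a_gt0)// rnd.
  by apply: lt_le_trans zb _; rewrite ler_wpM2l ?(ltW b_gt0)// rnd.
have cv := @ge0_nondecreasing_set_cvg_integral _ _ _ F (fun z => (w z)%:E) n ndF
  (fun k => mD _ _) _ _.
rewrite -(cvg_lim _ (cv _ _))//; last 2 first.
- move=> k; apply/measurable_EFinP; apply: measurable_funS mw => //.
  by move=> z [].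
- by move=> k z [qz _]; rewrite lee_fin w_ge0.
apply: lime_le.
  apply/cvg_ex; eexists; apply: cv.
    move=> k; apply/measurable_EFinP; apply: measurable_funS mw => //.
    by move=> z [].
  by move=> k z [qz _]; rewrite lee_fin w_ge0.
apply: nearW => k; apply: H.
- by rewrite mulr_ge0// ltW.
- by rewrite gtr_pMr.
- by rewrite mulr_ge0// ltW.
- by rewrite gtr_pMr.
Qed.

(** Each inner corner may come with its own pair [c], [c']: only the inner corner is passed to the
    limit, not the test functions. This freedom is what later lets the x-cutoff be adapted to the
    critical age. *)
Lemma squeezed_measure_unique : 0 < a0 -> 0 < b0 ->
  (forall a b p p', 0 < a <= a0 -> 0 < b <= b0 -> 0 <= p < a -> 0 <= p' < b ->
    exists c c', [/\ between p a c, between p' b c' &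
      \int[m1]_(z in quad) (c z.1 * c' z.2 * w z) =
      \int[m2]_(z in quad) (c z.1 * c' z.2 * w z)]) ->
  forall A, measurable A -> m1 (A `&` D a0 b0) = m2 (A `&` D a0 b0).
Proof.
move=> a00 b00 H; apply: weighted_corner_unique wC _ => // a b aa bb.
have D0 a' b' : a' <= 0 \/ b' <= 0 -> D a' b' = set0.
  by move=> h; apply/seteqP; split => // z [/quadP[? ?] /cornerP[? ?]]; lra.
rewrite -/(D a b).
have [a_le0|a_gt0] := leP a 0; first by rewrite D0 ?integral_set0//; left.
have [b_le0|b_gt0] := leP b 0; first by rewrite D0 ?integral_set0//; right.
have HH p p' : 0 <= p -> p < a -> 0 <= p' -> p' < b -> exists c c',
    [/\ between p a c, between p' b c' &
      \int[m1]_(z in quad) (c z.1 * c' z.2 * w z) =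
      \int[m2]_(z in quad) (c z.1 * c' z.2 * w z)].
  by move=> *; apply: H; apply/andP.
apply/eqP; rewrite eq_le; apply/andP; split; apply: corner_limit => // p p' p0 pa p'0 pb.
  by have [c [c' [? ? ?]]] := HH p p' p0 pa p'0 pb; apply: squeeze; eassumption.
have [c [c' [? ? E]]] := HH p p' p0 pa p'0 pb.
by apply: (squeeze aa bb _ _ (esym E)).
Qed.

End squeezed_test_functions.

(** * Calculus of C1 functions on the octant *)

Section C1_functions_on_the_octant.
Context {R : realType}.
Implicit Types (p : R * (R * R)) (phi psi f : R * (R * R) -> R).

Definition oct_continuous phi : Prop :=
  forall p, octant p -> phi @ within octant (nbhs p) --> phi p.

Lemma oct_continuousP phi : oct_continuous phi <-> {within octant, continuous phi}.
Proof. by split=> [H|/subspace_continuousP//]; apply/subspace_continuousP. Qed.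

Lemma octantP p : octant p <-> [/\ 0 <= p.1, 0 <= p.2.1 & 0 <= p.2.2].
Proof.
rewrite /octant; split=> [[/= p1 /quadP[p2 p3]]|[p1 p2 p3]]; last first.
  by split; [rewrite /nneg /= in_itv /= p1|exact/quadP].
by split => //; move: p1; rewrite /nneg /= in_itv /= andbT.
Qed.

Lemma continuous_oct_continuous phi : continuous phi -> oct_continuous phi.
Proof. by move=> H p _; apply: cvg_within_filter; exact: H. Qed.

Lemma eq_oct_continuous phi psi : (forall p, octant p -> phi p = psi p) ->
  oct_continuous phi -> oct_continuous psi.
Proof.
move=> e H p op; rewrite -e// => A Ap.
have {}H : nbhs p (fun q => octant q -> A (phi q)) := H p op A Ap.
change (nbhs p (fun q => octant q -> A (psi q))).
by apply: filterS H => q Hq oq; rewrite -e//; exact: Hq.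
Qed.

Lemma oct_continuousD phi psi : oct_continuous phi -> oct_continuous psi ->
  oct_continuous (fun p => phi p + psi p).
Proof. by move=> H1 H2 p op; apply: cvgD; [exact: H1|exact: H2]. Qed.

Lemma oct_continuousM phi psi : oct_continuous phi -> oct_continuous psi ->
  oct_continuous (fun p => phi p * psi p).
Proof. by move=> H1 H2 p op; apply: cvgM; [exact: H1|exact: H2]. Qed.

Lemma oct_continuous_comp phi (h : R -> R) : oct_continuous phi -> continuous h ->
  oct_continuous (h \o phi).
Proof. by move=> H1 H2 p op; apply: (@cvg_comp _ _ _ phi h); [exact: H1|exact: H2]. Qed.

Lemma oct_continuous_snd (f : R * R -> R) : {within quad, continuous f} ->
  oct_continuous (fun p => f p.2).
Proof.
move=> /continuous_clamp cf; apply: (@eq_oct_continuous (fun p => f (clamp p.2))).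
  by move=> p /octantP[_ p2 p3]; rewrite clamp_id//; exact/quadP.
apply: continuous_oct_continuous => p.
by apply: (@cvg_comp _ _ _ snd (f \o clamp)); [exact: cvg_snd|exact: cf].
Qed.

(** Carries the partial derivatives as data, so that products and compositions have explicit ones,
    whereas [C1_octant] only knows them as limits. *)
Record C1_oct f ft fx fy : Prop := C1Oct {
  C1_oct_cont : oct_continuous f;
  C1_oct_ct : oct_continuous ft;
  C1_oct_cx : oct_continuous fx;
  C1_oct_cy : oct_continuous fy;
  C1_oct_t : forall p, octant p -> is_derive_nneg (fun t => f (t, p.2)) p.1 (ft p);
  C1_oct_x : forall p, octant p -> is_derive_nneg (fun x => f (p.1, (x, p.2.2))) p.2.1 (fx p);
  C1_oct_y : forall p, octant p -> is_derive_nneg (fun y => f (p.1, (p.2.1, y))) p.2.2 (fy p) }.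

Lemma C1_octant_oct f : C1_octant f -> C1_oct f (dt3 f) (dx3 f) (dy3 f).
Proof.
move=> [c0 c1 ct cx cy]; split; try exact/oct_continuousP;
  by move=> p /c1[? ? ?]; exact: derivable_nnegP.
Qed.

Lemma C1_oct_octant f ft fx fy : C1_oct f ft fx fy -> C1_octant f /\
  forall p, octant p -> [/\ dt3 f p = ft p, dx3 f p = fx p & dy3 f p = fy p].
Proof.
move=> [c ct cx cy dt dxx dyy].
have E p : octant p -> [/\ dt3 f p = ft p, dx3 f p = fx p & dy3 f p = fy p].
  move=> op; have /octantP[p1 p2 p3] := op; split.
  - exact: (is_derive_nneg_val p1 (dt p op)).2.
  - exact: (is_derive_nneg_val p2 (dxx p op)).2.
  - exact: (is_derive_nneg_val p3 (dyy p op)).2.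
split => //; split.
- exact/oct_continuousP.
- move=> p op; have /octantP[p1 p2 p3] := op; split.
  + exact: (is_derive_nneg_val p1 (dt p op)).1.
  + exact: (is_derive_nneg_val p2 (dxx p op)).1.
  + exact: (is_derive_nneg_val p3 (dyy p op)).1.
- by apply/oct_continuousP; apply: eq_oct_continuous ct => p /E[].
- by apply/oct_continuousP; apply: eq_oct_continuous cx => p /E[].
- by apply/oct_continuousP; apply: eq_oct_continuous cy => p /E[].
Qed.

Lemma C1_octM f ft fx fy g gt gx gy : C1_oct f ft fx fy -> C1_oct g gt gx gy ->
  C1_oct (fun p => f p * g p) (fun p => ft p * g p + f p * gt p)
    (fun p => fx p * g p + f p * gx p) (fun p => fy p * g p + f p * gy p).
Proof.
move=> [fc fct fcx fcy fdt fdx fdy] [gc gct gcx gcy gdt gdx gdy]; split.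
- exact: oct_continuousM.
- by apply: oct_continuousD; exact: oct_continuousM.
- by apply: oct_continuousD; exact: oct_continuousM.
- by apply: oct_continuousD; exact: oct_continuousM.
- by move=> [t [x y]] op; have := is_derive_nnegM (fdt _ op) (gdt _ op).
- by move=> [t [x y]] op; have := is_derive_nnegM (fdx _ op) (gdx _ op).
- by move=> [t [x y]] op; have := is_derive_nnegM (fdy _ op) (gdy _ op).
Qed.

Lemma C1_oct_comp f ft fx fy (h dh : R -> R) : C1_oct f ft fx fy -> C1_fun h dh ->
  C1_oct (fun p => h (f p)) (fun p => dh (f p) * ft p) (fun p => dh (f p) * fx p)
    (fun p => dh (f p) * fy p).
Proof.
move=> [fc fct fcx fcy fdt fdx fdy] Ch; have hc := C1_fun_continuous Ch.
move: Ch => [hd dhc]; split.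
- exact: oct_continuous_comp fc hc.
- by apply: oct_continuousM => //; exact: oct_continuous_comp fc dhc.
- by apply: oct_continuousM => //; exact: oct_continuous_comp fc dhc.
- by apply: oct_continuousM => //; exact: oct_continuous_comp fc dhc.
- by move=> [t [x y]] op; exact: is_derive_nneg_comp (fdt _ op) (hd _).
- by move=> [t [x y]] op; exact: is_derive_nneg_comp (fdx _ op) (hd _).
- by move=> [t [x y]] op; exact: is_derive_nneg_comp (fdy _ op) (hd _).
Qed.

Lemma oct_continuous_cst (k : R) : oct_continuous (fun=> k).
Proof. by move=> p op; exact: cvg_cst. Qed.

(* The argument of the first cutoff in the test functions. In use, [K] is [id],
   [ramp p q] or constant. *)
Lemma C1_oct_shift (K dK : R -> R) (T : R) : C1_fun K dK ->
  C1_oct (fun p => p.2.1 + (K (p.2.2 + (T - p.1)) - K p.2.2))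
    (fun p => - dK (p.2.2 + (T - p.1))) (fun=> 1)
    (fun p => dK (p.2.2 + (T - p.1)) - dK p.2.2).
Proof.
move=> CK; have Kc := C1_fun_continuous CK; have [Kd dKc] := CK.
have cc1 : continuous (fun p : R * (R * R) => p.2.2 + (T - p.1)).
  move=> p; apply: cvgD.
    by apply: (@cvg_comp _ _ _ snd snd); exact: cvg_snd.
  by apply: cvgB; [exact: cvg_cst|exact: cvg_fst].
have cc2 : continuous (fun p : R * (R * R) => p.2.2).
  by move=> p; apply: (@cvg_comp _ _ _ snd snd); exact: cvg_snd.
have cc3 : continuous (fun p : R * (R * R) => p.2.1).
  by move=> p; apply: (@cvg_comp _ _ _ snd fst); [exact: cvg_snd|exact: cvg_fst].
have cco (h : R -> R) (l : R * (R * R) -> R) : continuous h -> continuous l ->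
    continuous (fun p => h (l p)).
  by move=> hc lc p; apply: (@cvg_comp _ _ _ l h); [exact: lc|exact: hc].
split.
- apply: continuous_oct_continuous => p; apply: cvgD; first exact: cc3.
  by apply: cvgB; exact: cco.
- by apply: continuous_oct_continuous => p; apply: cvgN; exact: cco.
- exact: oct_continuous_cst.
- by apply: continuous_oct_continuous => p; apply: cvgB; exact: cco.
- move=> [t [x y]] _ /=; apply: is_derive_is_derive_nneg.
  have := (C1_funD (C1_fun_comp (C1_fun_affine (-1) (y + T)) CK)
     (C1_fun_cst (x - K y))).1 t.
  rewrite /= mulN1r mulrN1 addr0.
  have -> : - t + (y + T) = y + (T - t) by ring.
  rewrite (_ : (fun x0 : R => K (-1 * x0 + (y + T)) + (x - K y)) =
    (fun t0 : R => x + (K (y + (T - t0)) - K y)))//.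
  by apply/funext => s; rewrite mulN1r (_ : - s + (y + T) = y + (T - s)); ring.
- move=> [t [x y]] _ /=; apply: is_derive_is_derive_nneg.
  have := (C1_funD C1_fun_id (C1_fun_cst (K (y + (T - t)) - K y))).1 x.
  by rewrite /= addr0.
- move=> [t [x y]] _ /=; apply: is_derive_is_derive_nneg.
  have := (C1_funD (C1_funD (C1_fun_comp (C1_fun_affine 1 (T - t)) CK)
     (C1_funM (C1_fun_cst (-1)) CK)) (C1_fun_cst x)).1 y.
  rewrite /= mul1r mulr1 mul0r add0r addr0 mulN1r.
  rewrite (_ : (fun x0 : R => K (1 * x0 + (T - t)) + -1 * K x0 + x) =
    (fun y0 : R => x + (K (y0 + (T - t)) - K y0)))//.
  by apply/funext => s; rewrite mul1r; ring.
Qed.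

Lemma C1_oct_age (c dc : R -> R) (T : R) : C1_fun c dc ->
  C1_oct (fun p => c (p.2.2 + (T - p.1)))
    (fun p => - dc (p.2.2 + (T - p.1))) (fun=> 0)
    (fun p => dc (p.2.2 + (T - p.1))).
Proof.
move=> CK; have Kc := C1_fun_continuous CK; have [Kd dKc] := CK.
have cc1 : continuous (fun p : R * (R * R) => p.2.2 + (T - p.1)).
  move=> p; apply: cvgD.
    by apply: (@cvg_comp _ _ _ snd snd); exact: cvg_snd.
  by apply: cvgB; [exact: cvg_cst|exact: cvg_fst].
have cco (h : R -> R) : continuous h -> continuous (fun p : R * (R * R) => h (p.2.2 + (T - p.1))).
  by move=> hc p; apply: (@cvg_comp _ _ _ _ h); [exact: cc1|exact: hc].
split.
- by apply: continuous_oct_continuous; exact: cco.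
- by apply: continuous_oct_continuous => p; apply: cvgN; exact: cco.
- exact: oct_continuous_cst.
- by apply: continuous_oct_continuous; exact: cco.
- move=> [t [x y]] _ /=; apply: is_derive_is_derive_nneg.
  have := (C1_fun_comp (C1_fun_affine (-1) (y + T)) CK).1 t.
  rewrite /= mulN1r mulrN1.
  have -> : - t + (y + T) = y + (T - t) by ring.
  rewrite (_ : _ \o _ = (fun t0 : R => c (y + (T - t0))))//.
  by apply/funext => s /=; rewrite mulN1r (_ : - s + (y + T) = y + (T - s)); ring.
- by move=> [t [x y]] _ /=; apply: is_derive_is_derive_nneg; exact: is_derive_cst.
- move=> [t [x y]] _ /=; apply: is_derive_is_derive_nneg.
  have := (C1_fun_comp (C1_fun_affine 1 (T - t)) CK).1 y.
  rewrite /= mul1r mulr1 (_ : _ \o _ = (fun y0 : R => c (y0 + (T - t))))//.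
  by apply/funext => s /=; rewrite mul1r.
Qed.

Lemma C1_oct_time (c dc : R -> R) : C1_fun c dc ->
  C1_oct (fun p => c p.1) (fun p => dc p.1) (fun=> 0) (fun=> 0).
Proof.
move=> Cc; have cc := C1_fun_continuous Cc; have [cd dcc] := Cc.
have cco (h : R -> R) : continuous h -> continuous (fun p : R * (R * R) => h p.1).
  by move=> hc p; apply: (@cvg_comp _ _ _ _ h); [exact: cvg_fst|exact: hc].
split; try exact: oct_continuous_cst.
- by apply: continuous_oct_continuous; exact: cco.
- by apply: continuous_oct_continuous; exact: cco.
- by move=> [t [x y]] _ /=; apply: is_derive_is_derive_nneg; exact: cd.
- by move=> [t [x y]] _ /=; apply: is_derive_is_derive_nneg; exact: is_derive_cst.
- by move=> [t [x y]] _ /=; apply: is_derive_is_derive_nneg; exact: is_derive_cst.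
Qed.

Lemma C1_oct_space (f : R * R -> R) : C1_quad f ->
  C1_oct (fun p => f p.2) (fun=> 0) (fun p => dx f p.2) (fun p => dy f p.2).
Proof.
move=> [fc fd fcx fcy]; split.
- exact: oct_continuous_snd.
- exact: oct_continuous_cst.
- exact: oct_continuous_snd.
- exact: oct_continuous_snd.
- by move=> [t [x y]] _ /=; apply: is_derive_is_derive_nneg; exact: is_derive_cst.
- by move=> [t [x y]] /octantP[/= _ x0 y0]; apply: derivable_nnegP; apply: (fd (x, y) _).1; exact/quadP.
- by move=> [t [x y]] /octantP[/= _ x0 y0]; apply: derivable_nnegP; apply: (fd (x, y) _).2; exact/quadP.
Qed.

End C1_functions_on_the_octant.

(** * Test functions built from characteristics *)

Section transported_test_functions.
Context {R : realType}.
Implicit Types (z : R * R) (p : R * (R * R)).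
Variables (T : R) (K dK c1 dc1 c2 dc2 : R -> R) (W Wx Wy : R * R -> R) (a b : R).
Hypotheses (CK : C1_fun K dK) (Cc1 : C1_fun c1 dc1) (Cc2 : C1_fun c2 dc2)
  (CW : C1_oct (fun p => W p.2) (fun=> 0) (fun p => Wx p.2) (fun p => Wy p.2)).
Hypotheses (K_lip : forall u v, u <= v -> 0 <= K v - K u <= v - u)
  (c1_0 : forall x, a <= x -> c1 x = 0) (c2_0 : forall y, b <= y -> c2 y = 0).

(** In the model flow a point of age [y] moves in [x] at speed [dK y], so [K (y + (T - t)) - K y] is
    its x-displacement from time [t] to [T]. The cutoffs [c1], [c2] are evaluated at the position
    reached at time [T], the weight [W] at the current one. The factor in [t] is 1 up to [T] and
    provides compact support in time. *)
Definition transport_test p : R := cut T (T + 1) p.1 *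
  (c1 (p.2.1 + (K (p.2.2 + (T - p.1)) - K p.2.2)) * (c2 (p.2.2 + (T - p.1)) * W p.2)).

Let TT1 : T < T + 1. Proof. by rewrite ltrDl. Qed.

Let C1_transport_test := C1_octM (C1_oct_time (C1_fun_cut TT1))
  (C1_octM (C1_oct_comp (C1_oct_shift T CK) Cc1) (C1_octM (C1_oct_age T Cc2) CW)).

Lemma transport_testE t z : t <= T -> transport_test (t, z) =
  c1 (z.1 + (K (z.2 + (T - t)) - K z.2)) * c2 (z.2 + (T - t)) * W z.
Proof. by move=> tT; rewrite /transport_test /= cut_eq1// mul1r mulrA. Qed.

(** The transported cutoffs are constant along the model flow. What remains is the mismatch [r - dK]
    between the actual and the model x-speed, and the derivative of [W] along the actual flow. *)
Lemma transport_test_derive t z (r : R) : 0 <= t -> t <= T -> quad z ->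
  dt3 transport_test (t, z) + r * dx3 transport_test (t, z) + dy3 transport_test (t, z) =
  (r - dK z.2) * dc1 (z.1 + (K (z.2 + (T - t)) - K z.2)) * c2 (z.2 + (T - t)) * W z
  + c1 (z.1 + (K (z.2 + (T - t)) - K z.2)) * c2 (z.2 + (T - t)) * (r * Wx z + Wy z).
Proof.
move=> t0 tT qz; have [_ E] := C1_oct_octant C1_transport_test.
have otz : octant (t, z) by split => //=; rewrite /nneg /= in_itv /= t0.
have [-> -> ->] := E _ otz.
have -> /= : dcut T (T + 1) t = 0 by apply: dcut_eq0; left.
by rewrite (cut_eq1 TT1 tT); ring.
Qed.

Lemma C1c_transport_test : C1c_octant transport_test.
Proof.
split; first exact: (C1_oct_octant C1_transport_test).1.
(* Beyond [T] the shift goes backwards over a time at most 1, and [K] is 1-Lipschitz by [K_lip];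
   hence the margins of 1 in [x] and [y]. *)
exists (`[0, T + 1]%classic `*` (`[0, a + 1]%classic `*` `[0, b + 1]%classic)).
  by apply: compact_setX; [|apply: compact_setX]; exact: segment_compact.
move=> [t [x y]] /octantP[/= t0 x0 y0] nK; rewrite /transport_test /=.
have [tT|Tt] := leP t (T + 1); last by rewrite cut_eq0 ?mul0r// ltW.
have [yb|yb] := ltP (y + (T - t)) b; last by rewrite (c2_0 yb) mul0r !mulr0.
suff ax : a <= x + (K (y + (T - t)) - K y) by rewrite (c1_0 ax) mul0r mulr0.
rewrite leNgt; apply/negP => xa; apply: nK; split => /=; last split => /=;
  rewrite in_itv /= ?t0 ?x0 ?y0 //=.
- have [tT'|tT'] := leP t T.
    by have := @K_lip y (y + (T - t)) ltac:(lra) => /andP[? ?]; lra.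
  by have := @K_lip (y + (T - t)) y ltac:(lra) => /andP[? ?]; lra.
- lra.
Qed.

End transported_test_functions.

(** * The fluid equation started from the null measure *)

Section null_initial_condition.
Context {R : realType}.
Variables (lambda0 : R) (g : R * R -> R).

Lemma measure_eq0_pairing (m : finmeas R) f : measure_eq m mzero -> pairing f m = 0.
Proof.
move=> m0; rewrite /pairing /Rintegral.
have -> : (\int[m]_(z in quad) (f z)%:E = \int[mzero]_(z in quad) (f z)%:E)%E.
  by apply: eq_measure_integral => A mA _; exact: m0.
by rewrite integral_measure_zero.
Qed.

Lemma eq_pairing (m : finmeas R) f f' : (forall z, quad z -> f z = f' z) ->
  pairing f m = pairing f' m.
Proof.
move=> e; rewrite /pairing /Rintegral; congr fine; apply: eq_integral => z /[!inE] qz.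
by rewrite e.
Qed.

Lemma ae_eq_pairing (m : finmeas R) (N : set (R * R)) f f' : measurable N -> m N = 0%E ->
  measurable_fun quad f -> measurable_fun quad f' ->
  (forall z, quad z -> ~ N z -> f z = f' z) ->
  pairing f m = pairing f' m.
Proof.
move=> mN N0 mf mf' e; rewrite /pairing /Rintegral; congr fine.
apply: ae_eq_integral; [exact: measurable_quad|exact/measurable_EFinP|exact/measurable_EFinP|].
exists N; split => // z /= /not_implyP[qz ne]; apply: contrapT => nN.
by apply: ne; rewrite e.
Qed.

(** The positive part vanishes on [D], so no measurability enters. This matters for time integrals
    along an arbitrary solution. *)
Lemma Rintegral_le0 d (X : measurableType d) (mu : {measure set X -> \bar R})
    (D : set X) (f : X -> R) : (forall x, D x -> f x <= 0) -> \int[mu]_(x in D) f x <= 0.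
Proof.
move=> f0; rewrite /Rintegral integralE (_ : (\int[mu]_(x in D) _^\+ x = 0)%E); last first.
  rewrite integral0_eq// => x Dx; rewrite funeposE -EFin_max max_r//; exact: f0.
by rewrite sub0e fineN oppr_le0 fine_ge0// integral_ge0.
Qed.

Lemma fluid_eq_transport (nu : R -> finmeas R) (T : R) (K dK c1 dc1 c2 dc2 : R -> R)
    (W Wx Wy : R * R -> R) (a b : R) :
  fluid_solution lambda0 g nu -> measure_eq (nu 0) mzero ->
  C1_fun K dK -> C1_fun c1 dc1 -> C1_fun c2 dc2 ->
  C1_oct (fun p => W p.2) (fun=> 0) (fun p => Wx p.2) (fun p => Wy p.2) ->
  (forall u v, u <= v -> 0 <= K v - K u <= v - u) ->
  (forall x, a <= x -> c1 x = 0) -> (forall y, b <= y -> c2 y = 0) -> 0 <= T ->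
  pairing (fun z => c1 z.1 * c2 z.2 * W z) (nu T) =
  lambda0 * \int[lebesgue_measure]_(s in `[0, T])
    (c1 (K (T - s) - K 0) * c2 (T - s) * W (0, 0))
  - \int[lebesgue_measure]_(s in `[0, T]) pairing (fun z =>
     c1 (z.1 + (K (z.2 + (T - s)) - K z.2)) * c2 (z.2 + (T - s)) * W z * drift_rate g (nu s) z) (nu s)
  + \int[lebesgue_measure]_(s in `[0, T]) pairing (fun z =>
      (rbar (nu s) z - dK z.2) * dc1 (z.1 + (K (z.2 + (T - s)) - K z.2)) * c2 (z.2 + (T - s)) * W z
      + c1 (z.1 + (K (z.2 + (T - s)) - K z.2)) * c2 (z.2 + (T - s)) *
        (rbar (nu s) z * Wx z + Wy z)) (nu s).
Proof.
move=> [_ _ _ _ H] nu0 CK Cc1 Cc2 CW Klip c10 c20 T0.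
have := H T _ T0 (C1c_transport_test T CK Cc1 Cc2 CW Klip c10 c20).
rewrite /fluid_eq (measure_eq0_pairing _ nu0) add0r.
rewrite (@eq_pairing (nu T) _ (fun z => c1 z.1 * c2 z.2 * W z)); last first.
  by move=> z qz; rewrite transport_testE// subrr !addr0 subrr addr0.
move=> ->.
have sP s : s \in `[0, T]%classic -> 0 <= s /\ s <= T.
  by rewrite inE /= in_itv /= => /andP[].
have congr3 (l x x' y y' u u' : R) : x = x' -> y = y' -> u = u' ->
    l * x - y + u = l * x' - y' + u' by move=> -> -> ->.
apply: congr3; apply: eq_Rintegral => s /sP[s0 sT].
- by rewrite transport_testE//= !add0r.
- by apply: eq_pairing => z qz; rewrite transport_testE.
- by apply: eq_pairing => z qz; rewrite (transport_test_derive CK Cc1 Cc2 CW).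
Qed.

End null_initial_condition.

(** * The survival function and the hazard field *)

Section survival_function.
Context {R : realType}.
Variable (g : R * R -> R).
Hypothesis g_density : is_density g.
Implicit Types (z : R * R).
Local Notation S := (survival g).
Local Notation leb2 := (@lebesgue_measure R \x @lebesgue_measure R)%E.

Let mg : measurable_fun quad g. Proof. by case: g_density. Qed.
Let g0 z : quad z -> 0 <= g z. Proof. by case: g_density => _ + _; apply. Qed.
Let g1 : (\int[leb2]_(z in quad) (g z)%:E = 1)%E. Proof. by case: g_density. Qed.

Let tail z : set (R * R) := `[z.1, +oo[ `*` `[z.2, +oo[.

Let mtail z : measurable (tail z).
Proof. by apply: measurableX; exact: measurable_itv. Qed.

Let tail_quad z : quad z -> tail z `<=` quad.
Proof.
move=> /quadP[z1 z2] w [/=]; rewrite !in_itv /= !andbT => w1 w2.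
by apply/quadP; split; [exact: le_trans w1|exact: le_trans w2].
Qed.

Let survivalE z : quad z ->
  ((S z)%:E = \int[leb2]_(w in tail z) (g w)%:E)%E.
Proof.
move=> qz; rewrite /survival /Rintegral fineK// ge0_fin_numE.
  apply: (@le_lt_trans _ _ (\int[leb2]_(w in quad) (g w)%:E)%E); last by rewrite g1 ltry.
  apply: ge0_subset_integral; [exact: mtail|exact: measurable_quad|exact/measurable_EFinP| |].
    by move=> w qw; rewrite lee_fin g0.
  exact: tail_quad.
by apply: integral_ge0 => w /(tail_quad qz) qw; rewrite lee_fin g0.
Qed.

Lemma survival_ge0 z : quad z -> 0 <= S z.
Proof.
move=> qz; rewrite -lee_fin survivalE//; apply: integral_ge0 => w /(tail_quad qz) qw.
by rewrite lee_fin g0.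
Qed.

Lemma survival_le z z' : quad z -> z.1 <= z'.1 -> z.2 <= z'.2 -> S z' <= S z.
Proof.
move=> qz z1 z2; have qz' : quad z'.
  by move/quadP : qz => [? ?]; apply/quadP; split; exact: le_trans z1 || exact: le_trans z2.
rewrite -lee_fin !survivalE//; apply: ge0_subset_integral; [exact: mtail|exact: mtail| | |].
- by apply/measurable_EFinP; apply: measurable_funS mg; [exact: measurable_quad|exact: tail_quad].
- by move=> w /(tail_quad qz) qw; rewrite lee_fin g0.
- move=> w [/=]; rewrite !in_itv /= !andbT => w1 w2.
  by split; rewrite /= in_itv /= andbT; [exact: le_trans w1|exact: le_trans w2].
Qed.

Lemma quad0 : quad ((0, 0) : R * R).
Proof. exact/quadP. Qed.

Lemma survival0 : S (0, 0) = 1.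
Proof. by apply: EFin_inj; rewrite survivalE; [exact: g1|exact: quad0]. Qed.

Lemma survival_le1 z : quad z -> S z <= 1.
Proof. by move=> /quadP[z1 z2]; rewrite -survival0; apply: survival_le => //; exact: quad0. Qed.

Hypothesis Sg_C1 : C1_quad S.

Let cS : {within quad, continuous S}. Proof. by case: Sg_C1. Qed.

Lemma survival_dx z : quad z -> is_derive_nneg (fun x => S (x, z.2)) z.1 (dx S z).
Proof. by case: Sg_C1 => _ /(_ z) + _ _ => /[apply] -[? _]; exact: derivable_nnegP. Qed.

Lemma survival_dy z : quad z -> is_derive_nneg (fun y => S (z.1, y)) z.2 (dy S z).
Proof. by case: Sg_C1 => _ /(_ z) + _ _ => /[apply] -[_ ?]; exact: derivable_nnegP. Qed.

Lemma dx_survival_le0 z : quad z -> dx S z <= 0.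
Proof.
move=> qz; have /quadP[z1 z2] := qz.
apply: (nonincreasing_is_derive_nneg z1 _ (survival_dx qz)) => x y x0 xy.
by apply: survival_le => //=; exact/quadP.
Qed.

Lemma dy_survival_le0 z : quad z -> dy S z <= 0.
Proof.
move=> qz; have /quadP[z1 z2] := qz.
apply: (nonincreasing_is_derive_nneg z2 _ (survival_dy qz)) => x y x0 xy.
by apply: survival_le => //=; exact/quadP.
Qed.

Let min_is_derive_nneg (f : R -> R) (a l : R) : 0 <= a -> f a = 0 ->
  (forall x, 0 <= x -> 0 <= f x) -> is_derive_nneg f a l -> 0 <= l.
Proof.
move=> a0 fa f0 /is_derive_nneg_near fl; rewrite leNgt; apply/negP => l0.
have /fl /nbhs_ballP [e /= e0] : nbhs l (fun x => x < 0) by exact: lt_nbhsl.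
have e2 : 0 < e / 2 by rewrite divr_gt0.
have ee : e / 2 < e by lra.
move=> /(_ (a + e / 2)); rewrite /ball /= opprD addNKr normrN (gtr0_norm e2).
have nea : a + e / 2 != a by rewrite gt_eqF// ltrDl.
move=> /(_ ee nea); have ae : 0 <= a + e / 2 by rewrite addr_ge0// ltW.
have -> : a + e / 2 - a = e / 2 by ring.
by move=> /(_ ae); apply/negP; rewrite -leNgt fa subr0 divr_ge0 ?f0// ltW.
Qed.

(** A zero of [S] is a minimum, so the derivative there is nonnegative as well as nonpositive. *)
Lemma dx_survival_eq0 z : quad z -> S z = 0 -> dx S z = 0.
Proof.
move=> qz Sz; have /quadP[z1 z2] := qz.
apply/eqP; rewrite eq_le dx_survival_le0//=.
apply: (min_is_derive_nneg z1 _ _ (survival_dx qz)); first by case: z Sz {qz z1 z2}.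
by move=> x x0; apply: survival_ge0; exact/quadP.
Qed.

Lemma dy_survival_eq0 z : quad z -> S z = 0 -> dy S z = 0.
Proof.
move=> qz Sz; have /quadP[z1 z2] := qz.
apply/eqP; rewrite eq_le dy_survival_le0//=.
apply: (min_is_derive_nneg z2 _ _ (survival_dy qz)); first by case: z Sz {qz z1 z2}.
by move=> x x0; apply: survival_ge0; exact/quadP.
Qed.

(* Off [Ug] both sides vanish, as division by [0] gives [0]. *)
Lemma hazard_xE z : quad z -> hazard_x g z = - dx S z / S z.
Proof.
move=> qz; rewrite /hazard_x; have /quadP[z1 z2] := qz.
case: ifPn => [/[!inE] -[_ Sz]|]; last first.
  rewrite notin_setE => nU; have -> : S z = 0.
    apply/eqP; rewrite eq_le survival_ge0// andbT leNgt; apply/negP => Sz.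
    by apply: nU.
  by rewrite invr0 mulr0.
have := is_derive_nneg_comp (survival_dx qz) (is_derive1_ln _).
rewrite -surjective_pairing => /(_ Sz) /(is_derive_nneg_val z1)[_].
by rewrite /dx mulNr mulrC => ->.
Qed.

Lemma hazard_yE z : quad z -> hazard_y g z = - dy S z / S z.
Proof.
move=> qz; rewrite /hazard_y; have /quadP[z1 z2] := qz.
case: ifPn => [/[!inE] -[_ Sz]|]; last first.
  rewrite notin_setE => nU; have -> : S z = 0.
    apply/eqP; rewrite eq_le survival_ge0// andbT leNgt; apply/negP => Sz.
    by apply: nU.
  by rewrite invr0 mulr0.
have := is_derive_nneg_comp (survival_dy qz) (is_derive1_ln _).
rewrite -surjective_pairing => /(_ Sz) /(is_derive_nneg_val z2)[_].
by rewrite /dy mulNr mulrC => ->.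
Qed.

Lemma rbar_ge0 (m : finmeas R) z : 0 <= rbar m z.
Proof. by rewrite /rbar ler0n. Qed.

Lemma drift_rate_ge0 (m : finmeas R) z : quad z -> 0 <= drift_rate g m z.
Proof.
move=> qz; rewrite /drift_rate hazard_xE// hazard_yE//.
have := survival_ge0 qz; have := dx_survival_le0 qz; have := dy_survival_le0 qz.
have := rbar_ge0 m z; move: (rbar m z) (dx S z) (dy S z) (S z) => r x y s r0 y0 x0 s0.
by rewrite addr_ge0 ?mulr_ge0 ?invr_ge0 ?oppr_ge0.
Qed.

(* Also valid where [S z = 0], by [dx_survival_eq0] and [dy_survival_eq0]. *)
Lemma drift_rate_survival (m : finmeas R) z : quad z ->
  drift_rate g m z * S z = - (rbar m z * dx S z + dy S z).
Proof.
move=> qz; rewrite /drift_rate hazard_xE// hazard_yE//.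
have [S0|S0] := eqVneq (S z) 0.
  by rewrite S0 dx_survival_eq0// dy_survival_eq0// !mulr0 addr0 oppr0.
by field.
Qed.

Lemma measurable_rbar (m : finmeas R) D : measurable_fun D (rbar m).
Proof.
apply: measurable_funTS.
have -> : rbar m = \1_(setT `*` [set y : R | (y%:E <= ystar m)%E]).
  apply/funext => z; rewrite /rbar indicE; congr (_%:R); congr nat_of_bool.
  by apply/idP/idP; rewrite inE; [move=> ?; split|case].
apply: measurable_indic; apply: measurableX => //.
case: (ystar m) => [y| |].
- rewrite (_ : [set _ | _] = `]-oo, y]%classic); first exact: measurable_itv.
  by apply/seteqP; split=> x; rewrite /= in_itv /= lee_fin.
- rewrite (_ : [set _ | _] = setT); first exact: measurableT.
  by apply/seteqP; split=> x //= _; rewrite leey.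
- rewrite (_ : [set _ | _] = set0); first exact: measurable0.
  by apply/seteqP; split=> x //=; rewrite leeNy_eq.
Qed.

Lemma measurable_survival : measurable_fun quad S.
Proof. exact: within_quad_measurable. Qed.

Lemma measurable_drift_rate (m : finmeas R) : measurable_fun quad (drift_rate g m).
Proof.
have [_ _ cx cy] := Sg_C1.
have mV : measurable_fun quad (fun z => (S z)^-1).
  by apply: measurableT_comp; [exact: measurable_invr|exact: measurable_survival].
apply: (eq_measurable_fun (fun z => rbar m z * (- dx S z / S z) + - dy S z / S z)).
  by move=> z /[!inE] qz; rewrite /drift_rate hazard_xE// hazard_yE.
apply: measurable_funD; [apply: measurable_funM; [exact: measurable_rbar|]|].
  by apply: measurable_funM => //; apply: measurableT_comp => //; exact: within_quad_measurable.
by apply: measurable_funM => //; apply: measurableT_comp => //; exact: within_quad_measurable.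
Qed.

Lemma C1_oct_survival :
  C1_oct (fun p => S p.2) (fun=> 0) (fun p => dx S p.2) (fun p => dy S p.2).
Proof. exact: C1_oct_space. Qed.

End survival_function.

(** * Bounds on the age marginal of a solution *)

Section age_marginal_bounds.
Context {R : realType}.
Variables (lambda0 : R) (g : R * R -> R).
Hypotheses (lambda0_gt0 : 0 < lambda0) (g_density : is_density g)
  (Sg_C1 : C1_quad (survival g)).
Implicit Types (z : R * R) (m : finmeas R).

Lemma measurable_nnegX (B : set R) : measurable B ->
  measurable (nneg `*` B : set (R * R)).
Proof. by move=> mB; apply: measurableX => //; exact: measurable_itv. Qed.

Lemma pairing_bounded m (f : R * R -> R) (C : R) : measurable_fun quad f ->
  (forall z, quad z -> 0 <= f z <= C) ->
  ((pairing f m)%:E = \int[m]_(z in quad) (f z)%:E)%E.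
Proof.
move=> mf fC; rewrite /pairing /Rintegral fineK// ge0_fin_numE; last first.
  by apply: integral_ge0 => z qz; rewrite lee_fin; case/andP: (fC z qz).
apply: (@le_lt_trans _ _ (\int[m]_(z in quad) C%:E)%E).
  apply: ge0_le_integral; [exact: measurable_quad| |exact/measurable_EFinP|exact: measurable_cst|].
    by move=> z qz; rewrite lee_fin; case/andP: (fC z qz).
  by move=> z qz; rewrite lee_fin; case/andP: (fC z qz).
have mq := @measurable_quad R.
by rewrite integral_cst// ltey_eq fin_numM// fin_num_measure.
Qed.

Lemma measure_le_pairing m (A : set (R * R)) (f : R * R -> R) (C : R) : measurable A ->
  A `<=` quad -> measurable_fun quad f -> (forall z, quad z -> 0 <= f z <= C) ->
  (forall z, A z -> 1 <= f z) -> (m A <= (pairing f m)%:E)%E.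
Proof.
move=> mA Aq mf fC f1; rewrite (pairing_bounded m mf fC).
have -> : m A = (\int[m]_(z in quad) (\1_A z)%:E)%E.
  by rewrite integral_indic ?setIidl//; exact: measurable_quad.
apply: ge0_le_integral; [exact: measurable_quad| | |exact/measurable_EFinP|].
- by move=> z _; rewrite lee_fin.
- by apply/measurable_EFinP; exact: measurable_indic.
- move=> z qz; rewrite lee_fin indicE; case: (boolP (z \in A)) => [/[!inE] /f1//|_].
  by case/andP: (fC z qz).
Qed.

Lemma Rintegral_le_itv (T u v : R) (f : R -> R) : u <= v ->
  measurable_fun `[0, T] f -> (forall s, 0 <= f s <= (u <= s <= v)%R%:R) ->
  \int[lebesgue_measure]_(s in `[0, T]) f s <= v - u.
Proof.
move=> uv mf fuv.
have H : (\int[lebesgue_measure]_(s in `[0%R, T]) (f s)%:E <= (v - u)%:E)%E.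
  apply: (@le_trans _ _ (\int[lebesgue_measure]_(s in `[0%R, T]) (\1_(`[u, v]%classic) s)%:E)%E).
    apply: ge0_le_integral => //=.
    - by move=> s _; rewrite lee_fin; case/andP: (fuv s).
    - exact/measurable_EFinP.
    - by apply/measurable_EFinP; apply: measurable_indic; exact: measurable_itv.
    - move=> s _; rewrite lee_fin indicE mem_setE in_itv /=; by case/andP: (fuv s).
  rewrite integral_indic//.
  apply: (@le_trans _ _ (lebesgue_measure `[u, v]%classic)); first exact: measureIl.
  by rewrite lebesgue_measure_itv /= lte_fin; case: ltP => // _; rewrite lee_fin subr_ge0.
rewrite /Rintegral -lee_fin; apply: (le_trans _ H).
rewrite fineK// ge0_fin_numE; first exact: le_lt_trans H (ltry _).
by apply: integral_ge0 => s _; rewrite lee_fin; case/andP: (fuv s).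
Qed.

Variable nu : R -> finmeas R.
Hypotheses (nu_sol : fluid_solution lambda0 g nu) (nu0 : measure_eq (nu 0) mzero).

Let C1_oct_one : C1_oct (fun p : R * (R * R) => (fun _ : R * R => 1 : R) p.2) (fun=> 0)
  (fun p => (fun=> 0) p.2) (fun p => (fun=> 0) p.2).
Proof.
split; try exact: oct_continuous_cst;
  by move=> p _; apply: is_derive_is_derive_nneg; exact: is_derive_cst.
Qed.

(** The model flow moves in [y] only ([K] is 0) and the weight is 1. The loss lowers the pairing,
    and so does the transport in [x], because mass never moves left and [c1] is nonincreasing.
    Dropping both by sign leaves the arrivals. *)
Lemma age_pairing_le (T : R) (c1 dc1 c2 dc2 : R -> R) (a b : R) : 0 <= T ->
  C1_fun c1 dc1 -> C1_fun c2 dc2 -> (forall x, dc1 x <= 0) ->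
  (forall x, 0 <= c1 x) -> (forall y, 0 <= c2 y) ->
  (forall x, a <= x -> c1 x = 0) -> (forall y, b <= y -> c2 y = 0) ->
  pairing (fun z => c1 z.1 * c2 z.2) (nu T) <=
  lambda0 * \int[lebesgue_measure]_(s in `[0, T]) (c1 0 * c2 (T - s)).
Proof.
move=> T0 Cc1 Cc2 dc10 c1_ge0 c2_ge0 c1_0 c2_0.
have K_lip (u v : R) : u <= v -> 0 <= (0 : R) - 0 <= v - u.
  by move=> uv; rewrite subrr lexx subr_ge0.
have := fluid_eq_transport nu_sol nu0 (C1_fun_cst 0) Cc1 Cc2 C1_oct_one K_lip c1_0 c2_0 T0.
rewrite (@eq_pairing _ (nu T) _ (fun z => c1 z.1 * c2 z.2)); last by move=> z _; rewrite mulr1.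
move=> ->.
set A := (X in _ - X + _); set B := (X in _ - _ + X).
have A0 : 0 <= A.
  apply: Rintegral_ge0 => s _; apply: Rintegral_ge0 => z qz.
  by rewrite mulr1 mulr_ge0 ?drift_rate_ge0// mulr_ge0.
have B0 : B <= 0.
  apply: Rintegral_le0 => s _; apply: Rintegral_le0 => z qz.
  rewrite mulr0 !addr0 mulr0 addr0 mulr1 subr0 subrr addr0.
  by rewrite mulr_le0_ge0// mulr_ge0_le0// rbar_ge0.
have -> : \int[lebesgue_measure]_(s in `[0, T]) (c1 (0 - 0) * c2 (T - s) * 1) =
    \int[lebesgue_measure]_(s in `[0, T]) (c1 0 * c2 (T - s)).
  by apply: eq_Rintegral => s _; rewrite subrr mulr1.
by rewrite -[leRHS]addr0 -addrA lerD2l addrC subr_le0 (le_trans B0).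
Qed.

(** A C1 bump, equal to 1 on [[a, b]] and to 0 off [[a - d, b + d]]. *)
Let bump_cut (a b d : R) (y : R) := (1 - cut (a - d) a y) * cut b (b + d) y.

Let age_mass_bump (T a b d : R) : 0 <= T -> 0 <= a -> a <= b -> 0 < d ->
  (nu T (nneg `*` `[a, b]) <= (lambda0 *
    \int[lebesgue_measure]_(s in `[0, T]) bump_cut a b d (T - s))%:E)%E.
Proof.
move=> T0 a0 ab d0.
have ad : a - d < a by rewrite ltrBlDr ltrDl.
have bd : b < b + d by rewrite ltrDl.
pose c2 := bump_cut a b d.
have [dc2 Cc2] : exists dc2, C1_fun c2 dc2.
  have Ca := C1_funM (C1_fun_cst (-1)) (C1_fun_cut ad).
  have Cb := C1_funM (C1_funD (C1_fun_cst 1) Ca) (C1_fun_cut bd).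
  by eexists; apply: C1_fun_eq Cb => // y; rewrite /c2 /bump_cut mulN1r.
have c2_01 y : 0 <= c2 y <= 1.
  have := cut_ge0 b (b + d) y; have := cut_le1 y bd.
  have := cut_ge0 (a - d) a y; have := cut_le1 y ad.
  by move=> *; rewrite /c2 /bump_cut mulr_ge0 ?subr_ge0//= mulr_ile1// ?subr_ge0// gerBl.
have c2_0 y : b + d <= y -> c2 y = 0 by move=> h; rewrite /c2 /bump_cut (cut_eq0 _ h) mulr0.
(* The x-cutoff demanded by compact support is removed by letting [n] grow, since the bound obtained
   is independent of [n]. *)
pose F n : set (R * R) := `[0, n%:R] `*` `[a, b].
have mF n : measurable (F n) by apply: measurableX; exact: measurable_itv.
have UF : nneg `*` `[a, b] = \bigcup_n F n.
  apply/seteqP; split=> [z [/= z1 z2]|z [n _ [/= z1 z2]]].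
    exists (Num.truncn z.1).+1 => //; split => //=.
    move: z1; rewrite /nneg /= !in_itv /= andbT => -> /=.
    by rewrite ltW// truncnS_gt.
  by split => //; move: z1; rewrite /nneg /= !in_itv /= => /andP[->].
have ndF : nondecreasing_seq F.
  move=> i j ij; apply/subsetPset => z [/= z1 z2]; split => //=.
  move: z1; rewrite !in_itv /= => /andP[-> /=] /le_trans; apply.
  by rewrite ler_nat.
have bound n : (nu T (F n) <= (lambda0 *
    \int[lebesgue_measure]_(s in `[0, T]) c2 (T - s))%:E)%E.
  have nn : (n%:R : R) < n%:R + 1 by rewrite ltrDl.
  have Fq : F n `<=` quad.
    move=> z [/=]; rewrite !in_itv /= => /andP[z1 _] /andP[z2 _]; apply/quadP.
    by split => //; exact: le_trans z2.
  apply: (@le_trans _ _ (pairing (fun z => cut n%:R (n%:R + 1) z.1 * c2 z.2) (nu T))%:E).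
    apply: (@measure_le_pairing _ _ _ 1) => //.
    - apply: within_quad_measurable; apply: continuous_subspaceT => z; apply: cvgM.
        apply: (@cvg_comp _ _ _ fst (cut n%:R (n%:R + 1))); first exact: cvg_fst.
        exact: (C1_fun_continuous (C1_fun_cut nn)).
      apply: (@cvg_comp _ _ _ snd c2); first exact: cvg_snd.
      exact: (C1_fun_continuous Cc2).
    - move=> z _; have /andP[h1 h2] := c2_01 z.2.
      by rewrite mulr_ge0 ?cut_ge0//= mulr_ile1// ?cut_ge0 ?cut_le1.
    - move=> z [/=]; rewrite !in_itv /= => /andP[_ z1] /andP[az zb].
      rewrite cut_eq1// mul1r /c2 /bump_cut (cut_eq0 _ az) subr0 mul1r.
      by rewrite cut_eq1.
  rewrite lee_fin; apply: le_trans (age_pairing_le T0 (C1_fun_cut nn) Cc2 _ _ _ _ c2_0) _.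
  - by move=> x; exact: dcut_le0.
  - by move=> x; exact: cut_ge0.
  - by move=> y; case/andP: (c2_01 y).
  - by move=> x; exact: cut_eq0.
  rewrite le_eqVlt; apply/orP; left; apply/eqP; congr (_ * _).
  by apply: eq_Rintegral => s _; rewrite cut_eq1// mul1r.
rewrite UF.
have := @nondecreasing_cvg_mu _ _ _ (nu T) F mF.
have mUF : measurable (\bigcup_n F n) by exact: bigcupT_measurable.
move=> /(_ mUF ndF) cv; rewrite -(cvg_lim _ cv)//.
by apply: lime_le; [apply/cvg_ex; eexists; exact: cv|exact: nearW].
Qed.

(** Arrivals at rate [lambda0] cross at unit speed the support of the bump, an interval of length
    [b - a + 2 * d]. *)
Lemma age_mass_le (T a b d : R) : 0 <= T -> 0 <= a -> a <= b -> 0 < d ->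
  (nu T (nneg `*` `[a, b]) <= (lambda0 * (b - a + 2 * d))%:E)%E.
Proof.
move=> T0 a0 ab d0; apply: le_trans (age_mass_bump T0 a0 ab d0) _.
have ad : a - d < a by rewrite ltrBlDr ltrDl.
have bd : b < b + d by rewrite ltrDl.
rewrite lee_fin ler_pM2l//.
have -> : b - a + 2 * d = (T - (a - d)) - (T - (b + d)) by ring.
apply: Rintegral_le_itv; first lra.
  apply: measurable_funTS; apply: continuous_measurable_fun => s.
  have cs : (fun s : R => T - s) @ s --> T - s by apply: cvgB; [exact: cvg_cst|exact: cvg_id].
  apply: cvgM; last first.
    apply: (@cvg_comp _ _ _ _ (cut b (b + d))); first exact: cs.
    exact: (C1_fun_continuous (C1_fun_cut bd)).
  apply: cvgB; first exact: cvg_cst.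
  apply: (@cvg_comp _ _ _ _ (cut (a - d) a)); first exact: cs.
  exact: (C1_fun_continuous (C1_fun_cut ad)).
move=> s; rewrite /bump_cut.
have := cut_ge0 b (b + d) (T - s); have := cut_le1 (T - s) bd.
have := cut_ge0 (a - d) a (T - s); have := cut_le1 (T - s) ad.
move=> h1 h2 h3 h4; rewrite mulr_ge0 ?subr_ge0//=.
case: (boolP (_ <= s <= _)) => [_|/nandP[]].
- by rewrite mulr_ile1// ?subr_ge0// gerBl.
- rewrite -ltNge => h; have bds : b + d <= T - s by lra.
  by rewrite (cut_eq0 _ bds) mulr0.
- rewrite -ltNge => h; have ads : T - s <= a - d by lra.
  by rewrite (cut_eq1 ad ads) subrr mul0r.
Qed.

Lemma age_mass_eq0 (T a b : R) : 0 <= T -> T < a -> nu T (nneg `*` `[a, b]) = 0%E.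
Proof.
move=> T0 Ta; have [ab|ba] := leP a b; last first.
  by rewrite set_itv_ge ?setX0 ?measure0// -ltNge.
have a0 : 0 <= a by rewrite (le_trans T0)// ltW.
(* With this margin the bump starts at [a - (a - T) = T], so it vanishes at every age reached by
   arrivals since time 0. *)
have d0 : 0 < a - T by rewrite subr_gt0.
apply/eqP; rewrite eq_le measure_ge0 andbT.
apply: le_trans (age_mass_bump T0 a0 ab d0) _.
rewrite (_ : \int[lebesgue_measure]_(s in `[0, T]) _ = 0) ?mulr0//.
rewrite /Rintegral integral0_eq// => s; rewrite /= in_itv /= => /andP[s0 sT].
have aT : a - (a - T) < a by lra.
have aTs : T - s <= a - (a - T) by lra.
by rewrite /bump_cut (cut_eq1 aT aTs) subrr mul0r.
Qed.

Lemma age_mass_gt (T : R) : 0 <= T -> nu T (nneg `*` `]T, +oo[) = 0%E.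
Proof.
move=> T0; pose F n : set (R * R) := nneg `*` `[T + n.+1%:R^-1, T + n%:R].
have mF n : measurable (F n) by apply: measurable_nnegX; exact: measurable_itv.
have F0 n : nu T (F n) = 0%E by rewrite age_mass_eq0// ltrDl invr_gt0.
have FU : nneg `*` `]T, +oo[ `<=` \bigcup_n F n.
  move=> z [z1 /=]; rewrite in_itv /= andbT => Tz.
  have zT : 0 < z.2 - T by rewrite subr_gt0.
  have [n _ Hn] := near_infty_natSinv_lt (PosNum zT).
  exists (maxn n (Num.truncn (z.2 - T)).+1) => //; split => //=; rewrite in_itv /=.
  have := Hn _ (leq_maxl n (Num.truncn (z.2 - T)).+1) => /= h.
  apply/andP; split; first by rewrite -lerBrDl ltW.
  rewrite -lerBlDl; apply: le_trans (ltW (truncnS_gt _)) _.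
  by rewrite ler_nat leq_maxr.
apply/eqP; rewrite eq_le measure_ge0 andbT.
apply: (@le_trans _ _ (\sum_(n <oo) nu T (F n))%E).
  apply: measure_sigma_subadditive => //.
  by apply: measurable_nnegX; exact: measurable_itv.
by rewrite eseries0.
Qed.

Lemma age_mass_line (T y : R) : 0 <= T -> nu T (nneg `*` `[y, y]) = 0%E.
Proof.
move=> T0; have [y0|y0] := ltP y 0.
  have -> : nu T (nneg `*` `[y, y]) = nu T ((nneg `*` `[y, y]) `&` (~` quad)).
    congr (nu T _); apply/seteqP; split=> z; last by case.
    move=> [z1 /= z2]; split => //; move: z2; rewrite in_itv /= => /andP[_ zy] /quadP[_].
    by rewrite leNgt (le_lt_trans zy).
  apply/eqP; rewrite eq_le measure_ge0 andbT -(finmeas_quad (nu T)).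
  apply: le_measure; rewrite ?inE; [apply: measurableI|exact: measurableC measurable_quad|by move=> z []].
    by apply: measurable_nnegX; exact: measurable_itv.
  exact: measurableC measurable_quad.
apply/eqP; rewrite eq_le measure_ge0 andbT; apply/lee_addgt0Pr => e e0.
(* For an interval of length 0 this margin makes the bound of [age_mass_le] equal to [e]. *)
have d0 : 0 < e / (2 * lambda0) by rewrite divr_gt0// mulr_gt0.
apply: le_trans (age_mass_le T0 y0 (lexx y) d0) _.
rewrite subrr add0r add0e lee_fin le_eqVlt; apply/orP; left; apply/eqP; field.
by rewrite gt_eqF.
Qed.

End age_marginal_bounds.

(** * Comparison of measures through weighted transport *)

Section comparison.
Context {R : realType}.
Variables (lambda0 : R) (g : R * R -> R).
Hypotheses (lambda0_gt0 : 0 < lambda0) (g_density : is_density g)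
  (Sg_C1 : C1_quad (survival g)).
Implicit Types (z : R * R) (m : finmeas R).
Local Notation S := (survival g).

(* [1 / S] where [e <= S] *)
Definition weight (e : R) z : R := recip (e / 2) e (S z).

Lemma recip_ge0 (p q x : R) : 0 <= p -> p < q -> 0 <= x -> 0 <= recip p q x.
Proof.
by move=> p0 pq x0; rewrite /recip divr_ge0 ?sqpos_ge0// ltW// recip_den_gt0.
Qed.

Let half e : 0 < e -> 0 <= e / 2 /\ e / 2 < e :> R.
Proof. by move=> e0; split; lra. Qed.

Lemma weight_ge0 e z : 0 < e -> quad z -> 0 <= weight e z.
Proof. by move=> e0 qz; have [? ?] := half e0; rewrite recip_ge0// survival_ge0. Qed.

Lemma weight_inv e z : 0 < e -> e <= S z -> weight e z = (S z)^-1.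
Proof. by move=> e0 eS; have [? ?] := half e0; rewrite /weight recip_inv. Qed.

Lemma C1_oct_weight e : 0 < e -> exists dr : R -> R,
  [/\ forall x, e <= x -> dr x = - x ^- 2,
      continuous dr
    & C1_oct (fun p => weight e p.2) (fun=> 0)
      (fun p => (fun z => dr (S z) * dx S z) p.2) (fun p => (fun z => dr (S z) * dy S z) p.2)].
Proof.
move=> e0; have [? ?] := half e0.
have [dr [Cr _ drE]] := @C1_fun_recip _ (e / 2) e ltac:(lra) ltac:(lra).
exists dr; split => //; first exact: Cr.2.
have := C1_oct_comp (C1_oct_survival Sg_C1) Cr.
have -> : (fun p : R * (R * R) => dr (S p.2) * 0) = fun=> 0.
  by apply/funext => p; rewrite mulr0.
by [].
Qed.

Lemma measurable_weight e : 0 < e -> measurable_fun quad (weight e).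
Proof.
move=> e0; have [? ?] := half e0.
have [dr [Cr _ _]] := @C1_fun_recip _ (e / 2) e ltac:(lra) ltac:(lra).
apply: measurableT_comp; last exact: measurable_survival.
exact: continuous_measurable_fun (C1_fun_continuous Cr).
Qed.

Section transport_identity.
Variable nu : R -> finmeas R.
Hypotheses (nu_sol : fluid_solution lambda0 g nu) (nu0 : measure_eq (nu 0) mzero).
Variables (T a b e : R) (K dK c1 dc1 c2 dc2 : R -> R).
Hypotheses (T0 : 0 <= T) (e0 : 0 < e) (eS : e <= S (a, b))
  (CK : C1_fun K dK) (Cc1 : C1_fun c1 dc1) (Cc2 : C1_fun c2 dc2)
  (K_lip : forall u v, u <= v -> 0 <= K v - K u <= v - u)
  (c1_0 : forall x, a <= x -> c1 x = 0) (c2_0 : forall y, b <= y -> c2 y = 0).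

(** Where the cutoffs are nonzero the weight is [1 / S], and its derivative along the flow is the
    weight times the drift rate, so loss and gain cancel at each time [s]. Only arrivals remain, and
    these depend on the solution no longer. The sets [N], which may vary with [s], absorb the points
    where the speed mismatch is not killed by a cutoff. *)
Lemma weighted_transport :
  (forall s, 0 <= s -> s <= T -> exists2 N : set (R * R), measurable N /\ nu s N = 0%E &
    forall z, quad z -> ~ N z -> (rbar (nu s) z - dK z.2) *
      dc1 (z.1 + (K (z.2 + (T - s)) - K z.2)) * c2 (z.2 + (T - s)) = 0) ->
  pairing (fun z => c1 z.1 * c2 z.2 * weight e z) (nu T) =
  lambda0 * \int[lebesgue_measure]_(s in `[0, T])
    (c1 (K (T - s) - K 0) * c2 (T - s) * weight e (0, 0)).
Proof.
move=> HE; have [dr [drE drc Cw]] := C1_oct_weight e0.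
apply: (etrans (@fluid_eq_transport _ lambda0 g nu T K dK c1 dc1 c2 dc2 (weight e)
  (fun z => dr (S z) * dx S z) (fun z => dr (S z) * dy S z) a b
  nu_sol nu0 CK Cc1 Cc2 Cw K_lip c1_0 c2_0 T0)).
rewrite -[RHS]addr0 -addrA; congr (_ + _).
apply/eqP; rewrite addrC subr_eq0; apply/eqP; apply: eq_Rintegral => s.
rewrite inE /= in_itv /= => /andP[s0 sT].
have [N [mN N0] NE] := HE s s0 sT.
have Kc := C1_fun_continuous CK; have dKc := CK.2.
have cX : continuous (fun z : R * R => z.1 + (K (z.2 + (T - s)) - K z.2)).
  move=> z; apply: cvgD; first exact: cvg_fst.
  apply: cvgB; last by apply: (@cvg_comp _ _ _ snd K); [exact: cvg_snd|exact: Kc].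
  apply: (@cvg_comp _ _ _ (fun z : R * R => z.2 + (T - s)) K); last exact: Kc.
  by apply: cvgD; [exact: cvg_snd|exact: cvg_cst].
have cY : continuous (fun z : R * R => z.2 + (T - s)).
  by move=> z; apply: cvgD; [exact: cvg_snd|exact: cvg_cst].
have mX (h : R -> R) : continuous h ->
    measurable_fun quad (fun z : R * R => h (z.1 + (K (z.2 + (T - s)) - K z.2))).
  move=> hc; apply: measurable_funTS; apply: continuous_measurable_plane => z.
  by apply: (@cvg_comp _ _ _ _ h); [exact: cX|exact: hc].
have mY (h : R -> R) : continuous h ->
    measurable_fun quad (fun z : R * R => h (z.2 + (T - s))).
  move=> hc; apply: measurable_funTS; apply: continuous_measurable_plane => z.
  by apply: (@cvg_comp _ _ _ _ h); [exact: cY|exact: hc].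
have m1 := mX _ (C1_fun_continuous Cc1); have m2 := mY _ (C1_fun_continuous Cc2).
have md1 := mX _ Cc1.2.
have mdK : measurable_fun quad (fun z : R * R => dK z.2).
  apply: measurable_funTS; apply: continuous_measurable_plane => z.
  by apply: (@cvg_comp _ _ _ snd dK); [exact: cvg_snd|exact: dKc].
have mW := measurable_weight e0; have mr := @measurable_rbar R (nu s) quad.
have mdr : measurable_fun quad (fun z : R * R => dr (S z)).
  apply: measurableT_comp; last exact: measurable_survival.
  exact: continuous_measurable_fun.
have [_ _ cSx cSy] := Sg_C1.
have mSx := within_quad_measurable cSx; have mSy := within_quad_measurable cSy.
apply: (ae_eq_pairing mN N0).
- apply: measurable_funD; apply: measurable_funM.
  + by do 2 (apply: measurable_funM => //); exact: measurable_funB.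
  + exact: mW.
  + exact: measurable_funM.
  + by apply: measurable_funD; [apply: measurable_funM => //|]; exact: measurable_funM.
- apply: measurable_funM; last exact: measurable_drift_rate.
  by do 2 (apply: measurable_funM => //).
move=> z qz nN; rewrite (NE z qz nN) mul0r add0r.
have /quadP[z1 z2] := qz.
have Ts : 0 <= T - s by lra.
(* Neither coordinate decreases along the model flow, so where both cutoffs are nonzero [z] lies
   below and to the left of [(a, b)], which gives [e <= S z]. *)
have [zb|zb] := ltP (z.2 + (T - s)) b; last by rewrite (c2_0 zb) mulr0 !mul0r.
have [za|za] := ltP (z.1 + (K (z.2 + (T - s)) - K z.2)) a; last by rewrite (c1_0 za) !mul0r.
have eSz : e <= S z.
  apply: le_trans eS _; apply: (survival_le g_density qz) => /=; last lra.
  by have := @K_lip z.2 (z.2 + (T - s)) ltac:(lra) => /andP[? _]; lra.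
have Sz0 : S z != 0 by rewrite gt_eqF// (lt_le_trans e0).
rewrite (drE _ eSz) (weight_inv e0 eSz) /drift_rate hazard_xE// hazard_yE//.
by field.
Qed.

End transport_identity.

Lemma eq_measure_bigcup (m1 m2 : {finite_measure set (R * R)%type -> \bar R})
    (Q : nat -> set (R * R)) : (forall n, measurable (Q n)) ->
  (forall n A, measurable A -> m1 (A `&` Q n) = m2 (A `&` Q n)) ->
  forall A, measurable A -> A `<=` \bigcup_n Q n -> m1 A = m2 A.
Proof.
move=> mQ H A mA AQ.
have mQD n : measurable (seqDU Q n).
  by apply: measurableD => //; apply: bigsetU_measurable.
have AE : A = \bigcup_n (A `&` seqDU Q n).
  by rewrite -setI_bigcupr -seqDU_bigcup_eq; apply/esym/setIidl.
have tA : trivIset setT (fun n => A `&` seqDU Q n).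
  by apply: trivIset_setIl; exact: trivIset_seqDU.
have mAn n : measurable (A `&` seqDU Q n) by exact: measurableI.
rewrite AE !measure_bigcup//; apply: eq_eseriesr => n _.
have -> : A `&` seqDU Q n = (A `&` seqDU Q n) `&` Q n.
  by apply/esym/setIidl => z [_ []].
exact: H.
Qed.

Section agreement.
Variables (m1 m2 : finmeas R) (M : \bar R).
Hypotheses (m1U : m1 (quad `\` Ug g) = 0%E) (m2U : m2 (quad `\` Ug g) = 0%E).
Hypothesis tests : forall a b p p' e, 0 < a -> 0 < b -> 0 <= p < a -> 0 <= p' < b ->
  (b%:E <= M)%E -> 0 < e -> e <= S (a, b) ->
  exists c c', [/\ between p a c, between p' b c' &
    pairing (fun z => c z.1 * c' z.2 * weight e z) m1 =
    pairing (fun z => c z.1 * c' z.2 * weight e z) m2].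

Let agree_corner a0 b0 : 0 < a0 -> 0 < b0 -> (b0%:E <= M)%E -> 0 < S (a0, b0) ->
  forall A, measurable A ->
  m1 (A `&` (quad `&` corner a0 b0)) = m2 (A `&` (quad `&` corner a0 b0)).
Proof.
move=> a00 b00 b0M S0.
apply: (@squeezed_measure_unique _ m1 m2 (weight (S (a0, b0))) a0 b0 (S (a0, b0))^-1) => //.
- exact: measurable_weight.
- by move=> z; exact: weight_ge0.
- move=> z qz /cornerP[za zb].
  have SS : S (a0, b0) <= S z by apply: (survival_le g_density qz); exact: ltW.
  rewrite weight_inv// invr_gt0 (lt_le_trans S0 SS)/= lef_pV2 ?posrE//.
  exact: lt_le_trans SS.
move=> a b p p' /andP[a_gt0 aa] /andP[b_gt0 bb] pa pb.
apply: tests => //; first by apply: le_trans b0M; rewrite lee_fin.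
by apply: (survival_le g_density) => //=; apply/quadP; split => /=; exact: ltW.
Qed.

(** Both measures live on [Ug], whose part below height [M] is covered by countably many corners to
    which the tests apply: those with rational vertex of height at most [M] and [S] positive at the
    vertex. Monotonicity of [S] then bounds [1 / S] on the whole corner. *)
Lemma agree_below (A : set (R * R)) : measurable A -> A `<=` [set z | (z.2%:E < M)%E] ->
  m1 A = m2 A.
Proof.
move=> mA AM.
have mUc : measurable (quad `\` Ug g).
  have -> : quad `\` Ug g = quad `&` S @^-1` [set 0].
    apply/seteqP; split=> z [qz Sz]; split => //.
      apply/eqP; rewrite eq_le survival_ge0// andbT leNgt; apply/negP => h.
      by apply: Sz.
    by move=> [_]; rewrite Sz ltxx.
  have := measurable_survival Sg_C1; apply => //; exact: measurable_quad.
have mUg : measurable (Ug g).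
  have -> : Ug g = quad `\` (quad `\` Ug g) by rewrite setDD; apply/esym/setIidr => z [].
  by apply: measurableD => //; exact: measurable_quad.
have mq := @measurable_quad R.
have AUg (m : finmeas R) : m (quad `\` Ug g) = 0%E -> m A = m (A `&` Ug g).
  move=> mU; rewrite -[in LHS](setIT A) -(setUv (Ug g)) setIUr measureU//; last 3 first.
  - by apply: measurableI => //.
  - by apply: measurableI => //; exact: measurableC.
  - by rewrite setIACA setICr setI0.
  rewrite [X in (_ + X)%E](_ : _ = 0%E) ?adde0//; apply/eqP.
  rewrite eq_le measure_ge0 andbT.
  have -> : 0%E = (m (quad `\` Ug g) + m (~` quad))%E :> \bar R.
    by rewrite mU finmeas_quad adde0.
  apply: (@le_trans _ _ (m ((quad `\` Ug g) `|` ~` quad))).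
    apply: le_measure; rewrite ?inE.
    + by apply: measurableI => //; exact: measurableC.
    + by apply: measurableU => //; exact: measurableC.
    + by move=> z [_ nU]; have [qz|qz] := pselect (quad z); [left|right].
  by apply: measureU2 => //; exact: measurableC.
rewrite (AUg m1)// (AUg m2)//.
pose ok (i : rat * rat) := `[< [/\ 0 < ratr i.1 :> R, 0 < ratr i.2 :> R,
  ((ratr i.2 : R)%:E <= M)%E & 0 < S (ratr i.1, ratr i.2)] >].
pose Q n : set (R * R) := if unpickle n is Some i then
  if ok i then quad `&` corner (ratr i.1) (ratr i.2) else set0 else set0.
apply: (@eq_measure_bigcup m1 m2 Q).
- move=> n; rewrite /Q; case: unpickle => [i|//]; case: ifP => // _.
  by apply: measurableI => //; exact: measurable_corner.
- move=> n B mB; rewrite /Q; case: unpickle => [i|]; last by rewrite setI0 !measure0.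
  case: ifP => [/asboolP[h1 h2 h3 h4]|_]; last by rewrite setI0 !measure0.
  exact: agree_corner.
- exact: measurableI.
move=> z [Az [qz Sz]]; have /quadP[z1 z2] := qz.
have zM : (z.2%:E < M)%E := AM _ Az.
(* By continuity [S] is still positive at a rational vertex slightly above and to the right of
   [z]. *)
have cS : continuous (S \o clamp) by apply: continuous_clamp; case: Sg_C1.
have := cS z; rewrite /continuous_at /= clamp_id// => cSz.
have : nbhs (S z) (fun x => 0 < x) by exact: lt_nbhsr.
move=> /cSz /nbhs_ballP[d /= d0 Hd].
have [q1] := @rat_in_itvoo R z.1 (z.1 + d) ltac:(lra).
rewrite in_itv /= => /andP[q1l q1r].
have [u [zu uM]] : exists u, z.2 < u /\ (u%:E <= M)%E.
  case: (M) zM => [r| |] //.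
    by rewrite lte_fin => h; exists r.
  by move=> _; exists (z.2 + 1); rewrite leey; split => //; lra.
have [q2] := @rat_in_itvoo R z.2 (Num.min u (z.2 + d)) ltac:(rewrite lt_min zu; lra).
rewrite in_itv /= lt_min => /andP[q2l /andP[q2u q2r]].
have QE i : ok i -> Q (pickle i) = quad `&` corner (ratr i.1) (ratr i.2).
  by rewrite /Q pickleK => ->.
have okq : ok (q1, q2).
  apply/asboolP; split; [rewrite /=; lra|rewrite /=; lra| |].
    by apply: le_trans uM; rewrite lee_fin ltW.
  have := Hd (ratr q1, ratr q2); rewrite /preimage /= clamp_id; last by apply/quadP; split => /=; lra.
  by apply; split; rewrite /ball /= ltr_norml; lra.
have Qz : Q (pickle (q1, q2)) z by rewrite (QE _ okq); split => //; apply/cornerP.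
exact: (ex_intro2 _ _ (pickle (q1, q2)) Logic.I Qz).
Qed.

End agreement.

End comparison.

(** * Comparison of solutions with known thresholds *)

Section threshold_comparison.
Context {R : realType}.
Variables (lambda0 : R) (g : R * R -> R).
Hypotheses (lambda0_gt0 : 0 < lambda0) (g_density : is_density g)
  (Sg_C1 : C1_quad (survival g)).
Implicit Types (z : R * R) (m : finmeas R) (nu mu : R -> finmeas R).

Definition null_solution nu := fluid_solution lambda0 g nu /\ measure_eq (nu 0) mzero.

Lemma between_cut (p q p' a : R) : p <= p' -> p' < q -> q <= a -> between p a (cut p' q).
Proof.
move=> pp' p'q qa; split.
- exact: continuous_measurable_fun (C1_fun_continuous (C1_fun_cut p'q)).
- by move=> x; rewrite cut_ge0 cut_le1.
- by move=> x xp; rewrite cut_eq1// ltW// (lt_le_trans xp).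
- by move=> x ax; rewrite cut_eq0// (le_trans qa).
Qed.

Lemma null_solution_Ug nu (T : R) : null_solution nu -> 0 <= T -> nu T (quad `\` Ug g) = 0%E.
Proof. by move=> [[_ + _ _ _] _]; apply. Qed.

(* Below the thresholds every individual is in service, so both coordinates
   grow at unit speed. *)
Lemma agree_below_thresholds nu mu (T : R) (M : \bar R) : null_solution nu ->
  null_solution mu -> 0 <= T ->
  (forall s, 0 <= s -> s <= T -> (M <= ystar (nu s))%E) ->
  (forall s, 0 <= s -> s <= T -> (M <= ystar (mu s))%E) ->
  forall A : set (R * R), measurable A -> A `<=` [set z | (z.2%:E < M)%E] ->
  nu T A = mu T A.
Proof.
move=> Snu Smu T0 Hnu Hmu A mA AM.
apply: (agree_below g_density Sg_C1 _ _ _ mA AM); try exact: null_solution_Ug.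
move=> a b p p' e a0 b0 /andP[p0 pa] /andP[p'0 p'b] bM e0 eS.
exists (cut p a), (cut p' b); split; try exact: between_cut.
have K_lip (u v : R) : u <= v -> 0 <= id v - id u <= v - u.
  by move=> uv; rewrite lexx subr_ge0 uv.
have key ka : null_solution ka ->
    (forall s, 0 <= s -> s <= T -> (M <= ystar (ka s))%E) ->
  pairing (fun z => cut p a z.1 * cut p' b z.2 * weight g e z) (ka T) =
  lambda0 * \int[lebesgue_measure]_(s in `[0, T])
    (cut p a (id (T - s) - id 0) * cut p' b (T - s) * weight g e (0, 0)).
  move=> [ka_sol ka0] Hka.
  apply: (weighted_transport g_density Sg_C1 ka_sol ka0 T0 e0 eS
    C1_fun_id (C1_fun_cut pa) (C1_fun_cut p'b) K_lip).
  - by move=> x; exact: cut_eq0.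
  - by move=> x; exact: cut_eq0.
  move=> s s0 sT; exists set0; first by rewrite measure0.
  move=> z qz _; have [zb|zb] := leP b (z.2 + (T - s)); first by rewrite (cut_eq0 _ zb) mulr0.
  have -> : rbar (ka s) z = 1.
    rewrite /rbar (le_trans _ (Hka s s0 sT))// (le_trans _ bM)// lee_fin; lra.
  by rewrite subrr !mul0r.
by rewrite (key nu Snu Hnu) (key mu Smu Hmu).
Qed.

(** What the smoothed comparison must know about a solution. The diagonal support is needed because
    the smoothed speed is wrong just before age [ys], and only on the diagonal is the argument of
    the x-cutoff under control there. *)
Definition settled (ys : R) nu :=
  [/\ forall s, 0 <= s -> (ys%:E <= ystar (nu s))%E,
      forall s, ys <= s -> (ystar (nu s) <= ys%:E)%E
    & forall s, 0 <= s -> nu s [set z | [/\ quad z, z.2 < ys & z.1 != z.2]] = 0%E].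

Lemma measurable_off_diagonal (ys : R) :
  measurable [set z : R * R | [/\ quad z, z.2 < ys & z.1 != z.2]].
Proof.
have -> : [set z : R * R | [/\ quad z, z.2 < ys & z.1 != z.2]] =
    quad `&` ((setT `*` `]-oo, ys[%classic) `&` ((fun z => z.1 - z.2) @^-1` [set x : R | x != 0])).
  apply/seteqP; split=> z /=.
    by move=> [qz zy z12]; split => //; split; [split => //=; rewrite in_itv|rewrite subr_eq0].
  by rewrite in_itv /= subr_eq0 => -[qz [[_ zy] z12]].
apply: measurableI; first exact: measurable_quad.
apply: measurableI; first by apply: measurableX => //; exact: measurable_itv.
rewrite -[X in measurable X]setTI; apply: continuous_measurable_plane => //.
  by move=> z; apply: cvgB; [exact: cvg_fst|exact: cvg_snd].
by apply: open_measurable; exact: open_neq.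
Qed.

Lemma agree_settled nu mu (T ys : R) : null_solution nu -> null_solution mu -> 0 <= T ->
  0 < ys -> settled ys nu -> settled ys mu ->
  forall A : set (R * R), measurable A -> nu T A = mu T A.
Proof.
move=> Snu Smu T0 ys0 Hnu Hmu A mA.
apply: (@agree_below _ g g_density Sg_C1 _ _ +oo%E _ _ _ A mA); try exact: null_solution_Ug; last first.
  by move=> z _ /=; rewrite ltry.
move=> a b p p' e a0 b0 /andP[p0 pa] /andP[p'0 p'b] bM e0 eS.
(* The cutoff in [x] is constant on [l, ys], where the trajectories slow down. *)
have [p1 [q1 [l [/andP[pp1 p1q1] q1a /andP[l0 lys] dc0]]]] : exists p1 q1 l : R,
    [/\ p <= p1 < q1, q1 <= a, 0 <= l < ys & forall x, l <= x <= ys -> dcut p1 q1 x = 0].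
  (* If [ys < a], the cutoff stays 1 at least up to [ys]. Otherwise it is 0 from the midpoint of [p]
     and [a] on, which lies before [ys]. *)
  have [ya|ay] := ltP ys a.
    exists (Num.max p ys), a, (ys / 2); split => //.
    - by rewrite le_max lexx /= gt_max pa ya.
    - by apply/andP; split; lra.
    - by move=> x /andP[_ xy]; apply: dcut_eq0; left; rewrite le_max xy orbT.
  exists ((3 * p + a) / 4), ((p + a) / 2), ((p + a) / 2); split.
  - by apply/andP; split; lra.
  - lra.
  - by apply/andP; split; lra.
  - by move=> x /andP[h _]; apply: dcut_eq0; right.
exists (cut p1 q1), (cut p' b); split; try exact: between_cut.
have K_lip (u v : R) : u <= v -> 0 <= ramp l ys v - ramp l ys u <= v - u.
  move=> uv; rewrite subr_ge0 ramp_nondecreasing//=.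
  have := ramp_sub_le lys uv; lra.
have key ka : null_solution ka -> settled ys ka ->
  pairing (fun z => cut p1 q1 z.1 * cut p' b z.2 * weight g e z) (ka T) =
  lambda0 * \int[lebesgue_measure]_(s in `[0, T])
    (cut p1 q1 (ramp l ys (T - s) - ramp l ys 0) * cut p' b (T - s) * weight g e (0, 0)).
  move=> [ka_sol ka0] [H1 H2 H3].
  apply: (weighted_transport g_density Sg_C1 ka_sol ka0 T0 e0 eS
    (C1_fun_ramp lys) (C1_fun_cut p1q1) (C1_fun_cut p'b) K_lip).
  - by move=> x ax; apply: cut_eq0; exact: le_trans ax.
  - by move=> x; exact: cut_eq0.
  move=> s s0 sT.
  (* [N2] is the single age [ys], where the model speed is 0 but the actual one is 1. [N3] matters
     for [s < ys]: it contains the ages above [ys], for which no upper bound on the threshold is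
     then available. *)
  pose N1 : set (R * R) := [set z | [/\ quad z, z.2 < ys & z.1 != z.2]].
  pose N2 : set (R * R) := nneg `*` `[ys, ys].
  pose N3 : set (R * R) := nneg `*` `]s, +oo[.
  have mN1 : measurable N1 by exact: measurable_off_diagonal.
  have mN2 : measurable N2 by apply: measurable_nnegX; exact: measurable_itv.
  have mN3 : measurable N3 by apply: measurable_nnegX; exact: measurable_itv.
  exists (N1 `|` N2 `|` N3).
    split; first by do 2 apply: measurableU => //.
    apply: null_set_setU => //; first exact: measurableU.
      apply: null_set_setU => //; first exact: H3.
      exact: (age_mass_line lambda0_gt0 g_density Sg_C1 ka_sol ka0).
    exact: (age_mass_gt g_density Sg_C1 ka_sol ka0).
  move=> z qz nN; have /quadP[z1 z2] := qz.
  have nz : nneg z.1 by rewrite /nneg /= in_itv /= z1.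
  have r1 : z.2 <= ys -> rbar (ka s) z = 1.
    by move=> zy; rewrite /rbar (le_trans _ (H1 s s0))// lee_fin.
  (* Up to age [l] both speeds are 1. Between [l] and [ys] the point is on the diagonal and
     [ramp_shift] keeps it where the x-cutoff is constant. Beyond [ys] both speeds are 0. *)
  have [zl|zl] := leP z.2 l.
    by rewrite dramp_le// r1 ?subrr ?mul0r// (le_trans zl)// ltW.
  have [zy|zy|zy] := ltgtP z.2 ys.
  - have z12 : z.1 = z.2.
      by apply/eqP; apply: contrapT => /negP ne; apply: nN; left; left.
    rewrite z12 dc0 ?mulr0 ?mul0r//; apply: ramp_shift => //; last lra.
    by rewrite (ltW zl) (ltW zy).
  - rewrite dramp_ge ?ltW// subr0.
    have [ys_s|s_ys] := leP ys s.
      have -> : rbar (ka s) z = 0; last by rewrite !mul0r.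
      rewrite /rbar; case: leP => // h; exfalso.
      by have := le_trans h (H2 s ys_s); rewrite lee_fin leNgt zy.
    exfalso; apply: nN; right; split => //=.
    by rewrite in_itv /= andbT (lt_trans s_ys).
  - exfalso; apply: nN; left; right; split => //=.
    by rewrite in_itv /= zy lexx.
by rewrite (key nu Snu Hnu) (key mu Smu Hmu).
Qed.

End threshold_comparison.

(** * The fundamental theorem of calculus along diagonal and vertical paths *)

Section integration_along_paths.
Context {R : realType}.
Local Notation leb := (@lebesgue_measure R).

(** Read off the definition as a supremum over simple functions. It bounds time integrals of
    quantities whose measurability in time has not been established. *)
Lemma ge0_le_integral_nonmeasurable d (X : measurableType d)
    (m : {measure set X -> \bar R}) (D : set X) (f1 f2 : X -> \bar R) :
  (forall x, D x -> 0 <= f1 x)%E -> (forall x, D x -> f1 x <= f2 x)%E ->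
  (\int[m]_(x in D) f1 x <= \int[m]_(x in D) f2 x)%E.
Proof.
move=> f10 f12; rewrite integral_mkcond [leRHS]integral_mkcond.
have H x : (0 <= (f1 \_ D) x)%E /\ ((f1 \_ D) x <= (f2 \_ D) x)%E.
  rewrite !patchE; case: ifPn => // /[!inE] Dx; split; [exact: f10|exact: f12].
rewrite !ge0_integralTE; last 2 first.
- by move=> x; have [h1 h2] := H x; exact: le_trans h2.
- by move=> x; case: (H x).
apply: ereal_sup_le => _ /= [h hf <-].
by exists h => // x; apply: le_trans (hf x) _; case: (H x).
Qed.

Lemma FTC_segment (f F : R -> R) (a b : R) : a <= b ->
  {within `[a, b], continuous f} -> {within `[a, b], continuous F} ->
  (forall x, a < x -> x < b -> is_derive (x : R) (1 : R) F (f x)) ->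
  \int[leb]_(x in `[a, b]) f x = F b - F a.
Proof.
rewrite le_eqVlt => /predU1P[-> _ _ _|ab cf cF dF].
  by rewrite /Rintegral set_itv1 integral_set1 subrr.
have /(continuous_within_itvP _ ab)[_ Fa Fb] := cF.
have dlr : derivable_oo_LRcontinuous F a b.
  by split => // x; rewrite in_itv /= => /andP[ax xb]; exact: (@ex_derive _ _ _ _ _ _ _ (dF x ax xb)).
rewrite /Rintegral (continuous_FTC2 ab cf dlr)// => x.
by rewrite in_itv /= => /andP[ax xb]; rewrite derive1E (@derive_val _ _ _ _ _ _ _ (dF x ax xb)).
Qed.

Record C1_plane (f fx fy : R * R -> R) : Prop := C1Plane {
  C1_plane_cont : {within quad, continuous f};
  C1_plane_cx : {within quad, continuous fx};
  C1_plane_cy : {within quad, continuous fy};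
  C1_plane_x : forall z, quad z -> is_derive_nneg (fun x => f (x, z.2)) z.1 (fx z);
  C1_plane_y : forall z, quad z -> is_derive_nneg (fun y => f (z.1, y)) z.2 (fy z) }.

(** The increment is split at [(u, u + t)]. The vertical part is a partial derivative at a fixed
    point. The horizontal part has a base point moving with [t], so it takes the mean value theorem
    and the continuity of [fx]. *)
Lemma is_derive_diagonal (f fx fy : R * R -> R) (u : R) : C1_plane f fx fy -> 0 < u ->
  is_derive (u : R) (1 : R) (fun u => f (u, u)) (fx (u, u) + fy (u, u)).
Proof.
move=> [fc cx _ dxf dyf] u0.
have quu : quad (u, u) by apply/quadP; split; exact: ltW.
have dyu : is_derive (u : R) (1 : R) (fun y => f (u, y)) (fy (u, u)).
  by apply: is_derive_nneg_is_derive => //; exact: (dyf (u, u)).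
have [ey Ey] := dyu.
have cvy : (fun t : R => t^-1 *: (f (u, t *: (1 : R) + u) - f (u, u))) @ 0^' --> fy (u, u).
  by rewrite -Ey; exact: ey.
have cvx : (fun t : R => t^-1 *: (f (t *: (1 : R) + u, t *: (1 : R) + u) - f (u, t *: (1 : R) + u)))
    @ 0^' --> fx (u, u).
  apply/cvgrPdist_lt => e e0.
  have cc : continuous (fx \o clamp) by exact: continuous_clamp.
  have := cc (u, u); rewrite /continuous_at /= clamp_id// => ccx.
  have /nbhs_ballP[d /= d0 Hd] := ccx _ (nbhsx_ballx _ _ e0).
  (* The bound by [u] keeps [t + u] positive, where the derivatives relative to the half-line are
     two-sided. *)
  apply/nbhs_ballP; exists (Num.min d u) => /=; first by rewrite lt_min d0.
  move=> t; rewrite /ball /= sub0r normrN lt_min /GRing.scale /= => /andP[td tu] t0.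
  rewrite !mulr1; have tu0 : 0 < t + u by move: tu; rewrite ltr_norml; lra.
  have D x : 0 < x -> is_derive (x : R) (1 : R) (fun x => f (x, t + u)) (fx (x, t + u)).
    move=> x0; apply: is_derive_nneg_is_derive => //.
    by apply: (dxf (x, t + u)); apply/quadP; split => /=; exact: ltW.
  have C x : 0 < x -> {for x, continuous (fun x => f (x, t + u))}.
    move=> x0; apply/differentiable_continuous/derivable1_diffP.
    exact: (@ex_derive _ _ _ _ _ _ _ (D x x0)).
  have near_uu c : `|c - u| < d -> 0 < c -> `|fx (u, u) - fx (c, t + u)| < e.
    move=> cd c0; have := Hd (c, t + u); rewrite /preimage /= clamp_id; last first.
      by apply/quadP; split => /=; exact: ltW.
    apply; split; rewrite /ball /=; first by rewrite distrC.
    by rewrite opprD addrCA subrr addr0 normrN.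
  have mvt p q : 0 < p -> p < q -> exists c, [/\ p < c, c < q &
      f (q, t + u) - f (p, t + u) = fx (c, t + u) * (q - p)].
    move=> p0 pq; have [|||c] := @MVT R (fun x => f (x, t + u)) (fun x => fx (x, t + u)) p q.
    - by [].
    - by move=> x; rewrite in_itv /= => /andP[px _]; apply: D; exact: lt_trans px.
    - apply: continuous_in_subspaceT => x; rewrite inE /= in_itv /= => /andP[px _].
      by apply: C; exact: lt_le_trans px.
    by rewrite in_itv /= => /andP[pc cq] E; exists c.
  have [tpos|tneg] := ltP 0 t.
    have [c [uc ct ->]] := mvt u (t + u) u0 ltac:(lra).
    rewrite addrK mulrCA mulVf// mulr1; apply: near_uu; last exact: lt_trans uc.
    by move: td; rewrite !ltr_norml; lra.
  have tlt0 : t < 0 by rewrite lt_neqAle t0.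
  have [c [uc ct E]] := mvt (t + u) u tu0 ltac:(lra).
  have -> : f (t + u, t + u) - f (u, t + u) = fx (c, t + u) * t.
    by rewrite -opprB E; ring.
  rewrite mulrCA mulVf// mulr1; apply: near_uu; last exact: lt_trans uc.
  by move: td; rewrite !ltr_norml; lra.
have H : (fun t : R => t^-1 *: (((fun u => f (u, u)) \o shift u) (t *: (1 : R)) - f (u, u)))
    @ 0^' --> fx (u, u) + fy (u, u).
  have -> : (fun t : R => t^-1 *: (((fun u => f (u, u)) \o shift u) (t *: (1 : R)) - f (u, u))) =
      (fun t : R => t^-1 *: (f (t *: (1 : R) + u, t *: (1 : R) + u) - f (u, t *: (1 : R) + u))) \+
      (fun t : R => t^-1 *: (f (u, t *: (1 : R) + u) - f (u, u))).
    apply/funext => t; rewrite /= -scalerDr; congr (_ *: _).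
    by rewrite addrA subrK.
  exact: cvgD cvx cvy.
apply: DeriveDef; first by apply/cvg_ex; eexists; exact: H.
exact/cvg_lim.
Qed.

Lemma continuous_clamp_path (f : R * R -> R) (c : R -> R) : {within quad, continuous f} ->
  continuous c -> continuous (fun u => f (clamp (c u, u))).
Proof.
move=> /continuous_clamp cf cc u.
have idu : (fun v : R => v) @ u --> u by exact: cvg_id.
have cu : (fun v : R => (c v, v)) @ u --> (c u, u) by exact: (cvg_pair (cc u) idu).
by apply: (@cvg_comp _ _ _ (fun v : R => (c v, v)) (f \o clamp)); [exact: cu|exact: cf].
Qed.

Lemma eq_within_segment (f h : R -> R) (a b : R) : continuous h ->
  (forall x, a <= x <= b -> h x = f x) -> {within `[a, b], continuous f}.
Proof.
move=> ch e; apply/subspace_continuousP => x abx; rewrite /from_subspace -e//.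
move=> A Ax; have H := ch x A Ax.
change (nbhs x (fun y => `[a, b]%classic y -> A (f y))).
have {}H : nbhs x (fun y => A (h y)) := H.
by apply: filterS H => y Ay aby; rewrite -e.
Qed.

Variables (f fx fy : R * R -> R).
Hypothesis Cf : C1_plane f fx fy.

Lemma integral_diagonal (s : R) : 0 <= s ->
  \int[leb]_(u in `[0, s]) (fx (u, u) + fy (u, u)) = f (s, s) - f (0, 0).
Proof.
move=> s0; apply: (@FTC_segment _ (fun u => f (u, u))) => //.
- apply: (@eq_within_segment _ (fun u => fx (clamp (u, u)) + fy (clamp (u, u)))).
    move=> u; apply: cvgD.
      by apply: (@continuous_clamp_path fx id); [exact: C1_plane_cx Cf|move=> ?; exact: cvg_id].
    by apply: (@continuous_clamp_path fy id); [exact: C1_plane_cy Cf|move=> ?; exact: cvg_id].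
  by move=> x /andP[x0 _]; rewrite clamp_id//; apply/quadP.
- apply: (@eq_within_segment _ (fun u => f (clamp (u, u)))).
    by apply: (@continuous_clamp_path f id); [exact: C1_plane_cont Cf|move=> ?; exact: cvg_id].
  by move=> x /andP[x0 _]; rewrite clamp_id//; apply/quadP.
- by move=> x x0 _; exact: is_derive_diagonal Cf _.
Qed.

Lemma integral_vertical (c r s : R) : 0 <= c -> 0 <= r -> r <= s ->
  \int[leb]_(u in `[r, s]) fy (c, u) = f (c, s) - f (c, r).
Proof.
move=> c0 r0 rs; apply: (@FTC_segment _ (fun u => f (c, u))) => //.
- apply: (@eq_within_segment _ (fun u => fy (clamp (c, u)))).
    by apply: (@continuous_clamp_path fy (fun=> c)); [exact: C1_plane_cy Cf|move=> ?; exact: cvg_cst].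
  by move=> x /andP[x0 _]; rewrite clamp_id//; apply/quadP; split => //=; exact: le_trans x0.
- apply: (@eq_within_segment _ (fun u => f (clamp (c, u)))).
    by apply: (@continuous_clamp_path f (fun=> c)); [exact: C1_plane_cont Cf|move=> ?; exact: cvg_cst].
  by move=> x /andP[x0 _]; rewrite clamp_id//; apply/quadP; split => //=; exact: le_trans x0.
- move=> x rx _; apply: is_derive_nneg_is_derive; first exact: le_lt_trans rx.
  by apply: (C1_plane_y Cf (z := (c, x))); apply/quadP; split => //=; rewrite (le_trans r0)// ltW.
Qed.

End integration_along_paths.

Lemma lebesgue_segment (R : realType) (t : R) : 0 <= t ->
  lebesgue_measure `[0, t]%classic = t%:E.
Proof.
move=> t0; rewrite lebesgue_measure_itv /= lte_fin sube0.
by case: ltgtP t0 => // <-.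
Qed.

(** * Fubini's theorem on a triangle *)

Section triangle.
Context {R : realType}.
Local Notation leb := (@lebesgue_measure R).
Variables (t C : R) (f : R * R -> R).
Hypotheses (t0 : 0 <= t) (mf : measurable_fun setT f)
  (fC : forall s u, 0 <= s <= t -> 0 <= u <= t -> `|f (s, u)| <= C).

Let Tri : set (R * R) := [set p | [/\ 0 <= p.2, p.2 <= p.1 & p.1 <= t]].

Let mTri : measurable Tri.
Proof.
have -> : Tri = (`]-oo, t]%classic `*` `[0, +oo[%classic) `&`
    ((fun p : R * R => p.1 - p.2) @^-1` `[0, +oo[%classic).
  apply/seteqP; split=> p /=; rewrite !in_itv /= ?andbT.
    by move=> [h1 h2 h3]; split => //; rewrite subr_ge0.
  by rewrite subr_ge0 => -[[h1 h2] h3].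
apply: measurableI; first by apply: measurableX; exact: measurable_itv.
rewrite -[X in measurable X]setTI; apply: continuous_measurable_plane => //.
  by move=> z; apply: cvgB; [exact: cvg_fst|exact: cvg_snd].
Qed.

Let finTri : ((leb \x leb) Tri < +oo)%E.
Proof.
pose Q : set (R * R) := `[0, t]%classic `*` `[0, t]%classic.
apply: (@le_lt_trans _ _ ((leb \x leb)%E Q)).
  apply: le_measure; rewrite ?inE //; first by apply: measurableX; exact: measurable_itv.
  move=> p [h1 h2 h3]; split => /=; rewrite in_itv /=; apply/andP; split => //.
    exact: le_trans h2.
  exact: le_trans h3.
rewrite /Q product_measure1E//.
change (leb `[0%R, t]%classic * leb `[0%R, t]%classic < +oo)%E.
by rewrite lebesgue_segment// -EFinM ltry.
Qed.

Let iTri : (leb \x leb)%E.-integrable setT ((EFin \o f) \_ Tri).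
Proof.
have H : (leb \x leb)%E.-integrable Tri (EFin \o f).
  apply: measurable_bounded_integrable => //; first exact: measurable_funTS.
  exists C; split; first exact: num_real.
  move=> M CM p [h1 h2 h3]; apply: le_trans (ltW CM); case: p h1 h2 h3 => s u /= h1 h2 h3.
  by apply: fC; apply/andP; split => //; [exact: le_trans h2|exact: le_trans h3].
exact: (@integrable_mkcond _ _ R (leb \x leb)%E Tri (EFin \o f) mTri).1 H.
Qed.

Let msec1 s D : measurable_fun D (fun u => f (s, u)).
Proof.
have H : measurable_fun [set: R] (fun u : R => (s, u)).
  by apply: measurable_fun_pair; [exact: measurable_cst|exact: measurable_id].
by apply: measurable_funTS; apply: (measurableT_comp mf H).
Qed.

Let FE s : fubini_F leb ((EFin \o f) \_ Tri) s =
  if (0 <= s <= t)%R then (\int[leb]_(u in `[0%R, s]) (f (s, u))%:E)%E else 0%E.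
Proof.
rewrite /fubini_F; case: ifPn => [/andP[s0 st]|ns].
  rewrite [RHS]integral_mkcond; apply: eq_integral => u _; rewrite !patchE.
  congr (if _ then _ else _); apply/idP/idP; rewrite !inE /= in_itv /=.
    by move=> [h1 h2 h3]; apply/andP.
  by move=> /andP[h1 h2].
rewrite integral0_eq// => u _; rewrite patchE ifF//; apply/negbTE.
rewrite notin_setE => -[/= h1 h2 h3]; move/negP: ns; apply.
by rewrite h3 (le_trans h1).
Qed.

Let GE u : fubini_G leb ((EFin \o f) \_ Tri) u =
  if (0 <= u <= t)%R then (\int[leb]_(s in `[u, t]) (f (s, u))%:E)%E else 0%E.
Proof.
rewrite /fubini_G; case: ifPn => [/andP[u0 ut]|nu].
  rewrite [RHS]integral_mkcond; apply: eq_integral => s _; rewrite !patchE.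
  congr (if _ then _ else _); apply/idP/idP; rewrite !inE /= in_itv /=.
    by move=> [h1 h2 h3]; apply/andP.
  by move=> /andP[h1 h2].
rewrite integral0_eq// => s _; rewrite patchE ifF//; apply/negbTE.
rewrite notin_setE => -[/= h1 h2 h3]; move/negP: nu; apply.
by rewrite h1 (le_trans h2).
Qed.

Let bounded_fin (D : set R) (h : R -> R) : measurable D -> D `<=` `[0, t]%classic ->
  measurable_fun D h -> (forall x, D x -> `|h x| <= C) ->
  leb.-integrable D (EFin \o h).
Proof.
move=> mD Dt mh hC; apply: measurable_bounded_integrable => //.
  apply: (@le_lt_trans _ _ (leb `[0, t]%classic)).
    by apply: le_measure; rewrite ?inE//; exact: measurable_itv.
  by rewrite lebesgue_segment// ltry.
exists C; split; first exact: num_real.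
by move=> M CM x Dx; apply: le_trans (hC _ Dx) _; exact: ltW.
Qed.

Let secF s : 0 <= s <= t -> leb.-integrable `[0, s] (EFin \o (fun u => f (s, u))).
Proof.
move=> /andP[s0 st]; apply: bounded_fin => //.
- by move=> u /=; rewrite !in_itv /= => /andP[-> us] /=; exact: le_trans st.
- by move=> u /=; rewrite in_itv /= => /andP[u0 us]; apply: fC; rewrite ?s0 ?st ?u0//= (le_trans us).
Qed.

Let FEr s : 0 <= s <= t ->
  (\int[leb]_(u in `[0, s]) f (s, u))%:E = fubini_F leb ((EFin \o f) \_ Tri) s.
Proof.
move=> st; rewrite FE st /Rintegral fineK//; apply: integrable_fin_num => //.
exact: secF.
Qed.

(** Measurability of the inner integral in [s] comes with Fubini's theorem applied to [f] cut off
    outside the triangle; integrability comes from the bound [C] on the square. *)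
Lemma integrable_triangle :
  leb.-integrable `[0, t] (EFin \o (fun s => \int[leb]_(u in `[0, s]) f (s, u))).
Proof.
have I0 : leb.-integrable setT (fubini_F leb ((EFin \o f) \_ Tri)).
  exact: integrable_fubini_F iTri.
have I1 : leb.-integrable `[0, t] (fubini_F leb ((EFin \o f) \_ Tri)).
  exact: (@integrableS _ _ _ leb setT `[0, t]%classic _ measurableT (measurable_itv _) (@subsetT _ _) I0).
apply: (@eq_integrable _ _ _ leb `[0, t]%classic (measurable_itv _) _ _ _ I1).
by move=> s; rewrite inE /= in_itv /= => st; rewrite FEr.
Qed.

Lemma Fubini_triangle :
  \int[leb]_(s in `[0, t]) \int[leb]_(u in `[0, s]) f (s, u) =
  \int[leb]_(u in `[0, t]) \int[leb]_(s in `[u, t]) f (s, u).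
Proof.
rewrite /Rintegral; congr fine.
transitivity (\int[leb]_s fubini_F leb ((EFin \o f) \_ Tri) s)%E.
  rewrite integral_mkcond; apply: eq_integral => s _; rewrite patchE FE.
  rewrite mem_setE in_itv /=; case: ifPn => // st.
  by have := FEr st; rewrite FE st.
rewrite /fubini_F Fubini//.
transitivity (\int[leb]_u fubini_G leb ((EFin \o f) \_ Tri) u)%E; first by [].
rewrite [RHS]integral_mkcond; apply: eq_integral => u _; rewrite patchE GE.
rewrite mem_setE in_itv /=; case: ifPn => // /andP[u0 ut].
rewrite fineK//; apply: integrable_fin_num => //; apply: bounded_fin => //.
- by move=> s /=; rewrite !in_itv /= => /andP[us ->]; rewrite andbT; exact: le_trans us.
- have H : measurable_fun [set: R] (fun s : R => (s, u)).
    by apply: measurable_fun_pair; [exact: measurable_id|exact: measurable_cst].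
  by apply: measurable_funTS; apply: (measurableT_comp mf H).
- move=> s /=; rewrite in_itv /= => /andP[us st]; apply: fC; rewrite ?u0 ?ut ?st ?andbT//.
  exact: le_trans us.
Qed.

End triangle.

(** * The critical age, the trajectory and the candidate measure *)

Section critical_age_theory.
Context {R : realType}.
Variables (lambda0 : R) (g : R * R -> R).
Hypotheses (lambda0_gt0 : 0 < lambda0) (g_density : is_density g)
  (Sg_C1 : C1_quad (survival g)).
Local Notation S := (survival g).
Local Notation leb := (@lebesgue_measure R).
Local Notation ys := (critical_age lambda0 g).

Lemma clamped_survival (c : R -> R) : continuous c ->
  continuous (fun u => S (clamp (c u, u))).
Proof. by move=> cc; apply: continuous_clamp_path => //; case: Sg_C1. Qed.

Lemma clamp_diag (u : R) : 0 <= u -> clamp (u, u) = (u, u).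
Proof. by move=> u0; rewrite clamp_id//; apply/quadP. Qed.

Lemma integrable_continuous_segment (f : R -> R) (a b : R) : continuous f ->
  leb.-integrable `[a, b] (EFin \o f).
Proof.
move=> cf; apply: continuous_compact_integrable; first exact: segment_compact.
exact: continuous_subspaceT.
Qed.

Definition served_mass (y : R) : R := lambda0 * \int[leb]_(u in `[0, y]) S (u, u).

Let served_massE y : served_mass y = lambda0 * \int[leb]_(u in `[0, y]) S (clamp (u, u)).
Proof.
apply: (congr1 (fun x => lambda0 * x)); apply: eq_Rintegral => u; rewrite inE /= in_itv /= => /andP[u0 _].
by rewrite clamp_diag.
Qed.

Let cS : continuous (fun u : R => S (clamp (u, u))).
Proof. by apply: (@clamped_survival id) => x; exact: cvg_id. Qed.

(** The integrand lies between 0 and 1. The Lipschitz bound makes the critical age at least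
    [1 / lambda0], and a finite critical age a point where mass one is actually reached. *)
Lemma served_mass_le a b : 0 <= a -> a <= b ->
  served_mass a <= served_mass b <= served_mass a + lambda0 * (b - a).
Proof.
move=> a0 ab; rewrite !served_massE -mulrDr !ler_pM2l//.
have iS : leb.-integrable `[0, b] (EFin \o (fun u => S (clamp (u, u)))).
  exact: integrable_continuous_segment.
have iSab : leb.-integrable `]a, b] (EFin \o (fun u => S (clamp (u, u)))).
  apply: integrableS iS => //=.
  by move=> x /=; rewrite !in_itv /= => /andP[/ltW ax ->]; rewrite (le_trans a0).
have E : \int[leb]_(u in `[0, b]) S (clamp (u, u)) - \int[leb]_(u in `[0, a]) S (clamp (u, u)) =
    \int[leb]_(u in `]a, b]) S (clamp (u, u)).
  by apply: Rintegral_itvB iS _ _; rewrite bnd_simp.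
have S0 u : 0 <= S (clamp (u, u)) by apply: survival_ge0 => //; exact: quad_clamp.
have h1 : 0 <= \int[leb]_(u in `]a, b]) S (clamp (u, u)) by apply: Rintegral_ge0.
have h2 : \int[leb]_(u in `]a, b]) S (clamp (u, u)) <= b - a.
  apply: (@le_trans _ _ (\int[leb]_(u in `]a, b]) 1)).
    apply: le_Rintegral => //.
      have icst : leb.-integrable `[a, b] (EFin \o (fun=> 1)).
        by apply: integrable_continuous_segment => x; exact: cvg_cst.
      apply: integrableS icst => //= x; exact: subset_itv_oc_cc.
    by move=> u _; apply: survival_le1 => //; exact: quad_clamp.
  rewrite Rintegral_cst// mul1r.
  have L : leb `]a, b]%classic = (b - a)%:E.
    by rewrite lebesgue_measure_itv /= lte_fin -EFinB; case: ltgtP ab => // ->; rewrite subrr.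
  by rewrite le_eqVlt; apply/orP; left; apply/eqP; exact: (congr1 fine L).
by rewrite -E in h1 h2; apply/andP; split; lra.
Qed.

Lemma served_mass0 : served_mass 0 = 0.
Proof. by rewrite /served_mass set_itv1 /Rintegral integral_set1 mulr0. Qed.

Lemma critical_age_gt0 : (0 < ys)%E.
Proof.
apply: (@lt_le_trans _ _ (lambda0^-1)%:E); first by rewrite lte_fin invr_gt0.
apply/ereal_infP => _ [y [y0 Gy] <-]; rewrite lee_fin.
have := served_mass_le (lexx 0) y0; rewrite served_mass0 add0r subr0 => /andP[_ h].
by rewrite -div1r ler_pdivrMr// mulrC (le_trans _ h).
Qed.

Lemma served_mass_lt1 y : 0 <= y -> (y%:E < ys)%E -> served_mass y < 1.
Proof.
move=> y0; rewrite ltNge => /negP ny; rewrite ltNge; apply/negP => Gy; apply: ny.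
by apply: ereal_inf_lbound; exists y.
Qed.

Lemma served_mass_ge1 r : ys = r%:E -> 1 <= served_mass r.
Proof.
move=> yr; have r0 : 0 < r by rewrite -lte_fin -yr critical_age_gt0.
apply/ler_addgt0Pr => e e0.
have d0 : 0 < e / lambda0 by rewrite divr_gt0.
have : (ys < (r + e / lambda0)%:E)%E by rewrite yr lte_fin ltrDl.
move=> /ereal_inf_lt[_ [y [y0 Gy] <-]]; rewrite lte_fin => yr'.
have [ry|yr''] := leP r y.
  have /andP[_ h] := served_mass_le (ltW r0) ry.
  apply: le_trans Gy _; apply: le_trans h _; rewrite lerD2l.
  rewrite mulrC -ler_pdivlMr// lerBlDl; exact: ltW.
have /andP[h _] := served_mass_le y0 (ltW yr'').
by apply: le_trans Gy _; apply: le_trans h _; rewrite lerDl ltW.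
Qed.

(** The [fine] loses nothing: the critical age is positive, so the minimum is a real number even if
    the critical age is infinite. *)
Definition cap (u : R) : R := fine (mine u%:E ys).

Lemma cap_id u : (u%:E <= ys)%E -> cap u = u.
Proof. by move=> uy; rewrite /cap min_l. Qed.

Lemma cap_crit r u : ys = r%:E -> r <= u -> cap u = r.
Proof. by move=> yr ru; rewrite /cap yr -EFin_min min_r. Qed.

Lemma cap_ge0 u : 0 <= u -> 0 <= cap u.
Proof.
move=> u0; have := critical_age_gt0; rewrite /cap; case: ys => [r| |] //=.
  by rewrite lte_fin -EFin_min /= le_min u0 => /ltW.
by move=> _; rewrite min_l ?leey.
Qed.

Lemma cap_continuous : continuous cap.
Proof.
have := critical_age_gt0; rewrite /cap; case: ys => [r| |] // _ u.
  have -> : (fun u => fine (mine u%:E r%:E)) = (fun u : R => Num.min u r).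
    by apply/funext => v; rewrite -EFin_min.
  by apply: (@continuous_min _ _ id (fun=> r)); [exact: cvg_id|exact: cvg_cst].
have -> : (fun u : R => fine (mine u%:E +oo%E)) = id.
  by apply/funext => v; rewrite min_l ?leey.
exact: cvg_id.
Qed.

Definition trajectory (u : R) : R * R := (cap u, u).

Lemma quad_trajectory u : 0 <= u -> quad (trajectory u).
Proof. by move=> u0; apply/quadP; split => //=; exact: cap_ge0. Qed.

Lemma clamp_trajectory u : 0 <= u -> clamp (trajectory u) = trajectory u.
Proof. by move=> u0; rewrite clamp_id//; exact: quad_trajectory. Qed.

Lemma measurable_trajectory : measurable_fun setT trajectory.
Proof.
apply: measurable_fun_pair; last exact: measurable_id.
by apply: continuous_measurable_fun; exact: cap_continuous.
Qed.

Let cSz : continuous (fun u => S (clamp (trajectory u))).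
Proof. by apply: clamped_survival; exact: cap_continuous. Qed.

(** Clamping makes the rate continuous on the whole line and changes nothing for [0 <= u]. *)
Let rate (u : R) : R := lambda0 * S (clamp (trajectory u)).

Let rate_continuous : continuous rate.
Proof. by move=> u; apply: cvgM; [exact: cvg_cst|exact: cSz]. Qed.

Let mrate D : measurable_fun D rate.
Proof. by apply: measurable_funTS; exact: continuous_measurable_fun. Qed.

Lemma survival_traj_bounds u : 0 <= S (clamp (trajectory u)) <= 1.
Proof.
by apply/andP; split; [apply: survival_ge0|apply: survival_le1] => //; exact: quad_clamp.
Qed.

Let rate_ge0 u : 0 <= rate u.
Proof. by rewrite mulr_ge0 ?(ltW lambda0_gt0)//; case/andP: (survival_traj_bounds u). Qed.

Let rate_int t : (\int[leb]_(u in `[0%R, t]) (rate u)%:E < +oo)%E.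
Proof.
have : leb.-integrable `[0%R, t] (EFin \o rate) by exact: integrable_continuous_segment.
move=> /integrableP[_]; apply: le_lt_trans; apply: ge0_le_integral_nonmeasurable.
  by move=> u _; rewrite lee_fin.
by move=> u _ /=; rewrite lee_fin ler_norm.
Qed.

Lemma fluid_measure_exists : exists mu : R -> finmeas R, forall t (A : set (R * R)),
  mu t A = (\int[leb]_(u in `[0%R, t] `&` trajectory @^-1` A)
    (lambda0 * S (clamp (trajectory u)))%:E)%E.
Proof.
suff H t : exists m : finmeas R, forall A : set (R * R),
    m A = (\int[leb]_(u in `[0%R, t] `&` trajectory @^-1` A) (rate u)%:E)%E.
  by have [mu Hmu] := choice H; exists mu.
have [m mE] := @weighted_image_measure _ _ _ _ R leb `[0, t]%classic rate trajectory
  (measurable_itv _) (@mrate _)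
  (fun u _ => rate_ge0 u) measurable_trajectory (rate_int t).
have m0 : m (~` quad) = 0%E.
  rewrite mE (_ : _ `&` _ = set0) ?integral_set0//.
  apply/seteqP; split => // u [/=]; rewrite in_itv /= => /andP[u0 _]; apply.
  exact: quad_trajectory.
by exists (FinMeas m0).
Qed.

End critical_age_theory.

(** * The candidate measure solves the fluid problem *)

Section fluid_measure.
Context {R : realType}.
Variables (lambda0 : R) (g : R * R -> R).
Hypotheses (lambda0_gt0 : 0 < lambda0) (g_density : is_density g)
  (Sg_C1 : C1_quad (survival g)).
Local Notation S := (survival g).
Local Notation leb := (@lebesgue_measure R).
Local Notation ys := (critical_age lambda0 g).
Local Notation tra := (trajectory lambda0 g).

Variable mu : R -> finmeas R.
Hypothesis muE : forall t (A : set (R * R)),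
  mu t A = (\int[leb]_(u in `[0%R, t] `&` tra @^-1` A) (lambda0 * S (clamp (tra u)))%:E)%E.

Let mtra : measurable_fun setT tra.
Proof. exact: measurable_trajectory. Qed.

Let qtra u : 0 <= u -> quad (tra u).
Proof. exact: quad_trajectory. Qed.

Let ctra u : 0 <= u -> clamp (tra u) = tra u.
Proof. exact: clamp_trajectory. Qed.

Let rate u := lambda0 * S (clamp (tra u)).

Let rate_ge0 u : 0 <= rate u.
Proof.
by rewrite mulr_ge0 ?(ltW lambda0_gt0)//; case/andP: (survival_traj_bounds lambda0 g_density u).
Qed.

Let rate_continuous : continuous rate.
Proof.
move=> u; apply: cvgM; first exact: cvg_cst.
apply: (@clamped_survival _ g Sg_C1 (cap lambda0 g)).
exact: cap_continuous.
Qed.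

Let mrate D : measurable_fun D rate.
Proof. by apply: measurable_funTS; exact: continuous_measurable_fun. Qed.

Let cap_quadE t : `[0, t]%classic `&` tra @^-1` quad = `[0, t]%classic.
Proof.
by apply/setIidl => u /=; rewrite in_itv /= => /andP[u0 _]; exact: qtra.
Qed.

Lemma pairing_fluid t f : measurable_fun quad f ->
  pairing f (mu t) = \int[leb]_(u in `[0, t]) (f (tra u) * (lambda0 * S (clamp (tra u)))).
Proof.
move=> mf; rewrite /pairing.
rewrite (@Rintegral_weighted_image _ _ _ _ R leb `[0, t]%classic rate tra (measurable_itv _)
  (@mrate _) (fun u _ => rate_ge0 u) mtra (mu t) (fun A _ => muE t A) quad f)//; last first.
  exact: measurable_quad.
by rewrite cap_quadE.
Qed.

Lemma fluid_measure0 : measure_eq (mu 0) mzero.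
Proof.
move=> A mA; suff: mu 0 A = 0%E by [].
rewrite muE; apply/eqP; rewrite eq_le; apply/andP; split; last first.
  by apply: integral_ge0 => u _; rewrite lee_fin; exact: rate_ge0.
apply: (@le_trans _ _ (\int[leb]_(u in `[0%R, 0%R]) (rate u)%:E)%E); last first.
  by rewrite set_itv1 integral_set1.
apply: ge0_subset_integral => //=.
- apply: measurableI => //; rewrite -[X in measurable X]setTI; exact: mtra.
- by apply/measurable_EFinP; exact: mrate.
- by move=> u _; rewrite lee_fin; exact: rate_ge0.
Qed.

Lemma fluid_measure_Ug t : mu t (quad `\` Ug g) = 0%E.
Proof.
rewrite muE integral0_eq// => u [/=]; rewrite in_itv /= => /andP[u0 _] [qu nU].
suff -> : S (clamp (tra u)) = 0 by rewrite mulr0.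
rewrite ctra//; apply/eqP; rewrite eq_le survival_ge0// andbT leNgt; apply/negP => h.
by apply: nU.
Qed.

Lemma fluid_measure_dominates t :
  content_dominates leb (fun A => mu t (nneg `*` A)).
Proof.
move=> A mA A0; rewrite muE.
have mB : measurable (`[0, t]%classic `&` tra @^-1` (nneg `*` A)).
  apply: measurableI => //; rewrite -[X in measurable X]setTI; apply: mtra => //.
  exact: measurable_nnegX.
apply: null_set_integral => //; first by apply/measurable_EFinP; exact: mrate.
apply/eqP; rewrite eq_le measure_ge0 andbT -A0; apply: le_measure; rewrite ?inE//.
by move=> u [_ [_]].
Qed.

(** Only the parameters up to both [t] and [y] contribute, and there the trajectory is still the
    diagonal. *)
Lemma fluid_mass t y : 0 <= t -> 0 <= y -> ((Num.min t y)%:E <= ys)%E ->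
  mu t (nneg `*` `[0, y]) = (served_mass lambda0 g (Num.min t y))%:E.
Proof.
move=> t0 y0 ty; set m := Num.min t y in ty *.
have m0 : 0 <= m by rewrite le_min t0 y0.
rewrite muE; have -> : `[0, t]%classic `&` tra @^-1` (nneg `*` `[0, y]) = `[0, m]%classic.
  apply/seteqP; split=> u /=; rewrite /trajectory /nneg /= !in_itv /= /m.
    by move=> [/andP[u0 ut] [_ /andP[_ uy]]]; rewrite u0 le_min ut uy.
  rewrite le_min => /and3P[u0 ut uy]; rewrite u0 ut uy andbT; split => //; split => //.
  by rewrite andbT; exact: cap_ge0.
have iS : leb.-integrable `[0, m] (EFin \o (fun u => S (clamp (tra u)))).
  apply: integrable_continuous_segment.
  by apply: (@clamped_survival _ g Sg_C1 (cap lambda0 g)); exact: cap_continuous.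
have -> : (\int[leb]_(u in `[0%R, m]) (lambda0 * S (clamp (tra u)))%:E =
  (lambda0 * \int[leb]_(u in `[0%R, m]) S (clamp (tra u)))%:E)%E.
  have <- : \int[leb]_(u in `[0, m]) (lambda0 * S (clamp (tra u))) =
      lambda0 * \int[leb]_(u in `[0, m]) S (clamp (tra u)) by exact: RintegralZl.
  rewrite /Rintegral fineK//.
  apply: integrable_fin_num => //; apply: integrable_continuous_segment.
  exact: rate_continuous.
apply: (congr1 (fun x => (lambda0 * x)%:E)); apply: eq_Rintegral => u.
rewrite inE /= in_itv /= => /andP[u0 um]; rewrite ctra// /trajectory cap_id//.
by apply: le_trans ty; rewrite lee_fin.
Qed.

Lemma ystar_fluid t : 0 <= t -> ystar (mu t) = if (t%:E < ys)%E then +oo%E else ys.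
Proof.
move=> t0; case: ifPn => [tys|].
  (* Before the critical age the total mass stays below one, so the infimum is over the empty
     set. *)
  rewrite /ystar (_ : [set _ | _ in _] = set0) ?ereal_inf0//.
  apply/seteqP; split=> // x [y [y0 Hy] _]; move: Hy; rewrite leNgt => /negP; apply.
  have mt : ((Num.min t y)%:E < ys)%E.
    by apply: le_lt_trans tys; rewrite lee_fin ge_min lexx.
  rewrite fluid_mass//; last exact: ltW.
  by rewrite lte_fin served_mass_lt1// le_min t0 y0.
rewrite -leNgt => yst; have := critical_age_gt0 lambda0_gt0 g_density Sg_C1.
case E : ys yst => [r| |]//; rewrite lee_fin lte_fin => rt r0.
apply/eqP; rewrite eq_le; apply/andP; split.
  apply: ereal_inf_lbound; exists r => //; split; first exact: ltW.
  have mr : Num.min t r = r by rewrite min_r.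
  rewrite fluid_mass ?mr ?E//; last exact: ltW.
  by rewrite lee_fin served_mass_ge1.
apply/ereal_infP => _ [y [y0 Hy] <-]; rewrite lee_fin leNgt; apply/negP => yr.
have my : Num.min t y = y by rewrite min_r// (le_trans (ltW yr)).
move: Hy; rewrite fluid_mass ?my ?E//; last by rewrite lee_fin ltW.
by rewrite lee_fin leNgt served_mass_lt1// E lte_fin.
Qed.

Let chi (u : R) : R := (u%:E <= ys)%E%:R.

(** Before time [ys] the threshold is infinite, but then every age [u <= s] is below [ys] anyway. On
    the support the indicator thus depends on the age alone, which makes the integrands jointly
    measurable in time and age. *)
Let rbar_fluid s u : 0 <= u -> u <= s -> rbar (mu s) (tra u) = chi u.
Proof.
move=> u0 us; rewrite /rbar /chi /=; congr (_%:R); congr nat_of_bool.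
rewrite ystar_fluid; last exact: le_trans us.
case: ifPn => // sys; rewrite leey; apply/esym/ltW.
by apply: le_lt_trans sys; rewrite lee_fin.
Qed.

Let chi_measurable : measurable_fun setT chi.
Proof.
have -> : chi = \1_[set u : R | (u%:E <= ys)%E].
  by apply/funext => u; rewrite indicE /chi; congr (_%:R); congr nat_of_bool;
    apply/idP/idP; rewrite inE.
apply: measurable_indic; have := critical_age_gt0 lambda0_gt0 g_density Sg_C1.
case: ys => [y| |]// _.
- rewrite (_ : [set _ | _] = `]-oo, y]%classic); first exact: measurable_itv.
  by apply/seteqP; split=> x; rewrite /= in_itv /= lee_fin.
- rewrite (_ : [set _ | _] = setT); first exact: measurableT.
  by apply/seteqP; split=> x //= _; rewrite leey.
Qed.

Let chi01 u : 0 <= chi u <= 1.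
Proof. by rewrite /chi ler0n /=; case: (_ <= _)%E. Qed.

(** Sends a pair of time and age to a point over the trajectory, clamped so that functions
    continuous on the octant pull back to continuous functions on the plane. *)
Let P (p : R * R) : R * (R * R) := (Num.max p.1 0, clamp (tra p.2)).

Let P_continuous : continuous P.
Proof.
move=> p.
have H1 : (fun w : R * R => Num.max w.1 0) @ p --> Num.max p.1 0.
  by apply: (@continuous_max _ _ fst (fun=> 0)); [exact: cvg_fst|exact: cvg_cst].
have ct : (fun u : R => (cap lambda0 g u, u)) @ p.2 --> (cap lambda0 g p.2, p.2).
  have idp : (fun v : R => v) @ p.2 --> p.2 by exact: cvg_id.
  exact: (cvg_pair (@cap_continuous _ _ _ lambda0_gt0 g_density Sg_C1 p.2) idp).
have H2 : (fun w : R * R => clamp (tra w.2)) @ p --> clamp (tra p.2).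
  apply: (@cvg_comp _ _ _ (fun w : R * R => tra w.2) clamp); last exact: clamp_continuous.
  by apply: (@cvg_comp _ _ _ snd tra); [exact: cvg_snd|exact: ct].
exact: cvg_pair H1 H2.
Qed.

Let P_octant p : octant (P p).
Proof.
by split; [rewrite /nneg /= in_itv /= le_max lexx orbT|exact: quad_clamp].
Qed.

Let P_id s u : 0 <= s -> 0 <= u -> P (s, u) = (s, tra u).
Proof. by move=> s0 u0; rewrite /P /= max_l// ctra. Qed.

Let comp_P (h : R * (R * R) -> R) : oct_continuous h -> continuous (h \o P).
Proof.
by move=> hc; apply: (continuous_comp_within P_continuous P_octant); exact/oct_continuousP.
Qed.

Let bounded_on_square (k : R * R -> R) t : continuous k -> exists C, forall s u,
  0 <= s <= t -> 0 <= u <= t -> `|k (s, u)| <= C.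
Proof.
move=> kc; pose Q : set (R * R) := `[0, t]%classic `*` `[0, t]%classic.
have cQ : compact (k @` Q).
  apply: continuous_compact; first exact: continuous_subspaceT.
  by apply: compact_setX; exact: segment_compact.
have [M [_ HM]] := compact_bounded cQ.
exists (M + 1) => s u st ut; apply: (HM (M + 1)); first by rewrite ltrDl.
by exists (s, u) => //; split; rewrite /= in_itv.
Qed.

(** The common form of the integrands: continuous up to a possible jump at the critical age, after
    which the terms in [x] are switched off. *)
Let switch (k1 k2 : R * R -> R) (p : R * R) : R := k1 p + chi p.2 * k2 p.

Let switch_measurable k1 k2 : continuous k1 -> continuous k2 ->
  measurable_fun setT (switch k1 k2).
Proof.
move=> c1 c2; apply: measurable_funD; first exact: continuous_measurable_plane.
apply: measurable_funM; last exact: continuous_measurable_plane.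
by apply: measurableT_comp => //; exact: measurable_snd.
Qed.

Let switch_bounded k1 k2 t : continuous k1 -> continuous k2 -> exists C, forall s u,
  0 <= s <= t -> 0 <= u <= t -> `|switch k1 k2 (s, u)| <= C.
Proof.
move=> c1 c2; have [C1 H1] := @bounded_on_square k1 t c1.
have [C2 H2] := @bounded_on_square k2 t c2.
exists (C1 + C2) => s u st ut; apply: le_trans (ler_normD _ _) _.
apply: lerD; first exact: H1.
rewrite normrM; have /andP[x0 x1] := chi01 u; rewrite ger0_norm//.
by apply: le_trans (H2 s u st ut); rewrite ler_piMl.
Qed.

Let switch_section_integrable k1 k2 s a b : continuous k1 -> continuous k2 ->
  0 <= s -> 0 <= a ->
  leb.-integrable `[a, b] (EFin \o (fun u => switch k1 k2 (s, u))).
Proof.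
move=> c1 c2 s0 a0.
have [C HC] := @switch_bounded k1 k2 (Num.max s b) c1 c2.
apply: measurable_bounded_integrable => //.
- by apply: compact_finite_measure; exact: segment_compact.
- have H : measurable_fun [set: R] (fun u : R => (s, u)).
    by apply: measurable_fun_pair; [exact: measurable_cst|exact: measurable_id].
  by apply: measurable_funTS; apply: (measurableT_comp (switch_measurable c1 c2) H).
exists C; split; first exact: num_real.
move=> M CM u /=; rewrite in_itv /= => /andP[au ub]; apply: le_trans (ltW CM).
by apply: HC; rewrite ?s0 le_max ?lexx ?(le_trans a0 au) ?ub ?orbT.
Qed.

Let switch_section s (k1 k2 : R * (R * R) -> R) : oct_continuous k1 -> oct_continuous k2 ->
  0 <= s ->
  leb.-integrable `[0, s] (EFin \o (fun u => k1 (s, tra u) + chi u * k2 (s, tra u))).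
Proof.
move=> c1 c2 s0.
have I := @switch_section_integrable _ _ s 0 s (comp_P c1) (comp_P c2) s0 (lexx 0).
apply: (@eq_integrable _ _ _ leb `[0, s]%classic (measurable_itv _) _ _ _ I).
by move=> u; rewrite inE /= in_itv /= => /andP[u0 _]; rewrite /switch /= P_id.
Qed.

Let path_served f fx fy s : C1_plane f fx fy -> 0 <= s -> (s%:E <= ys)%E ->
  \int[leb]_(u in `[0, s]) (fy (tra u) + chi u * fx (tra u)) = f (tra s) - f (tra 0).
Proof.
move=> Cf s0 sy.
have id_le u : u <= s -> tra u = (u, u) /\ chi u = 1.
  move=> us; have uy : (u%:E <= ys)%E by apply: le_trans sy; rewrite lee_fin.
  by rewrite /trajectory cap_id// /chi uy.
have [-> _] := id_le s (lexx s); have [-> _] := id_le 0 s0.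
rewrite -(integral_diagonal Cf s0); apply: eq_Rintegral => u.
rewrite inE /= in_itv /= => /andP[_ us]; have [-> ->] := id_le u us.
by rewrite mul1r addrC.
Qed.

(** The trajectory follows the diagonal up to the critical age and a vertical line afterwards, where
    the indicator removes [fx]; the fundamental theorem on the two pieces telescopes. *)
Lemma integral_trajectory f fx fy s : C1_plane f fx fy -> 0 <= s ->
  \int[leb]_(u in `[0, s]) (fy (tra u) + (u%:E <= ys)%E%:R * fx (tra u)) =
  f (tra s) - f (tra 0).
Proof.
move=> Cf s0; have [sy|] := leP s%:E ys; first exact: path_served.
have := critical_age_gt0 lambda0_gt0 g_density Sg_C1.
case E : ys => [r| |]//; rewrite !lte_fin => r0 rs.
have rE : ys = r%:E := E.
have cr u : r <= u -> tra u = (r, u) by move=> ru; rewrite /trajectory (cap_crit rE ru).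
pose k1 (p : R * (R * R)) := fy p.2; pose k2 (p : R * (R * R)) := fx p.2.
have c1 : oct_continuous k1 by apply: oct_continuous_snd; exact: C1_plane_cy Cf.
have c2 : oct_continuous k2 by apply: oct_continuous_snd; exact: C1_plane_cx Cf.
have I := switch_section c1 c2 s0; rewrite /k1 /k2 /= in I.
have rsle : r <= s := ltW rs.
have E1 : \int[leb]_(u in `[0, s]) (fy (tra u) + chi u * fx (tra u)) -
    \int[leb]_(u in `[0, r]) (fy (tra u) + chi u * fx (tra u)) =
    \int[leb]_(u in `]r, s]) (fy (tra u) + chi u * fx (tra u)).
  by apply: Rintegral_itvB I _ _; rewrite bnd_simp// ltW.
have E2 : \int[leb]_(u in `[0, r]) (fy (tra u) + chi u * fx (tra u)) = f (tra r) - f (tra 0).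
  by apply: path_served; rewrite ?rE// ltW.
have cfy : continuous (fun u => fy (clamp (r, u))).
  by apply: (@continuous_clamp_path R fy (fun=> r)); [exact: C1_plane_cy Cf|move=> ?; exact: cvg_cst].
have fyE u : r <= u -> fy (r, u) = fy (clamp (r, u)).
  by move=> ru; rewrite clamp_id//; apply/quadP; split => /=; [exact: ltW|rewrite (le_trans _ ru)// ltW].
have E3 : \int[leb]_(u in `]r, s]) (fy (tra u) + chi u * fx (tra u)) = f (tra s) - f (tra r).
  rewrite (cr s rsle) (cr r (lexx r)) -(integral_vertical Cf (ltW r0) (ltW r0) rsle).
  transitivity (\int[leb]_(u in `]r, s]) fy (clamp (r, u))).
    apply: eq_Rintegral => u; rewrite inE /= in_itv /= => /andP[ru _].
    by rewrite (cr u (ltW ru)) /chi rE lee_fin leNgt ru /= mul0r addr0 fyE// ltW.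
  transitivity (\int[leb]_(u in `[r, s]) fy (clamp (r, u))).
    apply: Rintegral_itv_obnd_cbnd.
    have I' : leb.-integrable `[r, s] (EFin \o (fun u => fy (clamp (r, u)))).
      exact: integrable_continuous_segment.
    apply: integrableS I' => //= x; exact: subset_itv_oc_cc.
  by apply: eq_Rintegral => u; rewrite inE /= in_itv /= => /andP[ru _]; rewrite fyE.
have -> : (fun u => fy (tra u) + (u%:E <= r%:E)%E%:R * fx (tra u)) =
  (fun u => fy (tra u) + chi u * fx (tra u)) by apply/funext => u; rewrite /chi rE.
lra.
Qed.

Lemma fluid_measure_cadlag : cadlag mu.
Proof.
have pairing_cont phi t : bounded_continuous phi -> 0 <= t ->
    (fun s => pairing phi (mu s)) @ t^'+ --> pairing phi (mu t) /\
    (0 < t -> (fun s => pairing phi (mu s)) @ t^'- --> pairing phi (mu t)).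
  move=> [cphi _] t0.
  pose k u := phi (clamp (tra u)) * rate u.
  have ck : continuous k.
    move=> u; apply: cvgM; last exact: rate_continuous.
    by apply: (@continuous_clamp_path R phi (cap lambda0 g)) => //; exact: cap_continuous.
  (* The pairing is the integral of a fixed continuous function up to [s], hence continuous in [s];
     both one-sided limits follow. *)
  have -> : (fun s => pairing phi (mu s)) =
      (parameterized_integral leb 0)^~ k.
    apply/funext => s; rewrite pairing_fluid; last exact: within_quad_measurable.
    apply: eq_Rintegral => u; rewrite inE /= in_itv /= => /andP[u0 _].
    by rewrite /k /rate ctra.
  have -> : pairing phi (mu t) = parameterized_integral leb 0 t k.
    rewrite pairing_fluid; last exact: within_quad_measurable.
    apply: eq_Rintegral => u; rewrite inE /= in_itv /= => /andP[u0 _].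
    by rewrite /k /rate ctra.
  have t10 : 0 < t + 1 by lra.
  have := @parameterized_integral_continuous R 0 (t + 1) k (ltW t10)
    (integrable_continuous_segment 0 (t + 1) ck).
  move=> /(continuous_within_itvP _ t10)[ci c0 _].
  have ct : 0 < t -> (parameterized_integral leb 0)^~ k @ t --> parameterized_integral leb 0 t k.
    move=> tpos; have tin : t \in `]0, (t + 1)[ by rewrite in_itv /= tpos ltrDl ltr01.
    exact: (ci t tin).
  split=> [|tpos]; last by apply: cvg_at_left_filter; exact: ct.
  move: t0; rewrite le_eqVlt => /predU1P[t00|tpos]; first by rewrite -t00 in c0 *.
  by apply: cvg_at_right_filter; exact: ct.
split=> t t0.
  by apply/finmeas_cvgP => phi bphi; have [h _] := pairing_cont phi t bphi t0.
exists (mu t); apply/finmeas_cvgP => phi bphi.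
by have [_ h] := pairing_cont phi t bphi (ltW t0); exact: h.
Qed.

(** The factor [S] in the rate turns the hazard into derivatives of [S], which are continuous also
    where [S] vanishes. *)
Let drift_rate_trajectory s u : 0 <= u -> u <= s ->
  drift_rate g (mu s) (tra u) * rate u =
  - lambda0 * (dy S (tra u) + chi u * dx S (tra u)).
Proof.
move=> u0 us; rewrite /rate ctra// mulrCA drift_rate_survival//; last exact: qtra.
rewrite rbar_fluid// mulrN mulNr; congr (- (lambda0 * _)).
by rewrite addrC.
Qed.

Let cSx : oct_continuous (fun p : R * (R * R) => dx S p.2).
Proof. by apply: oct_continuous_snd; case: Sg_C1. Qed.

Let cSy : oct_continuous (fun p : R * (R * R) => dy S p.2).
Proof. by apply: oct_continuous_snd; case: Sg_C1. Qed.

Lemma fluid_measure_drift t : 0 <= t ->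
  (\int[leb]_(s in `[0%R, t]) \int[mu s]_(z in quad) (drift_rate g (mu s) z)%:E < +oo)%E.
Proof.
move=> t0.
(* [C] bounds the derivative of [S] along the trajectory for ages up to [t], so the inner integral
   is at most [lambda0 * C * t]. *)
have [C HC] := @switch_bounded _ _ t (comp_P cSy) (comp_P cSx).
have C0 : 0 <= C by apply: le_trans (HC 0 0 _ _); rewrite ?lexx.
have leb_fin a : (leb `[0%R, a]%classic < +oo)%E.
  by apply: compact_finite_measure; exact: segment_compact.
apply: (@le_lt_trans _ _ (\int[leb]_(s in `[0%R, t]) (lambda0 * C * t)%:E)%E); last first.
  have I : leb.-integrable `[0%R, t] (EFin \o (fun=> lambda0 * C * t)).
    by apply: integrable_continuous_segment => x; exact: cvg_cst.
  move/integrableP : I => [_]; apply: le_lt_trans; apply: ge0_le_integral_nonmeasurable.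
    by move=> x _; rewrite lee_fin !mulr_ge0 ?(ltW lambda0_gt0).
  by move=> x _ /=; rewrite lee_fin ler_norm.
apply: ge0_le_integral_nonmeasurable => s.
  by move=> _; apply: integral_ge0 => z qz; rewrite lee_fin drift_rate_ge0.
rewrite /= in_itv /= => /andP[s0 st].
rewrite (@ge0_integral_weighted_image_in _ _ _ _ R leb `[0, s]%classic rate tra (measurable_itv _)
  (@mrate _) (fun u _ => rate_ge0 u) mtra (mu s) (fun A _ => muE s A) quad); last 3 first.
- exact: measurable_quad.
- by apply/measurable_EFinP; exact: measurable_drift_rate.
- by move=> z qz; rewrite lee_fin drift_rate_ge0.
rewrite cap_quadE.
apply: (@le_trans _ _ (\int[leb]_(u in `[0%R, s]) (lambda0 * C)%:E)%E).
  apply: ge0_le_integral_nonmeasurable => u; rewrite /= in_itv /= => /andP[u0 us].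
    by rewrite -EFinM lee_fin mulr_ge0 ?rate_ge0// drift_rate_ge0//; exact: qtra.
  rewrite -EFinM lee_fin drift_rate_trajectory// mulNr -mulrN ler_pM2l//.
  have ut : 0 <= u <= t by rewrite u0 (le_trans us).
  have := HC 0 u; rewrite lexx t0 => /(_ isT ut).
  by rewrite /switch /= ctra// => h; apply: le_trans h; rewrite -normrN ler_norm.
rewrite integral_cst//.
have L : leb `[0%R, s]%classic = s%:E by exact: lebesgue_segment.
apply: (@le_trans _ _ ((lambda0 * C)%:E * s%:E)%E).
  by apply: lee_wpmul2l; [rewrite lee_fin mulr_ge0// ltW|rewrite -L].
by rewrite -EFinM lee_fin ler_wpM2l// mulr_ge0// ltW.
Qed.

Lemma C1_oct_slice (f ft fx fy : R * (R * R) -> R) s : 0 <= s -> C1_oct f ft fx fy ->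
  C1_plane (fun z => f (s, z)) (fun z => fx (s, z)) (fun z => fy (s, z)).
Proof.
move=> s0 Cf.
have slice (h : R * (R * R) -> R) : oct_continuous h ->
    {within quad, continuous (fun z => h (s, z))}.
  move=> ch; apply/subspace_continuousP => z qz A Az.
  have osz : octant (s, z) by split; [rewrite /nneg /= in_itv /= s0|].
  have H : nbhs (s, z) (fun p => octant p -> A (h p)) := ch _ osz A Az.
  change (nbhs z (fun w => quad w -> A (h (s, w)))).
  have cp : (fun w : R * R => (s, w)) @ z --> (s, z).
    have cs : (fun _ : R * R => s) @ z --> s by exact: cvg_cst.
    have cz : (fun w : R * R => w) @ z --> z by exact: cvg_id.
    exact: (cvg_pair cs cz).
  have {}H : nbhs z (fun w => octant (s, w) -> A (h (s, w))) := cp _ H.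
  apply: filterS H => w Hw qw; apply: Hw; split => //.
  by rewrite /nneg /= in_itv /= s0.
have osz z : quad z -> octant (s, z) by move=> qz; split; [rewrite /nneg /= in_itv /= s0|].
split.
- exact: slice (C1_oct_cont Cf).
- exact: slice (C1_oct_cx Cf).
- exact: slice (C1_oct_cy Cf).
- by move=> z qz; exact: (C1_oct_x Cf (osz z qz)).
- by move=> z qz; exact: (C1_oct_y Cf (osz z qz)).
Qed.

Let oct_slice_measurable (h : R * (R * R) -> R) s : oct_continuous h -> 0 <= s ->
  measurable_fun quad (fun z => h (s, z)).
Proof.
move=> ch s0; apply: within_quad_measurable; apply/subspace_continuousP => z qz A Az.
have osz : octant (s, z) by split; [rewrite /nneg /= in_itv /= s0|].
have H : nbhs (s, z) (fun p => octant p -> A (h p)) := ch _ osz A Az.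
change (nbhs z (fun w => quad w -> A (h (s, w)))).
have cp : (fun w : R * R => (s, w)) @ z --> (s, z).
  have cs : (fun _ : R * R => s) @ z --> s by exact: cvg_cst.
  have cz : (fun w : R * R => w) @ z --> z by exact: cvg_id.
  exact: (cvg_pair cs cz).
have {}H : nbhs z (fun w => octant (s, w) -> A (h (s, w))) := cp _ H.
apply: filterS H => w Hw qw; apply: Hw; split => //.
by rewrite /nneg /= in_itv /= s0.
Qed.

Section weak_equation.
Variables (phi pt px py : R * (R * R) -> R) (t : R).
Hypotheses (Cphi : C1_oct phi pt px py) (t0 : 0 <= t).

Let psi := fun p => phi p * S p.2.
Let psit := fun p => pt p * S p.2.
Let psix := fun p => px p * S p.2 + phi p * dx S p.2.
Let psiy := fun p => py p * S p.2 + phi p * dy S p.2.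

Let Cpsi : C1_oct psi psit psix psiy.
Proof.
have := C1_octM Cphi (C1_oct_survival Sg_C1).
have -> // : (fun p => pt p * S p.2 + phi p * 0) = psit.
by apply/funext => p; rewrite mulr0 addr0.
Qed.

Let cphi := C1_oct_cont Cphi.
Let cS : oct_continuous (fun p : R * (R * R) => S p.2).
Proof. exact: C1_oct_cont (C1_oct_survival Sg_C1). Qed.

Let loss1 := fun p => phi p * dy S p.2.
Let loss2 := fun p => phi p * dx S p.2.
Let gain1 := fun p => (pt p + py p) * S p.2.
Let gain2 := fun p => px p * S p.2.
Let zero := fun _ : R * (R * R) => 0 : R.

Let closs1 : oct_continuous loss1. Proof. exact: oct_continuousM. Qed.
Let closs2 : oct_continuous loss2. Proof. exact: oct_continuousM. Qed.
Let cgain1 : oct_continuous gain1.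
Proof.
apply: oct_continuousM => //; apply: oct_continuousD; [exact: C1_oct_ct Cphi|exact: C1_oct_cy Cphi].
Qed.
Let cgain2 : oct_continuous gain2.
Proof. by apply: oct_continuousM => //; exact: C1_oct_cx Cphi. Qed.
Let cpsit : oct_continuous psit. Proof. exact: C1_oct_ct Cpsi. Qed.

Let flux (k1 k2 : R * (R * R) -> R) (s : R) : R :=
  \int[leb]_(u in `[0, s]) switch (k1 \o P) (k2 \o P) (s, u).

Let fluxE k1 k2 s : 0 <= s ->
  flux k1 k2 s = \int[leb]_(u in `[0, s]) (k1 (s, tra u) + chi u * k2 (s, tra u)).
Proof.
move=> s0; apply: eq_Rintegral => u; rewrite inE /= in_itv /= => /andP[u0 _].
by rewrite /switch /= !P_id.
Qed.

Let flux_integrable k1 k2 : oct_continuous k1 -> oct_continuous k2 ->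
  leb.-integrable `[0, t] (EFin \o flux k1 k2).
Proof.
move=> /comp_P c1 /comp_P c2; have [C HC] := @switch_bounded _ _ t c1 c2.
exact: (integrable_triangle t0 (switch_measurable c1 c2) HC).
Qed.

(** Product rule for [psi], which is [phi] times [S]: loss and gain combine into its full
    derivative, whose spatial part integrates along the trajectory at the fixed time [s]. *)
Let flux_add s : 0 <= s -> flux loss1 loss2 s + flux gain1 gain2 s =
  flux psit zero s + (psi (s, tra s) - psi (s, tra 0)).
Proof.
move=> s0; rewrite !fluxE//.
have Cs := C1_oct_slice s0 Cpsi; rewrite -(integral_trajectory Cs s0).
have cz : oct_continuous zero by exact: oct_continuous_cst.
have cx := C1_oct_cx Cpsi; have cy := C1_oct_cy Cpsi.
rewrite -RintegralD//; [|exact: switch_section|exact: switch_section].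
rewrite -RintegralD//; [|exact: switch_section|exact: (switch_section cy cx)].
apply: eq_Rintegral => u _; rewrite /loss1 /loss2 /gain1 /gain2 /psit /psix /psiy /zero /=.
by rewrite /chi; ring.
Qed.

(** After exchanging the integrals the age [u] is fixed and the time runs from [u] to [t], so the
    time derivative integrates exactly. *)
Let flux_time : \int[leb]_(s in `[0, t]) flux psit zero s =
  \int[leb]_(u in `[0, t]) (psi (t, tra u) - psi (u, tra u)).
Proof.
have cz : oct_continuous zero by exact: oct_continuous_cst.
have c1 := comp_P cpsit; have c2 := comp_P cz.
have [C HC] := @switch_bounded _ _ t c1 c2.
rewrite (Fubini_triangle t0 (switch_measurable c1 c2) HC).
apply: eq_Rintegral => u; rewrite inE /= in_itv /= => /andP[u0 ut].
transitivity (\int[leb]_(s in `[u, t]) psit (s, tra u)).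
  apply: eq_Rintegral => s; rewrite inE /= in_itv /= => /andP[us st].
  by rewrite /switch /= /zero mulr0 addr0 P_id// (le_trans u0).
apply: (@FTC_segment _ (fun s => psit (s, tra u)) (fun s => psi (s, tra u))) => //.
- apply: (@eq_within_segment _ _ (fun s => (psit \o P) (s, u))).
    move=> s; apply: (@cvg_comp _ _ _ (fun s : R => (s, u)) (psit \o P)); last exact: c1.
    have ids : (fun v : R => v) @ s --> s by exact: cvg_id.
    have cu : (fun _ : R => u) @ s --> u by exact: cvg_cst.
    exact: (cvg_pair ids cu).
  by move=> s /andP[us _]; rewrite /= P_id// (le_trans u0).
- apply: (@eq_within_segment _ _ (fun s => (psi \o P) (s, u))).
    move=> s; apply: (@cvg_comp _ _ _ (fun s : R => (s, u)) (psi \o P)).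
      have ids : (fun v : R => v) @ s --> s by exact: cvg_id.
      have cu : (fun _ : R => u) @ s --> u by exact: cvg_cst.
      exact: (cvg_pair ids cu).
    exact: (comp_P (C1_oct_cont Cpsi)).
  by move=> s /andP[us _]; rewrite /= P_id// (le_trans u0).
- move=> s us _; apply: is_derive_nneg_is_derive; first exact: le_lt_trans us.
  apply: (C1_oct_t Cpsi (p := (s, tra u))); split; last exact: qtra.
  by rewrite /nneg /= in_itv /= andbT (le_trans u0)// ltW.
Qed.

Let boundary_continuous (a b : R -> R) : continuous a -> continuous b ->
  continuous (fun u => psi (P (a u, b u))).
Proof.
move=> ca cb u; apply: (@cvg_comp _ _ _ (fun u : R => (a u, b u)) (psi \o P)).
  exact: (cvg_pair (ca u) (cb u)).
exact: (comp_P (C1_oct_cont Cpsi)).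
Qed.

Lemma fluid_weak_equation :
  pairing (fun z => phi (t, z)) (mu t) =
  lambda0 * \int[leb]_(s in `[0, t]) phi (s, (0, 0))
  - \int[leb]_(s in `[0, t]) pairing (fun z => phi (s, z) * drift_rate g (mu s) z) (mu s)
  + \int[leb]_(s in `[0, t])
     pairing (fun z => pt (s, z) + rbar (mu s) z * px (s, z) + py (s, z)) (mu s).
Proof.
have cz : oct_continuous zero by exact: oct_continuous_cst.
have cid : continuous (id : R -> R) by move=> u; exact: cvg_id.
have ccst (k : R) : continuous (fun _ : R => k) by move=> u; exact: cvg_cst.
have JI := fun a b ca cb => integrable_continuous_segment 0 t (@boundary_continuous a b ca cb).
have J1 := JI _ _ (ccst t) cid; have J2 := JI _ _ cid cid; have J3 := JI _ _ cid (ccst 0).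
have bE (s u : R) : 0 <= s -> 0 <= u -> psi (P (s, u)) = psi (s, tra u).
  by move=> s0 u0; rewrite P_id.
have inP (s : R) : s \in `[0, t]%classic -> 0 <= s /\ s <= t.
  by rewrite inE /= in_itv /= => /andP[].
(* The integrals of [psi] over the edges of the triangle [0 <= u <= s <= t]: [I1] on [s = t] is the
   current state, [I3] on [u = 0] the arrivals, and [I2] on [u = s] cancels between the time and the
   space contributions. *)
pose I1 := \int[leb]_(u in `[0, t]) psi (P (t, u)).
pose I2 := \int[leb]_(u in `[0, t]) psi (P (u, u)).
pose I3 := \int[leb]_(u in `[0, t]) psi (P (u, 0)).
have E0 : pairing (fun z => phi (t, z)) (mu t) = lambda0 * I1.
  rewrite pairing_fluid; last exact: oct_slice_measurable.
  rewrite /I1 -RintegralZl//; apply: eq_Rintegral => u /inP[u0 _].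
  by rewrite bE// /psi /= ctra//; ring.
have E1 : \int[leb]_(s in `[0, t]) phi (s, (0, 0)) = I3.
  apply: eq_Rintegral => s /inP[s0 _]; rewrite bE// /psi /=.
  have -> : tra 0 = (0, 0).
    by rewrite /trajectory cap_id// ltW// critical_age_gt0.
  by rewrite survival0// mulr1.
have FA := flux_integrable closs1 closs2; have FB := flux_integrable cgain1 cgain2.
have E2 : \int[leb]_(s in `[0, t]) pairing (fun z => phi (s, z) * drift_rate g (mu s) z) (mu s) =
    - lambda0 * \int[leb]_(s in `[0, t]) flux loss1 loss2 s.
  rewrite -RintegralZl//; apply: eq_Rintegral => s /inP[s0 _].
  rewrite pairing_fluid; last first.
    apply: measurable_funM; first exact: oct_slice_measurable.
    exact: measurable_drift_rate.
  rewrite fluxE// -RintegralZl//; last exact: switch_section.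
  apply: eq_Rintegral => u; rewrite inE /= in_itv /= => /andP[u0 us].
  by rewrite -mulrA drift_rate_trajectory// /loss1 /loss2 /=; ring.
have E3 : \int[leb]_(s in `[0, t])
     pairing (fun z => pt (s, z) + rbar (mu s) z * px (s, z) + py (s, z)) (mu s) =
    lambda0 * \int[leb]_(s in `[0, t]) flux gain1 gain2 s.
  rewrite -RintegralZl//; apply: eq_Rintegral => s /inP[s0 _].
  rewrite pairing_fluid; last first.
    apply: measurable_funD; last exact: oct_slice_measurable (C1_oct_cy Cphi) s0.
    apply: measurable_funD; first exact: oct_slice_measurable (C1_oct_ct Cphi) s0.
    apply: measurable_funM; first exact: measurable_rbar.
    exact: oct_slice_measurable (C1_oct_cx Cphi) s0.
  rewrite fluxE// -RintegralZl//; last exact: switch_section.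
  apply: eq_Rintegral => u; rewrite inE /= in_itv /= => /andP[u0 us].
  by rewrite rbar_fluid// ctra// /gain1 /gain2 /=; ring.
have E4 : \int[leb]_(s in `[0, t]) flux loss1 loss2 s +
    \int[leb]_(s in `[0, t]) flux gain1 gain2 s = I1 - I3.
  rewrite -RintegralD//.
  transitivity (\int[leb]_(s in `[0, t]) (flux psit zero s +
      (psi (P (s, s)) - psi (P (s, 0))))).
    by apply: eq_Rintegral => s /inP[s0 _]; rewrite flux_add// !bE.
  have J23 : leb.-integrable `[0, t] (EFin \o (fun s => psi (P (s, s)) - psi (P (s, 0)))).
    apply: integrable_continuous_segment => s.
    by apply: cvgB; [exact: (boundary_continuous cid cid)|exact: (boundary_continuous cid (ccst 0))].
  have FE := flux_integrable cpsit cz.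
  rewrite RintegralD// RintegralB// flux_time.
  have -> : \int[leb]_(u in `[0, t]) (psi (t, tra u) - psi (u, tra u)) = I1 - I2.
    transitivity (\int[leb]_(u in `[0, t]) (psi (P (t, u)) - psi (P (u, u)))).
      by apply: eq_Rintegral => u /inP[u0 _]; rewrite !bE.
    exact: RintegralB.
  exact: (subrKA I2 I1 (- I3)).
have arith (l i1 i3 a b : R) : a + b = i1 - i3 -> l * i1 = l * i3 - (- l * a) + l * b.
  by move=> E; have -> : i1 = i3 + (a + b) by [rewrite E; ring]; ring.
by rewrite E0 E1 E2 E3; exact: arith E4.
Qed.

End weak_equation.

Lemma fluid_measure_solution : fluid_solution lambda0 g mu.
Proof.
split.
- exact: fluid_measure_cadlag.
- by move=> t _; exact: fluid_measure_Ug.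
- by move=> t _; exact: fluid_measure_dominates.
- exact: fluid_measure_drift.
- move=> t phi t0 [/C1_octant_oct Cphi _]; rewrite /fluid_eq.
  rewrite (measure_eq0_pairing _ fluid_measure0) add0r.
  exact: fluid_weak_equation.
Qed.

Lemma pairing_fluid_continuous t f : {within quad, continuous f} ->
  pairing f (mu t) = lambda0 * \int[leb]_(u in `[0, t]) (f (tra u) * S (tra u)).
Proof.
move=> cf; rewrite pairing_fluid; last exact: within_quad_measurable.
pose k u := f (clamp (tra u)) * S (clamp (tra u)).
have ck : continuous k.
  move=> u; apply: cvgM.
    by apply: (@continuous_clamp_path R f (cap lambda0 g)) => //; exact: cap_continuous.
  by apply: (@clamped_survival _ g Sg_C1 (cap lambda0 g)); exact: cap_continuous.
transitivity (\int[leb]_(u in `[0, t]) (lambda0 * k u)).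
  apply: eq_Rintegral => u; rewrite inE /= in_itv /= => /andP[u0 _].
  by rewrite /k ctra// mulrCA.
transitivity (lambda0 * \int[leb]_(u in `[0, t]) k u).
  by apply: RintegralZl => //; exact: integrable_continuous_segment.
apply: (congr1 (fun x => lambda0 * x)); apply: eq_Rintegral => u.
by rewrite inE /= in_itv /= => /andP[u0 _]; rewrite /k ctra.
Qed.

End fluid_measure.

(** * Uniqueness: the thresholds of an arbitrary solution *)

Section uniqueness.
Context {R : realType}.
Variables (lambda0 : R) (g : R * R -> R).
Hypotheses (lambda0_gt0 : 0 < lambda0) (g_density : is_density g)
  (Sg_C1 : C1_quad (survival g)).
Local Notation S := (survival g).
Local Notation leb := (@lebesgue_measure R).
Local Notation ys := (critical_age lambda0 g).
Local Notation tra := (trajectory lambda0 g).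

Variable mu : R -> finmeas R.
Hypothesis muE : forall t (A : set (R * R)),
  mu t A = (\int[leb]_(u in `[0%R, t] `&` tra @^-1` A) (lambda0 * S (clamp (tra u)))%:E)%E.

Let Smu : null_solution lambda0 g mu.
Proof. by split; [exact: fluid_measure_solution|exact: fluid_measure0 muE]. Qed.

Let ystar_mu s : 0 <= s -> (ys <= ystar (mu s))%E.
Proof.
move=> s0; rewrite (ystar_fluid lambda0_gt0 g_density Sg_C1 muE s0).
by case: ifP => // _; rewrite leey.
Qed.

Let mX (B : set R) : measurable B -> measurable (nneg `*` B : set (R * R)).
Proof. exact: measurable_nnegX. Qed.

(* If [r], the infimum of the thresholds up to [t0], were less than [ys], then
   [nu] would agree with [mu] below age [r], and the age density bound would
   keep the mass up to age [r + e] below one for some [e > 0]. *)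
Lemma critical_age_le_ystar nu t0 : null_solution lambda0 g nu -> 0 <= t0 ->
  (ys <= ystar (nu t0))%E.
Proof.
move=> Snu t00; rewrite leNgt; apply/negP => lt_ys.
pose m := ereal_inf [set ystar (nu s) | s in [set s | 0 <= s <= t0]].
have m_le s : 0 <= s -> s <= t0 -> (m <= ystar (nu s))%E.
  by move=> s0 st; apply: ereal_inf_lbound; exists s => //=; rewrite s0.
have m_ys : (m < ys)%E by apply: le_lt_trans lt_ys; exact: m_le.
have m0 : (0 <= m)%E.
  apply/ereal_infP => _ [s _ <-]; apply/ereal_infP => _ [y [y0 _] <-].
  by rewrite lee_fin.
have [r E] : exists r, m = r%:E.
  by exists (fine m); rewrite fineK// ge0_fin_numE//; apply: lt_le_trans m_ys _; rewrite leey.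
move: m0 m_ys; rewrite E lee_fin => r0 r_ys.
have G1 : served_mass lambda0 g r < 1 by exact: served_mass_lt1.
(* The strip of ages [[r, r + e]], taken with margin [e] in [age_mass_le], has mass at most
   [3 * lambda0 * e], half of the gap between the served mass and one. *)
pose e := (1 - served_mass lambda0 g r) / (6 * lambda0).
have e0 : 0 < e by rewrite divr_gt0 ?subr_gt0// mulr_gt0.
have mass (s : R) : 0 <= s -> s <= t0 -> (nu s (nneg `*` `[0%R, (r + e)%R]) < 1)%E.
  move=> s0 st.
  have agree : nu s (nneg `*` `[0%R, r[) = mu s (nneg `*` `[0%R, r[).
    apply: (agree_below_thresholds g_density Sg_C1 Snu Smu s0 (M := m)).
    - by move=> s' s'0 s's; apply: m_le => //; exact: le_trans st.
    - move=> s' s'0 _; apply: le_trans (ystar_mu s'0).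
      by rewrite E; exact: ltW.
    - by apply: mX; exact: measurable_itv.
    - by move=> z [_ /=]; rewrite in_itv /= E lte_fin => /andP[].
  have mur : (mu s (nneg `*` `[0%R, r[) <= (served_mass lambda0 g r)%:E)%E.
    apply: (@le_trans _ _ (mu s (nneg `*` `[0%R, r]))).
      apply: le_measure; rewrite ?inE; try by apply: mX; exact: measurable_itv.
      by move=> z [? /=]; rewrite in_itv /= => /andP[z0 zr]; split => //=; rewrite in_itv /= z0 ltW.
    have ms : ((Num.min s r)%:E <= ys)%E.
      by apply: ltW; apply: le_lt_trans r_ys; rewrite lee_fin ge_min lexx orbT.
    rewrite (fluid_mass lambda0_gt0 g_density Sg_C1 muE s0 r0 ms) lee_fin.
    have sr0 : 0 <= Num.min s r by rewrite le_min s0 r0.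
    have srr : Num.min s r <= r by rewrite ge_min lexx orbT.
    by case/andP: (served_mass_le lambda0_gt0 g_density Sg_C1 sr0 srr).
  have re : r <= r + e by rewrite lerDl ltW.
  have strip := age_mass_le lambda0_gt0 g_density Sg_C1 Snu.1 Snu.2 s0 r0 re e0.
  apply: (@le_lt_trans _ _ (nu s ((nneg `*` `[0%R, r[) `|` (nneg `*` `[r, (r + e)%R])))).
    apply: le_measure; rewrite ?inE; [|apply: measurableU|]; try by apply: mX; exact: measurable_itv.
    move=> z [z1 /=]; rewrite in_itv /= => /andP[z0 zr].
    have [h|h] := ltP z.2 r; [left|right]; split => //=; rewrite in_itv /= ?z0 ?h//.
  apply: (@le_lt_trans _ _ (nu s (nneg `*` `[0%R, r[) + nu s (nneg `*` `[r, (r + e)%R]))%E).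
    by apply: measureU2; apply: mX; exact: measurable_itv.
  rewrite agree; apply: (le_lt_trans (leeD mur strip)).
  rewrite -EFinD lte_fin.
  have -> : lambda0 * (r + e - r + 2 * e) = (1 - served_mass lambda0 g r) / 2.
    by rewrite /e; field; rewrite gt_eqF.
  lra.
(* As mass one needs ages beyond [r + e] at all times up to [t0], the infimum [m] of the thresholds
   cannot be [r]. *)
have : ((r + e)%:E <= m)%E.
  apply/ereal_infP => _ [s /= /andP[s0 st] <-]; apply/ereal_infP => _ [y [y0 Hy] <-].
  rewrite lee_fin leNgt; apply/negP => yr.
  have := mass s s0 st; rewrite ltNge => /negP; apply; apply: le_trans Hy _.
  apply: le_measure; rewrite ?inE; try by apply: mX; exact: measurable_itv.
  move=> z [? /=]; rewrite in_itv /= => /andP[z0 zy]; split => //=.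
  by rewrite in_itv /= z0 (le_trans zy)// ltW.
by rewrite E lee_fin leNgt ltrDl e0.
Qed.

Let settled_mu r : ys = r%:E -> settled r mu.
Proof.
move=> yr; split.
- by move=> s s0; rewrite -yr; exact: ystar_mu.
- move=> s rs; have r0 : 0 < r by rewrite -lte_fin -yr critical_age_gt0.
  rewrite (ystar_fluid lambda0_gt0 g_density Sg_C1 muE (le_trans (ltW r0) rs)).
  by rewrite yr lte_fin ltNge rs.
- move=> s s0; rewrite muE (_ : _ `&` _ = set0) ?integral_set0//.
  apply/seteqP; split => // u [_ [_ /= ur]]; rewrite /trajectory cap_id ?eqxx//.
  by rewrite yr lee_fin ltW.
Qed.

(** The upper bound on the thresholds is carried over from [mu]: below age [r] the two solutions
    agree, the line at age [r] is null for [mu], and from time [r] on [mu] has mass at least one on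
    ages up to [r]. The diagonal support is inherited through the same agreement. *)
Let settled_null_solution nu r : ys = r%:E -> null_solution lambda0 g nu -> settled r nu.
Proof.
move=> yr Snu; have [M1 M2 M3] := settled_mu yr.
have r0 : 0 < r by rewrite -lte_fin -yr critical_age_gt0.
have H1 s : 0 <= s -> (r%:E <= ystar (nu s))%E.
  by move=> s0; rewrite -yr; exact: critical_age_le_ystar.
have agree s (A : set (R * R)) : 0 <= s -> measurable A ->
    A `<=` [set z | (z.2%:E < r%:E)%E] -> nu s A = mu s A.
  move=> s0; apply: (agree_below_thresholds g_density Sg_C1 Snu Smu s0).
    by move=> s' s'0 _; exact: H1.
  by move=> s' s'0 _; exact: M1.
split => //.
- move=> s rs; have s0 : 0 <= s by apply: le_trans rs; exact: ltW.
  apply: ereal_inf_lbound; exists r => //; split; first exact: ltW.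
  apply: (@le_trans _ _ (mu s (nneg `*` `[0%R, r]))).
    have mr : Num.min s r = r by rewrite min_r.
    rewrite (fluid_mass lambda0_gt0 g_density Sg_C1 muE s0 (ltW r0)) ?mr ?yr//.
    by rewrite lee_fin served_mass_ge1.
  apply: (@le_trans _ _ (mu s (nneg `*` `[0%R, r[))).
    apply: (@le_trans _ _ (mu s ((nneg `*` `[0%R, r[) `|` (nneg `*` `[r, r])))).
      apply: le_measure; rewrite ?inE; [|apply: measurableU|]; try by apply: mX; exact: measurable_itv.
      move=> z [z1 /=]; rewrite in_itv /= => /andP[z0 zr].
      have [h|h] := ltP z.2 r; [left|right]; split => //=; rewrite in_itv /= ?z0 ?h//.
    apply: le_trans (measureU2 _ _ _) _; try by apply: mX; exact: measurable_itv.
    have line := age_mass_line lambda0_gt0 g_density Sg_C1 Smu.1 Smu.2 r s0.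
    by rewrite -[leRHS]adde0 -line.
  rewrite -agree//; last 2 first.
  - by apply: mX; exact: measurable_itv.
  - by move=> z [_ /=]; rewrite in_itv /= lte_fin => /andP[].
  apply: le_measure; rewrite ?inE; try by apply: mX; exact: measurable_itv.
  by move=> z [? /=]; rewrite in_itv /= => /andP[z0 zr]; split => //=; rewrite in_itv /= z0 ltW.
- move=> s s0; rewrite agree//; first exact: M3.
    exact: measurable_off_diagonal.
  by move=> z [_ + _] /=; rewrite lte_fin.
Qed.

Lemma null_solution_unique nu t : null_solution lambda0 g nu -> 0 <= t ->
  measure_eq (nu t) (mu t).
Proof.
move=> Snu t0 A mA; have := critical_age_gt0 lambda0_gt0 g_density Sg_C1.
case E : ys => [r| |]//.
  rewrite lte_fin => r0.
  exact: (agree_settled lambda0_gt0 g_density Sg_C1 Snu Smu t0 r0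
    (settled_null_solution E Snu) (settled_mu E) mA).
move=> _.
(* With an infinite critical age the characteristics have no kink, and the comparison without
   smoothing reaches all ages. *)
apply: (agree_below_thresholds g_density Sg_C1 Snu Smu t0 (M := +oo%E)) => //.
- by move=> s s0 _; rewrite -E; exact: critical_age_le_ystar.
- by move=> s s0 _; rewrite -E; exact: ystar_mu.
- by move=> z _ /=; rewrite ltry.
Qed.

End uniqueness.

(** * Measures determined by bounded continuous functions *)

Section determined_by_pairings.
Context {R : realType}.

(** The squeezing argument with weight 1, since products of cutoffs are bounded and continuous. *)
Lemma eq_pairing_measure (m1 m2 : finmeas R) :
  (forall phi, bounded_continuous phi -> pairing phi m1 = pairing phi m2) ->
  measure_eq m1 m2.
Proof.
move=> H A mA.
have mq := @measurable_quad R.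
have cq n (B : set (R * R)) : measurable B ->
    m1 (B `&` (quad `&` corner n.+1%:R n.+1%:R)) = m2 (B `&` (quad `&` corner n.+1%:R n.+1%:R)).
  apply: (@squeezed_measure_unique _ m1 m2 (fun=> 1) _ _ 1) => //.
  - by move=> z _ _; rewrite ltr01 lexx.
  move=> a b p p' _ _ /andP[_ pa] /andP[_ p'b].
  exists (cut p a), (cut p' b); split; try exact: between_cut.
  apply: H; split.
    apply: continuous_subspaceT => z; apply: cvgM; last exact: cvg_cst.
    apply: cvgM.
      apply: (@cvg_comp _ _ _ fst (cut p a)); first exact: cvg_fst.
      exact: (C1_fun_continuous (C1_fun_cut pa)).
    apply: (@cvg_comp _ _ _ snd (cut p' b)); first exact: cvg_snd.
    exact: (C1_fun_continuous (C1_fun_cut p'b)).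
  exists 1; split; first exact: num_real.
  move=> M M1 z _ /=; rewrite mulr1 ger0_norm; last by apply: mulr_ge0; exact: cut_ge0.
  apply: le_trans (ltW M1); apply: mulr_ile1; by [exact: cut_ge0|exact: cut_le1].
have off (m : finmeas R) : m A = m (A `&` quad).
  rewrite -[in LHS](setIT A) -(setUv quad) setIUr measureU//; last 3 first.
  - exact: measurableI.
  - by apply: measurableI => //; exact: measurableC.
  - by rewrite setIACA setICr setI0.
  rewrite [X in (_ + X)%E](_ : _ = 0%E) ?adde0//; apply/eqP.
  rewrite eq_le measure_ge0 andbT -(finmeas_quad m).
  apply: le_measure; rewrite ?inE; [|exact: measurableC|exact: subIsetr].
  by apply: measurableI => //; exact: measurableC.
suff : m1 (A `&` quad) = m2 (A `&` quad) by rewrite -!off.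
apply: (@eq_measure_bigcup _ m1 m2 (fun n => quad `&` corner n.+1%:R n.+1%:R)).
- by move=> n; apply: measurableI => //; exact: measurable_corner.
- by move=> n B mB; exact: cq.
- exact: measurableI.
move=> z [_ qz]; exists (Num.truncn (`|z.1| + `|z.2|)) => //; split => //.
have := truncnS_gt (`|z.1| + `|z.2|) => h.
have := ler_norm z.1; have := ler_norm z.2.
have := normr_ge0 z.1; have := normr_ge0 z.2.
by move=> *; apply/cornerP; split; lra.
Qed.

End determined_by_pairings.

Unset Implicit Arguments.

Theorem theorem3p4 (R : realType) (lambda0 : R) (g : R * R -> R)
  (lambda0_gt0 : 0 < lambda0) (g_density : is_density g)
  (g_locbnd : locally_bounded_Ug g) (Sg_C1 : C1_quad (survival g)) :
  let ys := critical_age lambda0 g in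
  let cap (u : R) : R := fine (mine u%:E ys) in
  exists mu : R -> finmeas R,
    [/\ fluid_solution lambda0 g mu /\ measure_eq (mu 0) mzero,
        forall nu : R -> finmeas R,
          fluid_solution lambda0 g nu -> measure_eq (nu 0) mzero ->
          forall t : R, 0 <= t -> measure_eq (nu t) (mu t),
        forall t : R, 0 <= t ->
          ystar (mu t) = if (t%:E < ys)%E then +oo%E else ys
      & forall t : R, 0 <= t -> forall m : finmeas R,
          measure_eq m (mu t) <->
          (forall phi, bounded_continuous phi ->
             pairing phi m =
             lambda0 * \int[lebesgue_measure]_(u in `[0, t])
               (phi (cap u, u) * survival g (cap u, u)))].
Proof.
move=> ys cap0.
have [mu muE] := fluid_measure_exists lambda0_gt0 g_density Sg_C1.
exists mu; split.
- by split; [exact: fluid_measure_solution|exact: fluid_measure0 muE].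
- move=> nu nu_sol nu0 t t0.
  exact: (null_solution_unique lambda0_gt0 g_density Sg_C1 muE (conj nu_sol nu0) t0).
- by move=> t t0; exact: ystar_fluid.
move=> t t0 m; split=> [m_mu phi [cphi _]|m_phi].
  rewrite -(pairing_fluid_continuous lambda0_gt0 g_density Sg_C1 muE t cphi).
  rewrite /pairing /Rintegral; congr fine.
  by apply: eq_measure_integral => A mA _; exact: m_mu.
apply: eq_pairing_measure => phi bphi; rewrite m_phi//.
exact/esym/(pairing_fluid_continuous lambda0_gt0 g_density Sg_C1 muE t bphi.1).
Qed.
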